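(* Fix $\mathrm{acv}_0>0$, $\mathrm{arb}_0\in(0,1)$ and $b\ge0$. For $\zeta\in[0,1]$ let $\nu^\dagger=\log_\zeta\mathrm{arb}_0+b$, let $\theta=(\zeta,\mathrm{acv}_0,\mathrm{arb}_0,b)$, and let $(n_1^{\mathrm{opt}},n_2^{\mathrm{opt}})(\theta)$ denote the optimal sample sizes for $\mathscr T_{\nu^\dagger}$ (see context), as a function of $\theta$, that also satisfy $\operatorname{ACV}\mathscr T_{\nu^\dagger}(n_1^{\mathrm{opt}},n_2^{\mathrm{opt}}\mid\theta)=\mathrm{acv}_0$ and $\operatorname{ARB}\mathscr T_{\nu^\dagger}=\mathrm{arb}_0\zeta^b$. Let $\zeta_{b,1}=\mathrm{arb}_0^{1/(1-b)}$ if $b<1$ and $\zeta_{b,1}=0$ if $b\ge1$. Then for $\zeta\in\{0,\zeta_{b,1}\}$, $$(n_1^{\mathrm{opt}},n_2^{\mathrm{opt}})(\theta)=(2\,\mathrm{acv}_0^{-2}+5,\;1).$$ Likewise, for all remaining $\zeta\in[0,1]\setminus\{0,\zeta_{b,1}\}$, $$(n_1^{\mathrm{opt}},n_2^{\mathrm{opt}})(\theta)=(2\alpha_1^{\mathrm{opt}}+1,\;2\alpha_2^{\mathrm{opt}}+1)(\theta),$$ where $\alpha_1^{\mathrm{opt}}$ and $\alpha_2^{\mathrm{opt}}$ satisfy $$\partial_{\alpha_2}\operatorname{ACV}^2\mathscr T_{\nu^\dagger}(\mathrm A-\alpha_2,\alpha_2\mid\theta)\Big|_{(\mathrm A,\alpha_2)=(\alpha_1^{\mathrm{opt}}+\alpha_2^{\mathrm{opt}},\,\alpha_2^{\mathrm{opt}})}=0,\qquad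 \operatorname{ACV}^2\mathscr T_{\nu^\dagger}(\alpha_1^{\mathrm{opt}},\alpha_2^{\mathrm{opt}}\mid\theta)-\mathrm{acv}_0^2=0 ,$$ $\operatorname{ACV}^2\mathscr T_{\nu^\dagger}(\alpha_1,\alpha_2\mid\theta)$ denoting the squared absolute coefficient of variation as a function of $\alpha_i=(n_i-1)/2$.
   Context: $\mathscr T_\nu$ is an estimator of $(\kappa_1-\kappa_2)^{-1}$ based on two independent gamma variables $Y_i$ (sample variances of normal samples of sizes $n_i$) with shape $\alpha_i=(n_i-1)/2$ and rate $\alpha_i/\kappa_i$, $\zeta=\kappa_2/\kappa_1$: $$\mathscr T_\nu=\frac{\alpha_1-1}{\alpha_1Y_1}\Bigl({}_2F_1(1,2-\alpha_1;\alpha_2;-Z)-\frac{Z^\nu}{(\alpha_1-1)_{-\nu}(\alpha_2)_\nu}{}_2F_1(1,2-\alpha_1+\nu;\alpha_2+\nu;-Z)\Bigr),\quad Z=\frac{\alpha_2Y_2}{\alpha_1Y_1},\quad (s)_w=\frac{\Gamma(s+w)}{\Gamma(s)} .$$ It has absolute relative bias $\operatorname{ARB}\mathscr T_\nu=\zeta^\nu$ (so $\operatorname{ARB}\mathscr T_{\nu^\dagger}=\mathrm{arb}_0\zeta^b$ automatically), and its absolute coefficient of variation $\operatorname{ACV}=\sqrt{\operatorname{Var}}/|\mathsf E|$ is given by $$\operatorname{ACV}^2\mathscr T_\nu(\alpha_1,\alpha_2)=\sum_{k=1}^\infty\sum_{\ell=0}^k\frac{\tilde g_{k,\ell}^2(\zeta,\nu)}{(\alpha_1)_\ell(\alpha_2)_{k-\ell}\,\ell!\,(k-\ell)!},\quad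 \tilde g_{n,\omega}(z,\nu)=n!\,\frac{(\omega+\nu)^{(n+1)}}{\nu}\,\frac{\mathbf F(1,\omega+\nu+1;n+2;1-z)}{\mathbf F(1,\nu+1;2;1-z)},$$ where $(s)^{(n)}=\prod_{k=0}^{n-1}(s-k)$, $\mathbf F(a,b;c;x)={}_2F_1(a,b;c;x)/\Gamma(c)$. The shapes $\alpha_i\ge0$ (equivalently the sample sizes $n_i$) are treated as real numbers; the series takes values in $[0,\infty]$, terms with $\tilde g_{k,\ell}(\zeta,\nu)=0$ counting as $0$. Optimal sample sizes: for a given total, the pair minimizing (attaining the infimum of) $\operatorname{ACV}\mathscr T_{\nu^\dagger}$ subject to the total $n_1+n_2$ being fixed (equivalently $\alpha_1+\alpha_2=\mathrm A$ fixed, $0\le\alpha_2\le\mathrm A$). Requiring additionally $\operatorname{ACV}\mathscr T_{\nu^\dagger}(n_1^{\mathrm{opt}},n_2^{\mathrm{opt}})=\mathrm{acv}_0$ determines the total. When $\operatorname{ACV}\mathscr T_{\nu^\dagger}$ does not depend on $\alpha_2$ the optimum is taken at $\alpha_2=0$ and $\alpha_1$ is determined by the constraint alone. Endpoints of $\zeta\in[0,1]$ are understood through limits: at $\zeta=0$, $\nu^\dagger$ is read as its limit $b$ and $\tilde g_{k,\ell}(\zeta,\nu^\dagger)$ as its limit for $\zeta\to0^+$; at $\zeta=1$ the statement is read in the limit $\zeta\to1^-$, where $\nu^\dagger\to\infty$ and the optimal sample sizes tend to infinity (like a constant times $(1-\zeta)^{-2}$). *)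

(* Defs.v *)
From HB Require Import structures.
From mathcomp Require Import all_boot all_order all_algebra.
From mathcomp Require Import all_classical all_reals all_analysis.

Set Implicit Arguments.
Unset Strict Implicit.
Unset Printing Implicit Defensive.

Import Order.TTheory GRing.Theory Num.Theory.
Import numFieldNormedType.Exports.

Local Open Scope classical_set_scope.
Local Open Scope ring_scope.

Section Defs.
Context {R : realType}.
Implicit Types (s a b c x z nu : R).

(* (s)_w = Gamma(s + w) / Gamma(s) for w a natural number, in its polynomial
   form, so that it also makes sense at s = 0: (0)_0 = 1, (0)_w.+1 = 0. *)
Definition pochhammer s (w : nat) : R := \prod_(i < w) (s + i%:R).

(* s^(n) = s (s - 1) ... (s - n + 1) *)
Definition falling s (n : nat) : R := \prod_(i < n) (s - i%:R).

(* Gauss' series; it is only evaluated at 0 < x < 1. *)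
Definition F21 a b c x : R :=
  limn (series (fun n : nat =>
    pochhammer a n * pochhammer b n / (pochhammer c n * n`!%:R) * x ^+ n)).

(* Regularized function 2F1(a, b; c; x) / Gamma(c). Only integers c >= 1 are
   needed, for which Gamma(c) = (c - 1)!. *)
Definition regF21 a b (c : nat) x : R := F21 a b c%:R x / (c.-1)`!%:R.

Definition gtilde (n w : nat) z nu : R :=
  n`!%:R * (falling (w%:R + nu) n.+1 / nu)
  * (regF21 1 (w%:R + nu + 1) n.+2 (1 - z) / regF21 1 (nu + 1) 2 (1 - z)).

(* log_z arb0 + b, with its limit b at z = 0 *)
Definition nu_dagger (arb0 : R) b z : R := if z == 0 then b else ln arb0 / ln z + b.

Definition gtilde_dagger (arb0 : R) b z (n w : nat) : R :=
  if z == 0 then lim (gtilde n w x (nu_dagger arb0 b x) @[x --> 0^'+])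
  else gtilde n w z (nu_dagger arb0 b z).

(* Squared absolute coefficient of variation of the estimator with parameter
   nu_dagger, as a function of the shapes a1, a2 >= 0, for zeta = z in [0, 1[.
   In \bar R, 0^-1 = +oo and 0 * +oo = 0: a term with a vanishing denominator is
   infinite, unless its numerator vanishes, in which case it counts as 0. *)
Definition ACV2_dagger (arb0 : R) b z (a1 a2 : R) : \bar R :=
  (\sum_(1 <= k <oo) \sum_(0 <= l < k.+1)
     (gtilde_dagger arb0 b z k l ^+ 2)%:E
     / (pochhammer a1 l * pochhammer a2 (k - l) * l`!%:R * (k - l)`!%:R)%:E)%E.

Definition shape (n : R) : R := (n - 1) / 2.

(* Absolute coefficient of variation as a function of the sample sizes *)
Definition ACV_dagger (arb0 : R) b z (n1 n2 : R) : \bar R :=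
  sqrte (ACV2_dagger arb0 b z (shape n1) (shape n2)).

Definition ARB z nu : R := z `^ nu.

Definition ARB_dagger (arb0 : R) b z : R :=
  if z == 0 then lim (ARB x (nu_dagger arb0 b x) @[x --> 0^'+])
  else ARB z (nu_dagger arb0 b z).

(* The sample sizes are real numbers n_i >= 1, i.e. the shapes are >= 0.
   When the ACV does not depend on n2, minimality at a fixed total already
   forces n2 = 1 (as soon as the ACV is finite). *)
Definition optimal_sample_sizes z (acv0 arb0 : R) b (n1 n2 : R) : Prop :=
  [/\ 1 <= n1 /\ 1 <= n2,
      forall m1 m2 : R, 1 <= m1 -> 1 <= m2 -> m1 + m2 = n1 + n2 ->
        (ACV_dagger arb0 b z n1 n2 <= ACV_dagger arb0 b z m1 m2)%E,
      ACV_dagger arb0 b z n1 n2 = acv0%:E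
    & ARB_dagger arb0 b z = arb0 * z `^ b].

(* The value of z for which nu_dagger = 1, if there is one in ]0, 1[ *)
Definition zeta1 (arb0 : R) b : R := if b < 1 then arb0 `^ (1 / (1 - b)) else 0.

(* d/da2 ACV^2(A - a2, a2) = 0 at A = a1 + a2. As ACV^2 is [0, +oo]-valued, it is
   required to be finite near a2, so that [fine] does not change its values. *)
Definition stationary_at_fixed_total (arb0 : R) b z (a1 a2 : R) : Prop :=
  let f (x : R) := ACV2_dagger arb0 b z (a1 + a2 - x) x in
  (\forall x \near a2, f x \is a fin_num) /\
  is_derive a2 (1 : R) (fine \o f) (0 : R).

End Defs.

(* Main.v *)
(* With k = l + m the coefficients factor as
     gtilde (l + m) l = (nu + 1)_l (nu - 1)^(m) 2F1(1, l + nu + 1; k + 2; 1 - zeta)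
                        / ((k + 1) 2F1(1, nu + 1; 2; 1 - zeta)),
   where both hypergeometric values lie between 1 and a constant.  For nu = 1, and in the
   limit zeta -> 0, only the coefficients with m = 0 survive, they equal k!, and the series
   sum_k k! / (alpha_1)_k telescopes to 1 / (alpha_1 - 2).

   For nu <> 1 the series is finite exactly on the open set alpha_1 > 2 nu, alpha_2 > 0,
   alpha_1 + alpha_2 > 2, it is strictly convex and strictly decreasing there (each term is
   log-convex), and it scales down under dilations.  Hence the optimal shapes are the unique
   minimiser of alpha_1 + alpha_2 on the sublevel set {ACV^2 <= acv_0^2}, which exists by
   compactness and is interior, so that the derivative at a fixed total vanishes.

   As zeta -> 1, (1 - zeta) nu tends to L = - ln arb_0, and ACV^2 at the shapes
   A / (1 - zeta)^2 and B / (1 - zeta)^2 tends to a power series in 1/A + 1/B with positive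
   coefficients.  For a given value of 1/A + 1/B the total A + B is least at A = B, so both
   rescaled optimal shapes tend to the same positive limit. *)
Require Import Defs.
From HB Require Import structures.
From mathcomp Require Import all_boot all_order all_algebra.
From mathcomp Require Import ring lra.
From mathcomp Require Import all_classical all_reals all_analysis.
Set Implicit Arguments.
Unset Strict Implicit.
Unset Printing Implicit Defensive.
Import Order.TTheory GRing.Theory Num.Theory.
Import numFieldNormedType.Exports.
Local Open Scope classical_set_scope.
Local Open Scope ring_scope.

(** * Series *)

(** The series can be infinite, and its sum is never differentiated or shown continuous directly.
    Finiteness and size are expressed by [sumle], a bound on all partial sums: it survives convex
    combinations, and closedness of a sublevel set needs only continuity of each partial sum.
    Openness of the domain of finiteness does the work of continuity: from a point with slack, a
    short convex step towards a nearby point with a smaller shape lowers the total and stays below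
    the level. So the constraint is active at a minimiser of the total, which makes minimising ACV^2
    at a fixed total and minimising the total at a fixed ACV^2 equivalent. This is why the exact
    domain is determined, by summability inside and comparison with the harmonic series on its
    boundary. Their total is bounded above by a test point that is fixed after rescaling, and their
    reciprocals are controlled through finitely many terms of the series. *)

Section Series.
Context {R : realType}.
Implicit Types (u f M : R^nat).

Lemma series_bounded_cvg u (B : R) :
  (forall n, 0 <= u n) -> (forall n, series u n <= B) -> cvgn (series u).
Proof.
move=> u0 uB; apply: nondecreasing_is_cvgn.
  exact: nondecreasing_series.
by exists B => _ [n _ <-].
Qed.

(** The hypothesis reads [eta * u n.+1 <= n%:R * u n - n.+1%:R * u n.+1], which telescopes. Without
    division by [u n] it also covers vanishing terms, such as those with [pochhammer (1 - nu) m] for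
    an integer [nu]. *)
Lemma raabe u (eta : R) (N : nat) : (forall n, 0 <= u n) -> 0 < eta ->
  (forall n, (N <= n)%N -> (n.+1%:R + eta) * u n.+1 <= n%:R * u n) ->
  cvgn (series u).
Proof.
move=> u0 eta0 H.
have key n : eta * series u (N.+1 + n)%N + (N + n)%:R * u (N + n)%N
             <= eta * series u N.+1 + N%:R * u N.
  elim: n => [|n IH]; first by rewrite !addn0.
  apply: le_trans IH; rewrite !addnS [series u (N.+1 + n).+1]seriesSr.
  rewrite mulrDr -addrA lerD2l addSn.
  have := H (N + n)%N (leq_addr _ _).
  by rewrite mulrDl addrC.
apply: (@series_bounded_cvg _ (eta^-1 * (eta * series u N.+1 + N%:R * u N))) => //.
move=> n; rewrite mulrC ler_pdivlMr// mulrC.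
apply: le_trans (key n); rewrite -[leLHS]addr0 lerD ?mulr_ge0// ?ler0n//.
rewrite ler_pM2l//.
have := @nondecreasing_series _ u xpredT 0 (fun n _ _ => u0 n).
by apply; exact: leq_addl.
Qed.

Lemma series_partial_le u n : (forall n, 0 <= u n) -> cvgn (series u) ->
  series u n <= limn (series u).
Proof.
by move=> u0 cu; apply: nondecreasing_cvgn_le => //; exact: nondecreasing_series.
Qed.

Lemma lim_series_bound u (B : R) : cvgn (series u) ->
  (forall n, series u n <= B) -> limn (series u) <= B.
Proof. by move=> cu H; apply: limr_le => //; apply: nearW. Qed.

Lemma dominated_series_cvg f M : (forall n, `|f n| <= M n) ->
  cvgn (series M) -> cvgn (series f).
Proof.
move=> fM cM; apply: normed_cvg; apply: series_le_cvg cM => //= n.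
by rewrite (le_trans _ (fM n)).
Qed.

Lemma dominated_series_tail f M N : (forall n, `|f n| <= M n) ->
  cvgn (series M) ->
  `|limn (series f) - series f N| <= limn (series M) - series M N.
Proof.
move=> fM cM.
have cf := dominated_series_cvg fM cM.
have M0 n : 0 <= M n by exact: le_trans (fM n).
have H : (`|series f n - series f N|) @[n --> \oo] --> `|limn (series f) - series f N|.
  by apply: cvg_norm; apply: cvgB => //; exact: cvg_cst.
rewrite -(cvg_lim _ H)//; apply: limr_le; first exact: cvgP H.
near=> n.
have Nn : (N <= n)%N by near: n; exists N.
apply: (@le_trans _ _ (series M n - series M N)); last first.
  by rewrite lerD2r; exact: series_partial_le.
rewrite /series /= !sub_series_geq//.
by apply: (le_trans (ler_norm_sum _ _ _)); apply: ler_sum.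
Unshelve. all: by end_near. Qed.

Lemma cvg_sumr (T I : Type) (F : set_system T) {FF : Filter F} (r : seq I)
    (P : pred I) (h : I -> T -> R) (l : I -> R) :
  (forall i, P i -> h i x @[x --> F] --> l i) ->
  \sum_(i <- r | P i) h i x @[x --> F] --> \sum_(i <- r | P i) l i.
Proof.
move=> hl; elim: r => [|i r IH].
  by rewrite big_nil; under eq_cvg do rewrite big_nil; exact: cvg_cst.
rewrite big_cons; under eq_cvg do rewrite big_cons.
by case: ifPn => // Pi; apply: cvgD => //; exact: hl.
Qed.

Lemma cvg_prodr (T I : Type) (F : set_system T) {FF : Filter F} (r : seq I)
    (P : pred I) (h : I -> T -> R) (l : I -> R) :
  (forall i, P i -> h i x @[x --> F] --> l i) ->
  \prod_(i <- r | P i) h i x @[x --> F] --> \prod_(i <- r | P i) l i.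
Proof.
move=> hl; elim: r => [|i r IH].
  by rewrite big_nil; under eq_cvg do rewrite big_nil; exact: cvg_cst.
rewrite big_cons; under eq_cvg do rewrite big_cons.
by case: ifPn => // Pi; apply: cvgM => //; exact: hl.
Qed.

Lemma dominated_lim_le (U : Type) (F : set_system U) {FF : ProperFilter F}
    (f : nat -> U -> R) (g M : R^nat) :
  (forall n, f n @ F --> g n) ->
  (\forall x \near F, forall n, `|f n x| <= M n) -> forall n, `|g n| <= M n.
Proof.
move=> fg fM n.
have H : `|f n x| @[x --> F] --> `|g n| by apply: cvg_norm; exact: fg.
rewrite -(cvg_lim _ H)//; apply: limr_le; first exact: cvgP H.
by apply: filterS fM => x.
Qed.

(** Tannery's theorem: cut where the tail of [M] is at most [e / 3]. That tail bounds both
    remainders, and the finite head converges term by term. *)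
Lemma cvg_series_dominated (U : Type) (F : set_system U) {FF : ProperFilter F}
    (f : nat -> U -> R) (g M : R^nat) :
  (forall n, f n @ F --> g n) ->
  (\forall x \near F, forall n, `|f n x| <= M n) ->
  cvgn (series M) ->
  limn (series (f^~ x)) @[x --> F] --> limn (series g).
Proof.
move=> fg fM cM.
have gM n : `|g n| <= M n by exact: (dominated_lim_le fg fM).
apply/cvgrPdist_le => e e0.
have e3 : 0 < e / 3 by rewrite divr_gt0.
have [N HN] : exists N, limn (series M) - series M N <= e / 3.
  have /cvgrPdist_le/(_ _ e3) [N _ HN] := cM.
  exists N; apply: le_trans (HN N _) => //=; exact: ler_norm.
have HS : series (f^~ x) N @[x --> F] --> series g N.
  by apply: cvg_sumr => i _; exact: fg.
have /cvgrPdist_le/(_ _ e3) HS' := HS.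
near=> x.
have fMx : forall n, `|f n x| <= M n by near: x.
have h1 := dominated_series_tail N fMx cM.
have h2 := dominated_series_tail N gM cM.
have h3 : `|series g N - series (f^~ x) N| <= e / 3 by near: x.
move: h1 h2 h3 HN.
set a := limn (series g); set a' := limn _; set b := series g N.
set b' := series _ N; set c := limn _ - _ => h1 h2 h3 h4.
have -> : a - a' = (a - b) + ((b - b') - (a' - b')) by ring.
rewrite (le_trans (ler_normD _ _))//.
have := ler_normB (b - b') (a' - b').
lra.
Unshelve. all: by end_near. Qed.

End Series.

(** * Pochhammer symbols and the hypergeometric coefficients *)

Section Pochhammer.
Context {R : realType}.
Implicit Types (s t a b c x nu : R).

Lemma poch0 s : pochhammer s 0 = 1.
Proof. by rewrite /pochhammer big_ord0. Qed.

Lemma pochS s n : pochhammer s n.+1 = pochhammer s n * (s + n%:R).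
Proof. by rewrite /pochhammer big_ord_recr. Qed.

Lemma pochSl s n : pochhammer s n.+1 = s * pochhammer (s + 1) n.
Proof.
rewrite /pochhammer big_ord_recl /= addr0; congr (_ * _).
by apply: eq_bigr => i _; rewrite /bump /= add1n -natr1; ring.
Qed.

Lemma poch_gt0 s n : 0 < s -> 0 < pochhammer s n.
Proof. by move=> s0; apply: prodr_gt0 => i _; rewrite ltr_pwDl. Qed.

Lemma poch_ge0 s n : 0 <= s -> 0 <= pochhammer s n.
Proof. by move=> s0; apply: prodr_ge0 => i _; rewrite addr_ge0. Qed.

Lemma ler_poch s t n : 0 <= s -> s <= t -> pochhammer s n <= pochhammer t n.
Proof. by move=> s0 st; apply: ler_prod => i _; rewrite addr_ge0//= lerD2r. Qed.

Lemma poch_one n : pochhammer 1 n = n`!%:R :> R.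
Proof.
elim: n => [|n IH]; first by rewrite poch0.
by rewrite pochS IH factS natrM mulrC nat1r.
Qed.

Lemma falling0 s : falling s 0 = 1.
Proof. by rewrite /falling big_ord0. Qed.

Lemma fallingSl s n : falling s n.+1 = s * falling (s - 1) n.
Proof.
rewrite /falling big_ord_recl /= subr0; congr (_ * _).
by apply: eq_bigr => i _; rewrite /bump /= add1n -natr1; ring.
Qed.

(** The factors run from [nu + l] down to [nu - m]: [l] of them above [nu], then [nu], then [m]
    below it. *)
Lemma falling_shift nu l m :
  falling (l%:R + nu) (l + m).+1 = nu * pochhammer (nu + 1) l * falling (nu - 1) m.
Proof.
elim: l => [|l IH]; first by rewrite add0r add0n fallingSl poch0 mulr1.
rewrite addSn fallingSl -natr1.
have -> : l%:R + 1 + nu - 1 = l%:R + nu by ring.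
by rewrite IH pochS; ring.
Qed.

(** The two products differ by the sign (-1)^m. Passing to [pochhammer] lets one summability lemma
    serve both indices. *)
Lemma sqr_falling nu m : falling (nu - 1) m ^+ 2 = pochhammer (1 - nu) m ^+ 2.
Proof.
rewrite /falling /pochhammer -!prodrXl; apply: eq_bigr => i _.
by ring.
Qed.

Lemma poch_scale s t n : 0 <= s -> 1 <= t ->
  pochhammer s n <= pochhammer (t * s) n.
Proof. by move=> s0 t1; apply: ler_poch => //; rewrite ler_peMl. Qed.

Lemma poch_scaleS s t n : 0 <= s -> 1 <= t ->
  t * pochhammer s n.+1 <= pochhammer (t * s) n.+1.
Proof.
move=> s0 t1; rewrite !pochSl -mulrA !mulrA ler_pM ?mulr_ge0//.
- by rewrite (le_trans ler01).
- by apply: poch_ge0; rewrite addr_ge0.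
- by apply: ler_poch; rewrite ?addr_ge0// lerD2r ler_peMl.
Qed.

Definition hcoef b c x : R^nat := fun n => pochhammer b n / pochhammer c n * x ^+ n.

(* 2F1(1, b; c; x) *)
Definition hyp b c x : R := limn (series (hcoef b c x)).

Lemma F21_one b c x : F21 1 b c x = hyp b c x.
Proof.
rewrite /F21 /hyp; congr (limn (series _)); apply/funext => n.
rewrite /hcoef poch_one; have : n`!%:R != 0 :> R by rewrite pnatr_eq0 -lt0n fact_gt0.
move: (n`!%:R) => f f0; congr (_ * _).
by rewrite [f * _]mulrC -mulf_div divff// mulr1.
Qed.

Lemma hcoef_ge0 b c x n : 0 <= b -> 0 <= c -> 0 <= x -> 0 <= hcoef b c x n.
Proof. by move=> b0 c0 x0; rewrite /hcoef mulr_ge0 ?exprn_ge0// divr_ge0 ?poch_ge0. Qed.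

Lemma hcoefS b c x n : hcoef b c x n.+1 = hcoef b c x n * ((b + n%:R) / (c + n%:R) * x).
Proof.
by rewrite /hcoef !pochS exprS invfM; ring.
Qed.

Lemma hcoef_cvg b c x : 0 <= b -> 0 < c -> 0 <= x < 1 -> cvgn (series (hcoef b c x)).
Proof.
move=> b0 c0 /andP[x0 x1].
(* The gain [n^2 (1 - x)] has to pay for [n (2 + b) + 2 b], and [2 b <= 2 b n]; hence
   [2 + 3 * b]. *)
apply: (@raabe _ _ 1 (Num.truncn ((2 + 3 * b) / (1 - x))).+1) => //.
  by move=> n; apply: hcoef_ge0 => //; exact: ltW.
move=> n Nn.
have x1' : 0 < 1 - x by lra.
have n1 : 1 <= n%:R :> R by rewrite ler1n (leq_trans _ Nn).
have hn : 2 + 3 * b <= n%:R * (1 - x).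
  rewrite -ler_pdivrMr//; apply: (le_trans (ltW (truncnS_gt _))).
  by rewrite ler_nat.
have : 0 <= hcoef b c x n by apply: hcoef_ge0 => //; exact: ltW.
rewrite hcoefS -natr1.
move: (n%:R) (hcoef _ _ _ _) n1 hn => {Nn}v h n1 hn h0.
have cn : 0 < c + v by lra.
rewrite mulrCA [leRHS]mulrC ler_wpM2l//.
have -> : (v + 1 + 1) * ((b + v) / (c + v) * x) = (v + 2) * (b + v) * x / (c + v).
  by field; rewrite gt_eqF.
rewrite ler_pdivrMr//.
have h1 : v * (2 + 3 * b) <= v * (v * (1 - x)) by rewrite ler_pM2l//; lra.
have h2 : 0 <= v * c by rewrite mulr_ge0//; lra.
have h3 : (v * (2 + b) + 2 * b) * x <= (v * (2 + b) + 2 * b).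
  by rewrite ler_piMr//; nra.
have h4 : b <= v * b by rewrite ler_peMl.
lra.
Qed.

Lemma hyp_ge1 b c x : 0 <= b -> 0 < c -> 0 <= x < 1 -> 1 <= hyp b c x.
Proof.
move=> b0 c0 xx; have /andP[x0 _] := xx.
have := @series_partial_le _ (hcoef b c x) 1.
rewrite /series /= big_nat1 /hcoef !poch0 divr1 mul1r expr0; apply.
  by move=> n; apply: hcoef_ge0 => //; exact: ltW.
exact: hcoef_cvg.
Qed.

Lemma hcoef_shift b c x n :
  hcoef b c x n.+1 = b * x / c * hcoef (b + 1) (c + 1) x n.
Proof. by rewrite /hcoef !pochSl exprS invfM; ring. Qed.

(** Dropping the leading term 1 raises both parameters by one. This is the source of the recursion
    [gcoefS]. *)
Lemma hyp_shift b c x : 0 <= b -> 0 < c -> 0 <= x < 1 ->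
  b * x / c * hyp (b + 1) (c + 1) x = hyp b c x - 1.
Proof.
move=> b0 c0 xx.
have cv : cvgn (series (hcoef (b + 1) (c + 1) x)) by apply: hcoef_cvg => //; lra.
have cv' : cvgn (series (hcoef b c x)) by apply: hcoef_cvg => //; lra.
have H : (fun n => b * x / c * series (hcoef (b + 1) (c + 1) x) n) @ \oo -->
   b * x / c * hyp (b + 1) (c + 1) x by apply: cvgMl_tmp.
have H2 : (fun n => series (hcoef b c x) n.+1 - 1) @ \oo --> hyp b c x - 1.
  by apply: cvgB; [rewrite (cvg_shiftS (series _))|exact: cvg_cst].
have E : (fun n => series (hcoef b c x) n.+1 - 1) =
   (fun n => b * x / c * series (hcoef (b + 1) (c + 1) x) n).
  apply/funext => n.
  rewrite /series /= big_nat_recl//= addrC {1}/hcoef !poch0 divr1 mul1r expr0 addrA.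
  rewrite addNr add0r mulr_sumr; apply: eq_bigr => i _; exact: hcoef_shift.
by rewrite -(cvg_lim _ H)// -(cvg_lim _ H2)// E.
Qed.

Lemma ler_hyp b c b' c' x : 0 <= b -> 0 < c -> 0 <= b' -> 0 < c' -> 0 <= x < 1 ->
  (forall i : nat, (b + i%:R) * (c' + i%:R) <= (b' + i%:R) * (c + i%:R)) ->
  hyp b c x <= hyp b' c' x.
Proof.
move=> b0 c0 b'0 c'0 xx H; have /andP[x0 _] := xx.
apply: lim_series_le; [exact: hcoef_cvg|exact: hcoef_cvg|move=> n].
rewrite /hcoef ler_wpM2r ?exprn_ge0//.
rewrite /pochhammer -!prodf_div; apply: ler_prod => i _.
have ci : 0 < c + i%:R by rewrite ltr_pwDl.
have ci' : 0 < c' + i%:R by rewrite ltr_pwDl.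
apply/andP; split; first by rewrite divr_ge0 ?addr_ge0// ltW.
rewrite ler_pdivrMr//.
by rewrite mulrAC ler_pdivlMr.
Qed.

(** The bound does not depend on [l] and [m]: it makes the coefficients comparable to their
    elementary factors. *)
Lemma hyp_le_uniform nu x l m : 0 <= nu -> 0 <= x < 1 ->
  hyp (l%:R + nu + 1) (l + m).+2%:R x <= hyp (nu + 1) 1 x.
Proof.
move=> nu0 xx; apply: ler_hyp => //; try lra.
- by rewrite addrAC -addrA; have := ler0n R l; lra.
- move=> i; rewrite -!natr1 natrD.
  have := ler0n R l; have := ler0n R m; have := ler0n R i.
  move: (l%:R : R) (m%:R : R) (i%:R : R) => L M I I0 M0 L0. nra.
Qed.

Lemma gtildeE l m z nu : 0 < nu ->
  gtilde (l + m) l z nu = pochhammer (nu + 1) l * falling (nu - 1) m / (l + m).+1%:R *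
    (hyp (l%:R + nu + 1) (l + m).+2%:R (1 - z) / hyp (nu + 1) 2 (1 - z)).
Proof.
move=> nu0; rewrite /gtilde /regF21 !F21_one falling_shift /= divr1 factS natrM.
have f0 : (l + m)`!%:R != 0 :> R by rewrite pnatr_eq0 -lt0n fact_gt0.
have k0 : (l + m).+1%:R != 0 :> R by rewrite pnatr_eq0.
move: (_`!%:R) f0 (_.+1%:R) k0 (hyp _ 2 _)^-1 => f f0 k k0 q.
by field; rewrite f0 k0 gt_eqF.
Qed.
End Pochhammer.

Ltac nneg := repeat first
  [ assumption | exact: ler0n | apply: ltW; assumption | apply: sqr_ge0 | apply: divr_ge0
  | apply: mulr_ge0 | apply: poch_ge0 | apply: exprn_ge0 | lra | apply: addr_ge0 ].

(** * The coefficients at nu = 1 and in the limit zeta -> 0 *)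

Section GCoef.
Context {R : realType}.
Implicit Types (x nu : R).

(* The factor of gtilde (l + m) l that remains after extracting falling (nu - 1) m. *)
Definition gcoef l m nu x : R := pochhammer (nu + 1) l / (l + m).+1%:R *
  (hyp (l%:R + nu + 1) (l + m).+2%:R x / hyp (nu + 1) 2 x).

Lemma gtilde_gcoef l m z nu : 0 < nu ->
  gtilde (l + m) l z nu = falling (nu - 1) m * gcoef l m nu (1 - z).
Proof. by move=> nu0; rewrite gtildeE// /gcoef; ring. Qed.

Lemma hyp_neq0 b c x : 0 <= b -> 0 < c -> 0 <= x < 1 -> hyp b c x != 0.
Proof. by move=> *; rewrite gt_eqF// (lt_le_trans ltr01)// hyp_ge1. Qed.

(** This is [hyp_shift] at [b = l + nu + 1], [c = l + m + 2]. Induction on [l] then reduces both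
    [nu = 1] and the limit [x -> 1] to [l = 0]. *)
Lemma gcoefS l m nu x : 0 <= nu -> 0 < x < 1 ->
  gcoef l.+1 m nu x =
  ((l + m).+1%:R * gcoef l m nu x - pochhammer (nu + 1) l / hyp (nu + 1) 2 x) / x.
Proof.
move=> nu0 /andP[x0 x1]; rewrite /gcoef.
have xx : 0 <= x < 1 by rewrite ltW.
have H : (l%:R + nu + 1) * x / (l + m).+2%:R * hyp (l%:R + nu + 1 + 1) ((l + m).+2%:R + 1) x
   = hyp (l%:R + nu + 1) (l + m).+2%:R x - 1.
  by apply: hyp_shift => //; rewrite !addr_ge0.
have h0 : hyp (nu + 1) 2 x != 0 by apply: hyp_neq0 => //; rewrite addr_ge0.
have e1 : l%:R + nu + 1 + 1 = l.+1%:R + nu + 1 by rewrite -natr1; ring.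
rewrite e1 natr1 in H.
rewrite pochS addSn; have -> : nu + 1 + l%:R = l%:R + nu + 1 by ring.
have k0 : (l + m).+1%:R != 0 :> R by rewrite pnatr_eq0.
have k1 : (l + m).+2%:R != 0 :> R by rewrite pnatr_eq0.
have -> : hyp (l%:R + nu + 1) (l + m).+2%:R x = 1 +
  (l%:R + nu + 1) * x / (l + m).+2%:R * hyp (l.+1%:R + nu + 1) (l + m).+3%:R x.
  by rewrite H; ring.
move: {H e1} (hyp (nu + 1) _ _) h0 (hyp _ _ _) k1 k0.
move: (l + m).+2%:R (l + m).+1%:R => k2 k1 h h0 p k20 k10.
by field; rewrite h0 k10 k20 gt_eqF.
Qed.

(** For every [b > 0] the series of [hyp b b x] is the geometric one, and [hyp_shift] at [b = c = 1]
    sums it. *)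
Lemma hyp_two_one x : 0 < x < 1 -> hyp 2 2 x * (1 - x) = 1.
Proof.
move=> /andP[x0 x1].
have E b c : 0 < b -> 0 < c -> hyp b b x = hyp c c x.
  move=> b0 c0; rewrite /hyp; congr (limn (series _)); apply/funext => n.
  by rewrite /hcoef !divff ?gt_eqF ?poch_gt0.
have := @hyp_shift _ 1 1 x ler01 ltr01; rewrite ltW// => /(_ x1).
rewrite divr1 mul1r (E 1 2)//= -[1 + 1]/(2%:R).
by move: (hyp _ _ _) => h; lra.
Qed.

Lemma gcoef_nu1 l x : 0 < x < 1 -> gcoef l 0 1 x = l`!%:R.
Proof.
move=> xx; have h := hyp_two_one xx; have /andP[x0 x1] := xx.
elim: l => [|l IH].
  rewrite /gcoef poch0 divr1 mul1r add0r divff//.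
  by apply: hyp_neq0; rewrite ?ltW.
rewrite gcoefS// IH addn0 -natrM -factS.
have -> : pochhammer (1 + 1) l = l.+1`!%:R :> R.
  by rewrite -poch_one pochSl mul1r.
have -> : (hyp (1 + 1) 2 x)^-1 = 1 - x.
  apply: (mulfI (_ : hyp 2 2 x != 0)); first by apply: hyp_neq0; rewrite ?ltW.
  by rewrite h divff//; apply: hyp_neq0; rewrite ?ltW.
by field; rewrite gt_eqF.
Qed.

Lemma cvgXr (T : Type) (F : set_system T) {FF : Filter F} (f : T -> R) (l : R) n :
  f t @[t --> F] --> l -> f t ^+ n @[t --> F] --> l ^+ n.
Proof.
move=> fl; elim: n => [|n IH].
  by under eq_cvg do rewrite expr0; rewrite expr0; exact: cvg_cst.
by under eq_cvg do rewrite exprS; rewrite exprS; exact: cvgM.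
Qed.

Section AtZero.
Context {T : Type} {F : set_system T} {FF : ProperFilter F}.
Variables (nu x : T -> R) (B : R).
Hypothesis nuB : \forall t \near F, 0 < nu t <= B.
Hypothesis x01 : \forall t \near F, 0 < x t < 1.
Hypothesis x1 : x t @[t --> F] --> (1 : R).

(** As [nu > 0], the coefficients dominate (1)_n / (2)_n = 1 / (n + 1), and the harmonic series
    diverges. *)
Lemma hyp_two_cvgy : hyp (nu t + 1) 2 (x t) @[t --> F] --> +oo.
Proof.
apply/cvgryPge => A.
have /cvgryPge/(_ (A + 1)) [N _ HN] : series (@harmonic R) n @[n --> \oo] --> +oo.
  apply: nondecreasing_dvgn_lt; last exact: dvg_harmonic.
  by apply: nondecreasing_series => i _ _; rewrite harmonic_ge0.
have {}HN : A + 1 <= series (@harmonic R) N by apply: HN => /=.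
have L : (\sum_(0 <= i < N) harmonic i * x t ^+ i) @[t --> F] --> series (@harmonic R) N.
  apply: cvg_sumr => i _; rewrite -[X in _ --> X]mulr1; apply: cvgM; first exact: cvg_cst.
  by rewrite -(expr1n R i); exact: cvgXr.
have AN : A < series (@harmonic R) N by lra.
have L' : \forall t \near F, A < \sum_(0 <= i < N) harmonic i * x t ^+ i.
  exact: (cvgr_gt _ L).
near=> t.
have : A < \sum_(0 <= i < N) harmonic i * x t ^+ i by near: t.
have /andP[xt0 xt1] : 0 < x t < 1 by near: t.
have xt0' := ltW xt0.
have /andP[n0 nB] : 0 < nu t <= B by near: t.
move/ltW/le_trans; apply.
have u0 n : 0 <= hcoef (nu t + 1) 2 (x t) n.
  by apply: hcoef_ge0 => //; lra.
have cv : cvgn (series (hcoef (nu t + 1) 2 (x t))).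
  by apply: hcoef_cvg => //; lra.
apply: (le_trans _ (series_partial_le N u0 cv)).
rewrite /series /= !big_mkord; apply: ler_sum => i _.
rewrite /hcoef ler_wpM2r ?exprn_ge0//.
rewrite ler_pdivlMr ?poch_gt0// /harmonic /=.
have -> : i.+1%:R^-1 * pochhammer 2 i = pochhammer 1 i :> R.
  have := pochSl (1 : R) i; rewrite pochS mul1r -[1 + 1]/(2%:R) nat1r => <-.
  by field; rewrite nat1r pnatr_eq0.
by apply: ler_poch => //; lra.
Unshelve. all: by end_near. Qed.

(** Since (3)_n = (2)_n (2 + n) / 2, the terms from [N] on are at most [2 / N] times those of the
    denominator. The head stays below [K] while the denominator tends to infinity. *)
Lemma hyp_three_two_cvg0 : hyp (nu t + 1) 3 (x t) / hyp (nu t + 1) 2 (x t) @[t --> F] --> 0.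
Proof.
apply/cvgr0Pnorm_le => e e0.
pose N := (Num.truncn (4 / e)).+1.
pose K := \sum_(0 <= i < N) pochhammer (B + 1) i : R.
have L : \forall t \near F, 2 * K / e <= hyp (nu t + 1) 2 (x t).
  by have /cvgryPge := hyp_two_cvgy; exact.
near=> t.
have Lt : 2 * K / e <= hyp (nu t + 1) 2 (x t) by near: t.
have /andP[xt0 xt1] : 0 < x t < 1 by near: t.
have xt0' := ltW xt0.
have /andP[n0 nB] : 0 < nu t <= B by near: t.
have xx : 0 <= x t < 1 by rewrite ltW.
have b0 : 0 <= nu t + 1 by lra.
have h1 : 1 <= hyp (nu t + 1) 2 (x t) by apply: hyp_ge1.
have h3 : 1 <= hyp (nu t + 1) 3 (x t) by apply: hyp_ge1.
have h0 : 0 < hyp (nu t + 1) 2 (x t) by lra.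
rewrite ger0_norm; last by rewrite divr_ge0//; lra.
rewrite ler_pdivrMr//.
suff : hyp (nu t + 1) 3 (x t) <= K + 2 / N%:R * hyp (nu t + 1) 2 (x t).
  have : 2 / N%:R <= e / 2.
    have : 4 / e <= N%:R by rewrite /N ltW// truncnS_gt.
    rewrite ler_pdivrMr// => H4; rewrite ler_pdivrMr//.
    by move: (N%:R) H4 => v; nra.
  move=> H1 /le_trans; apply.
  rewrite ler_pdivrMr// in Lt.
  have : 2 / N%:R * hyp (nu t + 1) 2 (x t) <= e / 2 * hyp (nu t + 1) 2 (x t).
    by rewrite ler_pM2r.
  lra.
have cv c : 0 < c -> cvgn (series (hcoef (nu t + 1) c (x t))) by move=> c0; apply: hcoef_cvg.
have u0 c n : 0 < c -> 0 <= hcoef (nu t + 1) c (x t) n by move=> c0; apply: hcoef_ge0 => //; lra.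
apply: lim_series_bound; first exact: cv.
move=> n.
have c2 : (0 : R) < 2 by []. have c3 : (0 : R) < 3 by [].
apply: (@le_trans _ _ (series (hcoef (nu t + 1) 3 (x t)) (N + n)%N)).
  by apply: (@nondecreasing_series _ (hcoef (nu t + 1) 3 (x t)) xpredT 0);
   [move=> i _ _; exact: u0|exact: leq_addl].
rewrite /series /= (@big_cat_nat _ _ _ N)//=; last exact: leq_addr.
apply: lerD.
  rewrite /K !big_mkord; apply: ler_sum => i _; rewrite /hcoef.
  apply: (@le_trans _ _ (pochhammer (nu t + 1) i)); last by apply: ler_poch => //; lra.
  rewrite -[leRHS]mulr1 ler_pM ?exprn_ge0 ?exprn_ile1 ?divr_ge0 ?poch_ge0//; last exact: ltW.
  rewrite ler_pdivrMr ?poch_gt0// ler_peMr ?poch_ge0//.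
  apply: (@le_trans _ _ (pochhammer 1 i)); first by rewrite poch_one ler1n fact_gt0.
  by apply: ler_poch => //; rewrite ler1n.
apply: (@le_trans _ _ (2 / N%:R * \sum_(N <= i < N + n) hcoef (nu t + 1) 2 (x t) i)).
  rewrite mulr_sumr ler_sum_nat// => i /andP[Ni _].
  rewrite /hcoef !mulrA ler_wpM2r ?exprn_ge0//.
  have -> : pochhammer 3 i = pochhammer 2 i * (2 + i%:R) / 2 :> R.
    have := pochSl (2 : R) i; rewrite pochS => ->.
    by rewrite mulrAC divff// mul1r -natr1.
  have p2 : 0 < pochhammer 2 i :> R by exact: poch_gt0.
  have a0 : 0 <= pochhammer (nu t + 1) i by exact: poch_ge0.
  rewrite invfM invrK invfM.
  have rN : (2 + i%:R)^-1 <= N%:R^-1 :> R.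
    rewrite lef_pV2 ?posrE ?ltr_pwDl ?ltr0n//.
    by rewrite -[leLHS]add0r lerD ?ler_nat.
  have ap : 0 <= 2 * pochhammer (nu t + 1) i / pochhammer 2 i.
    by rewrite divr_ge0 ?mulr_ge0// ltW.
  by move: (ler_wpM2l ap rN); congr (_ <= _); ring.
rewrite ler_wpM2l ?divr_ge0//.
apply: (@le_trans _ _ (series (hcoef (nu t + 1) 2 (x t)) (N + n)%N)).
  rewrite /series /= (@big_cat_nat _ _ _ N 0 (N + n))//=; last exact: leq_addr.
  by rewrite lerDr sumr_ge0// => i _; exact: u0.
by apply: series_partial_le; [move=> i; exact: u0|exact: cv].
Unshelve. all: by end_near. Qed.

(* By gcoefS only l = 0 is left; there the terms of the numerator are o(1) times those of
   the denominator, which tends to +oo. *)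
Lemma gcoef_cvg0 l m : gcoef l m (nu t) (x t) @[t --> F] --> ((m == 0%N)%:R * l`!%:R : R).
Proof.
elim: l => [|l IH].
  rewrite mulr1; case: m => [|m].
    rewrite eqxx; apply: (@cvg_trans _ ((fun=> 1 : R) @ F)); last exact: cvg_cst.
    apply: near_eq_cvg; near=> t.
    have /andP[xt0 xt1] : 0 < x t < 1 by near: t.
    have /andP[n0 nB] : 0 < nu t <= B by near: t.
    rewrite /gcoef poch0 addn0 divr1 mul1r add0r divff//.
    by apply: hyp_neq0 => //; lra.
  apply: (@squeeze_cvgr _ _ _ _ (fun=> 0)
    (fun t => hyp (nu t + 1) 3 (x t) / hyp (nu t + 1) 2 (x t))).
  - near=> t.
    have /andP[xt0 xt1] : 0 < x t < 1 by near: t.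
    have /andP[n0 nB] : 0 < nu t <= B by near: t.
    have h2 : 1 <= hyp (nu t + 1) 2 (x t) by apply: hyp_ge1 => //; lra.
    have h3 : 1 <= hyp (nu t + 1) m.+3%:R (x t) by apply: hyp_ge1 => //; lra.
    rewrite /gcoef poch0 add0r add0n.
    rewrite mulr_ge0 ?divr_ge0//=; [|lra|lra].
    apply: (@le_trans _ _ (hyp (nu t + 1) m.+3%:R (x t) / hyp (nu t + 1) 2 (x t))).
      rewrite ler_piMl//; first by rewrite divr_ge0//; lra.
      by rewrite ler_pdivrMr// mul1r ler1n.
    rewrite ler_pM2r ?invr_gt0; last lra.
    apply: ler_hyp => //; [lra|lra|lra|move=> i].
    rewrite ler_wpM2l//; last by rewrite lerD2r ler_nat.
    by rewrite !addr_ge0// ltW.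
  - exact: cvg_cst.
  - exact: hyp_three_two_cvg0.
have E : (((l + m).+1%:R * gcoef l m (nu t) (x t) -
      pochhammer (nu t + 1) l / hyp (nu t + 1) 2 (x t)) / x t) @[t --> F] -->
   (((l + m).+1%:R * ((m == 0%N)%:R * l`!%:R) - 0) / 1 : R).
  apply: cvgM; last by apply: cvgV => //; exact: oner_neq0.
  apply: cvgB; first by apply: cvgM => //; exact: cvg_cst.
  apply: (@squeeze_cvgr _ _ _ _ (fun=> 0)
    (fun t => pochhammer (B + 1) l * (hyp (nu t + 1) 2 (x t))^-1)).
  - near=> t.
    have /andP[xt0 xt1] : 0 < x t < 1 by near: t.
    have /andP[n0 nB] : 0 < nu t <= B by near: t.
    have h2 : 1 <= hyp (nu t + 1) 2 (x t) by apply: hyp_ge1 => //; lra.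
    rewrite divr_ge0 ?poch_ge0//=; [|lra|lra].
    by rewrite ler_wpM2r ?invr_ge0 ?ler_poch//; lra.
  - exact: cvg_cst.
  - rewrite -[X in _ --> X](mulr0 (pochhammer (B + 1) l)).
    apply: cvgM; first exact: cvg_cst.
    apply/gtr0_cvgV0; last first. exact: hyp_two_cvgy.
    near=> t.
    have /andP[xt0 xt1] : 0 < x t < 1 by near: t.
    have /andP[n0 nB] : 0 < nu t <= B by near: t.
    have : 1 <= hyp (nu t + 1) 2 (x t) by apply: hyp_ge1 => //; lra.
    lra.
have -> : ((m == 0%N)%:R * l.+1`!%:R : R) = (((l + m).+1%:R * ((m == 0%N)%:R * l`!%:R) - 0) / 1).
  rewrite subr0 divr1; case: m {IH E} => [|m]; last by rewrite !mul0r mulr0.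
  by rewrite !mul1r addn0 factS natrM.
apply: cvg_trans E; apply: near_eq_cvg; near=> t.
have /andP[xt0 xt1] : 0 < x t < 1 by near: t.
have /andP[n0 nB] : 0 < nu t <= B by near: t.
by rewrite gcoefS ?xt0// ltW.
Unshelve. all: by end_near. Qed.

End AtZero.
End GCoef.

(** * Convexity, and minimisation of the total on a sublevel set *)

Section WeightedSum.
Context {R : realType}.
Implicit Types (a b c M v t : R).

(** The logarithmic derivative of [pochhammer a n] with respect to [a]. *)
Definition harm a n : R := \sum_(i < n) (a + i%:R)^-1.

(** Factor by factor, [(b + i) / (a + i) = 1 + (b - a) / (a + i)] is at most the exponential of
    [(b - a) / (a + i)], whatever the sign of [b - a]. *)
Lemma expR_poch_ratio a b n : 0 < a -> 0 < b ->
  expR (- (b - a) * harm a n) <= pochhammer a n / pochhammer b n.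
Proof.
move=> a0 b0; rewrite /harm mulr_sumr expR_sum /pochhammer -prodf_div.
apply: ler_prod => i _; rewrite expR_ge0/=.
have ai : 0 < a + i%:R by rewrite ltr_pwDl.
have bi : 0 < b + i%:R by rewrite ltr_pwDl.
rewrite mulNr expRN -[leRHS]invf_div lef_pV2 ?posrE ?expR_gt0 ?divr_gt0//.
apply: le_trans (expR_ge1Dx _).
by rewrite le_eqVlt; apply/orP; left; apply/eqP; field; rewrite gt_eqF.
Qed.

Definition kern (l m : nat) a b : R := (pochhammer a l * pochhammer b m)^-1.

Lemma kern_gt0 l m a b : 0 < a -> 0 < b -> 0 < kern l m a b.
Proof. by move=> a0 b0; rewrite invr_gt0 mulr_gt0 ?poch_gt0. Qed.

(* The tangent plane of the log-convex function kern lies below its graph. *)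
Lemma kern_tangent l m a b a' b' : 0 < a -> 0 < b -> 0 < a' -> 0 < b' ->
  kern l m a b * (1 - (a' - a) * harm a l - (b' - b) * harm b m) <= kern l m a' b'.
Proof.
move=> a0 b0 a'0 b'0.
have k0 := kern_gt0 l m a0 b0.
rewrite mulrC -ler_pdivlMr//.
have -> : kern l m a' b' / kern l m a b =
    (pochhammer a l / pochhammer a' l) * (pochhammer b m / pochhammer b' m).
  by rewrite /kern; field; rewrite !gt_eqF// poch_gt0.
apply: le_trans (ler_pM (expR_ge0 _) (expR_ge0 _) (expR_poch_ratio l a0 a'0)
  (expR_poch_ratio m b0 b'0)).
rewrite -expRD; apply: le_trans (expR_ge1Dx _).
by rewrite !mulNr addrA.
Qed.

(** Take the tangent plane at the intermediate point, evaluate it at both ends and average: the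
    linear parts cancel. *)
Lemma kern_convex l m a b a' b' t : 0 < a -> 0 < b -> 0 < a' -> 0 < b' -> 0 <= t <= 1 ->
  kern l m ((1 - t) * a + t * a') ((1 - t) * b + t * b') <=
  (1 - t) * kern l m a b + t * kern l m a' b'.
Proof.
move=> a0 b0 a'0 b'0 /andP[t0 t1].
set x := _ + t * a'; set y := _ + t * b'.
have [x0 y0] : 0 < x /\ 0 < y by rewrite /x /y; split; nra.
have H1 := kern_tangent l m x0 y0 a0 b0.
have H2 := kern_tangent l m x0 y0 a'0 b'0.
have t1' : 0 <= 1 - t by lra.
have := lerD (ler_wpM2l t1' H1) (ler_wpM2l t0 H2).
apply: le_trans; rewrite /x /y.
by rewrite le_eqVlt; apply/orP; left; apply/eqP; ring.
Qed.

Lemma kern_anti l m a b a' b' : 0 < a -> 0 < b -> a <= a' -> b <= b' ->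
  kern l m a' b' <= kern l m a b.
Proof.
move=> a0 b0 aa bb; rewrite /kern lef_pV2 ?posrE ?mulr_gt0 ?poch_gt0 ?(lt_le_trans _ aa)//.
  by rewrite ler_pM ?poch_ge0 ?ler_poch// ltW.
exact: lt_le_trans bb.
Qed.

Lemma kern_scale l m a b t : (0 < l + m)%N -> 0 < a -> 0 < b -> 1 <= t ->
  kern l m (t * a) (t * b) <= kern l m a b / t.
Proof.
move=> lm a0 b0 t1; have t0 : 0 < t by lra.
have ta : 0 < t * a by rewrite mulr_gt0.
have tb : 0 < t * b by rewrite mulr_gt0.
rewrite /kern -invfM lef_pV2 ?posrE ?mulr_gt0 ?poch_gt0//.
case: l lm => [|l] lm.
  case: m lm => [//|m] _; rewrite !poch0 !mul1r mulrC.
  by apply: poch_scaleS => //; exact: ltW.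
rewrite mulrC mulrA ler_pM ?mulr_ge0 ?poch_ge0 ?poch_scaleS ?poch_scale//; exact: ltW.
Qed.

Variable w : nat -> nat -> R.
Hypothesis w_ge0 : forall l m, 0 <= w l m.

(* The terms of total degree j + 1 of the series of ACV^2, as a function of the shapes. *)
Definition acvterm a b : R^nat := fun j =>
  \sum_(l < j.+2) w l (j.+1 - l)%N * kern l (j.+1 - l)%N a b.

(* The sum of the series, possibly infinite, is at most M. *)
Definition sumle M a b := forall n, series (acvterm a b) n <= M.

Lemma acvterm_ge0 a b j : 0 < a -> 0 < b -> 0 <= acvterm a b j.
Proof. by move=> a0 b0; apply: sumr_ge0 => i _; rewrite mulr_ge0// ltW// kern_gt0. Qed.

Lemma acvterm_convex a b a' b' t j : 0 < a -> 0 < b -> 0 < a' -> 0 < b' -> 0 <= t <= 1 ->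
  acvterm ((1 - t) * a + t * a') ((1 - t) * b + t * b') j <=
  (1 - t) * acvterm a b j + t * acvterm a' b' j.
Proof.
move=> a0 b0 a'0 b'0 t01; rewrite /acvterm !mulr_sumr -big_split /=.
apply: ler_sum => i _; rewrite !(mulrCA _ (w _ _)) -mulrDr ler_wpM2l//.
exact: kern_convex.
Qed.

Lemma acvterm_anti a b a' b' j : 0 < a -> 0 < b -> a <= a' -> b <= b' ->
  acvterm a' b' j <= acvterm a b j.
Proof. by move=> *; apply: ler_sum => i _; rewrite ler_wpM2l// kern_anti. Qed.

Lemma acvterm_scale a b t j : 0 < a -> 0 < b -> 1 <= t ->
  acvterm (t * a) (t * b) j <= acvterm a b j / t.
Proof.
move=> *; rewrite mulr_suml; apply: ler_sum => i _; rewrite -mulrA ler_wpM2l//.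
by rewrite kern_scale// subnKC// -ltnS.
Qed.

Lemma acvterm0 a b : acvterm a b 0 = w 0 1 / b + w 1 0 / a.
Proof.
rewrite /acvterm !big_ord_recl big_ord0 addr0 /= /kern subnn subn0.
by rewrite !pochS !poch0 mulr1 !mul1r !addr0.
Qed.

Lemma sumle_convex a b a' b' t M M' : 0 < a -> 0 < b -> 0 < a' -> 0 < b' -> 0 <= t <= 1 ->
  sumle M a b -> sumle M' a' b' ->
  sumle ((1 - t) * M + t * M') ((1 - t) * a + t * a') ((1 - t) * b + t * b').
Proof.
move=> a0 b0 a'0 b'0 t01 H H' n; have /andP[t0 t1] := t01.
apply: (@le_trans _ _ ((1 - t) * series (acvterm a b) n + t * series (acvterm a' b') n)).
  rewrite /series /= !mulr_sumr -big_split; apply: ler_sum => i _; exact: acvterm_convex.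
by rewrite lerD// ler_wpM2l//; lra.
Qed.

Lemma sumle_anti a b a' b' M : 0 < a -> 0 < b -> a <= a' -> b <= b' ->
  sumle M a b -> sumle M a' b'.
Proof.
by move=> *; move=> n; apply: le_trans (_ : _ <= series (acvterm a b) n) _ => //;
  apply: ler_sum => i _; exact: acvterm_anti.
Qed.

Lemma sumle_scale a b t M : 0 < a -> 0 < b -> 1 <= t ->
  sumle M a b -> sumle (M / t) (t * a) (t * b).
Proof.
move=> a0 b0 t1 H n; apply: (@le_trans _ _ (series (acvterm a b) n / t)).
  rewrite /series /= mulr_suml; apply: ler_sum => i _; exact: acvterm_scale.
by rewrite ler_pM2r// invr_gt0; lra.
Qed.

Lemma sumleW M M' a b : M <= M' -> sumle M a b -> sumle M' a b.
Proof. by move=> MM H n; exact: le_trans MM. Qed.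

Lemma sumle_coord M a b : 0 < a -> 0 < b -> sumle M a b ->
  w 0 1 / b <= M /\ w 1 0 / a <= M.
Proof.
move=> a0 b0 /(_ 1%N); rewrite /series /= big_nat1 acvterm0.
have : 0 <= w 0 1 / b by rewrite divr_ge0// ltW.
have : 0 <= w 1 0 / a by rewrite divr_ge0// ltW.
by move=> *; split; lra.
Qed.

(** A gain in the term of degree 1 is enough, the others being compared weakly; that term,
    [w 0 1 / b + w 1 0 / a], is simple enough to exhibit the gain. *)
Lemma sumle_strict c M a b (U : R^nat) : 0 < a -> 0 < b ->
  (forall n, series U n <= M) -> acvterm a b 0 + c <= U 0%N ->
  (forall j, acvterm a b j <= U j) -> sumle (M - c) a b.
Proof.
move=> a0 b0 UM H0 H n.
apply: (@le_trans _ _ (series (acvterm a b) n.+1)).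
  rewrite seriesSr lerDl; exact: acvterm_ge0.
rewrite lerBrDr; apply: le_trans (UM n.+1).
rewrite /series /= !big_nat_recl//= addrAC lerD//.
by apply: ler_sum => i _; exact: H.
Qed.

Hypothesis w10 : 0 < w 1 0.

Lemma sumle_strict_anti a b h M : 0 < a -> 0 < b -> 0 < h -> sumle M a b ->
  exists2 c, 0 < c & sumle (M - c) (a + h) b.
Proof.
move=> a0 b0 h0 H; exists (w 1 0 / a - w 1 0 / (a + h)).
  by rewrite subr_gt0 ltr_pM2l// ltf_pV2 ?posrE; lra.
apply: (@sumle_strict _ _ _ _ (acvterm a b)) => //; first lra.
  by rewrite !acvterm0; lra.
by move=> j; apply: acvterm_anti => //; lra.
Qed.

Lemma sumle_strict_convex a b a' b' M : 0 < a -> 0 < b -> 0 < a' -> 0 < b' ->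
  a != a' -> sumle M a b -> sumle M a' b' ->
  exists2 c, 0 < c & sumle (M - c) ((a + a') / 2) ((b + b') / 2).
Proof.
move=> a0 b0 a'0 b'0 aa H H'.
have half : 1 - 2^-1 = 2^-1 :> R by lra.
(* The midpoint convexity gap of the reciprocal, equal to [(a - a')^2 / (2 a a' (a + a'))]. *)
exists (w 1 0 * ((a^-1 + a'^-1) / 2 - ((a + a') / 2)^-1)).
  rewrite mulr_gt0//.
  have -> : (a^-1 + a'^-1) / 2 - ((a + a') / 2)^-1 =
     (a - a') ^+ 2 / (2 * a * a' * (a + a')).
    by field; rewrite !gt_eqF//; lra.
  by rewrite divr_gt0// ?exprn_even_gt0//= ?subr_eq0// !mulr_gt0//; lra.
pose U j := (acvterm a b j + acvterm a' b' j) / 2.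
have E j : U j = (1 - 2^-1) * acvterm a b j + 2^-1 * acvterm a' b' j.
  by rewrite half /U; lra.
have Ea : (a + a') / 2 = (1 - 2^-1) * a + 2^-1 * a' by rewrite half; lra.
have Eb : (b + b') / 2 = (1 - 2^-1) * b + 2^-1 * b' by rewrite half; lra.
apply: (@sumle_strict _ _ _ _ U); [lra|lra| | |].
- move=> n; have -> : series U n = (series (acvterm a b) n + series (acvterm a' b') n) / 2.
    by rewrite /series /= /U -big_split -mulr_suml.
  by have := H n; have := H' n; lra.
- rewrite /U !acvterm0.
  have := @kern_convex 0 1 a b a' b' 2^-1 a0 b0 a'0 b'0.
  rewrite -Ea -Eb /kern !pochS !poch0 half !mul1r !addr0 => K.
  have {}K := K ltac:(lra).
  move: K => /(ler_wpM2l (w_ge0 0 1)); lra.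
- by move=> j; rewrite E Ea Eb; apply: acvterm_convex => //; lra.
Qed.

End WeightedSum.

(** * Existence, uniqueness and sharpness of the minimal total *)

Section Minimiser.
Context {R : realType}.
Implicit Types (a b c M v t : R).

Lemma cvg_poch (T : Type) (F : set_system T) {FF : Filter F} (f : T -> R) (l : R) n :
  f t @[t --> F] --> l -> pochhammer (f t) n @[t --> F] --> pochhammer l n.
Proof.
by move=> fl; apply: cvg_prodr => i _; apply: cvgD => //; exact: cvg_cst.
Qed.

Lemma cvg_kern (T : Type) (F : set_system T) {FF : Filter F} (f g : T -> R) a b l m :
  0 < a -> 0 < b -> f t @[t --> F] --> a -> g t @[t --> F] --> b ->
  kern l m (f t) (g t) @[t --> F] --> kern l m a b.
Proof.
move=> a0 b0 fa gb; apply: cvgV; first by rewrite gt_eqF// mulr_gt0 ?poch_gt0.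
by apply: cvgM; exact: cvg_poch.
Qed.

Variable w : nat -> nat -> R.
Hypothesis w_ge0 : forall l m, 0 <= w l m.
Hypothesis w10 : 0 < w 1 0.
Hypothesis w01 : 0 < w 0 1.
Hypothesis open_domain : forall M a b, 0 < a -> 0 < b -> sumle w M a b ->
  exists r M', [/\ 0 < r, r < a, r < b & sumle w M' (a - r) (b - r)].

Lemma cvg_acvterm (T : Type) (F : set_system T) {FF : Filter F} (f g : T -> R) a b j :
  0 < a -> 0 < b -> f t @[t --> F] --> a -> g t @[t --> F] --> b ->
  acvterm w (f t) (g t) j @[t --> F] --> acvterm w a b j.
Proof.
move=> a0 b0 fa gb; apply: cvg_sumr => i _; apply: cvgM; first exact: cvg_cst.
exact: cvg_kern.
Qed.

Definition total_min v a b := [/\ 0 < a, 0 < b, sumle w v a b &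
  forall a' b', 0 < a' -> 0 < b' -> sumle w v a' b' -> a + b <= a' + b'].

(** With slack [c], one could move slightly towards [(a - r, b)], where the sum is still finite by
    openness. Convexity keeps the bound below [v], and the total drops. *)
Lemma total_min_sharp v a b c : total_min v a b -> 0 < c -> ~ sumle w (v - c) a b.
Proof.
case=> a0 b0 _ min c0 H.
have [r [M [r0 ra rb HM]]] := open_domain a0 b0 H.
have HM' : sumle w M (a - r) b by apply: sumle_anti HM => //; lra.
(* Chosen so that [t * (M - (v - c)) <= c]; the summand [c] in the denominator ensures [t <= 1]. *)
pose t := c / (c + `|M - (v - c)|).
have d0 : 0 < c + `|M - (v - c)| by rewrite ltr_pwDl.
have t01 : 0 <= t <= 1.
  apply/andP; split; first by rewrite divr_ge0// ltW.
  by rewrite ler_pdivrMr// mul1r lerDl.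
have t0 : 0 < t by rewrite divr_gt0.
have ar : 0 < a - r by lra.
have := sumle_convex w_ge0 a0 b0 ar b0 t01 H HM'.
have -> : (1 - t) * a + t * (a - r) = a - t * r by ring.
have -> : (1 - t) * b + t * b = b by ring.
have a1 : 0 < a - t * r by have /andP[] := t01; nra.
have bnd : (1 - t) * (v - c) + t * M <= v.
  have : t * (c + `|M - (v - c)|) = c by rewrite /t divfK ?gt_eqF.
  have := ler_norm (M - (v - c)).
  nra.
move=> /(sumleW bnd) /(min _ _ a1 b0).
have : 0 < t * r by rewrite mulr_gt0.
lra.
Qed.

Lemma total_min_uniq v a b a' b' :
  total_min v a b -> total_min v a' b' -> (a, b) = (a', b').
Proof.
move=> m1 m2; have [a0 b0 H min] := m1; have [a'0 b'0 H' min'] := m2.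
have tot : a + b = a' + b'.
  by apply/eqP; rewrite eq_le min//= min'.
have [aa|aa] := eqVneq a a'; first by congr (_, _) => //; lra.
have [c c0 Hc] := sumle_strict_convex w_ge0 w10 a0 b0 a'0 b'0 aa H H'.
have m0 : 0 < (a + a') / 2 by lra.
have m0' : 0 < (b + b') / 2 by lra.
case: (@total_min_sharp v _ _ c _ c0 Hc); split => //.
  by apply: sumleW Hc; lra.
by move=> x y x0 y0 /(min _ _ x0 y0); lra.
Qed.

(** The degree-1 term keeps feasible shapes away from 0, and one feasible pair [(p, q)] caps the
    relevant totals at [B], which leaves a compact box. *)
Lemma total_min_exists v a b M : 0 < v -> 0 < a -> 0 < b -> sumle w M a b ->
  exists a' b', total_min v a' b'.
Proof.
move=> v0 a0 b0 HM.
have [p [q [p0 q0 Hpq]]] : exists p q, [/\ 0 < p, 0 < q & sumle w v p q].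
  (* Dilation by [t] divides the bound [M] by [t], and [t * v >= M]. *)
  pose t := 1 + `|M| / v.
  have t1 : 1 <= t by rewrite lerDl divr_ge0// ltW.
  have tp : 0 < t by lra.
  exists (t * a), (t * b); split; [exact: mulr_gt0|exact: mulr_gt0|].
  apply: sumleW (sumle_scale w_ge0 a0 b0 t1 HM).
  rewrite ler_pdivrMr//; apply: le_trans (ler_norm _) _.
  have : v * (`|M| / v) = `|M| by rewrite mulrCA divff ?mulr1// gt_eqF.
  by rewrite /t mulrDr mulr1; lra.
pose e1 := w 1 0 / v; pose e2 := w 0 1 / v; pose B := p + q.
have e10 : 0 < e1 by rewrite divr_gt0.
have e20 : 0 < e2 by rewrite divr_gt0.
have low x y : 0 < x -> 0 < y -> sumle w v x y -> e1 <= x /\ e2 <= y.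
  move=> x0 y0 /(sumle_coord w_ge0 x0 y0)[h1 h2]; rewrite /e1 /e2; split.
    by rewrite ler_pdivrMr// mulrC -ler_pdivrMr.
  by rewrite ler_pdivrMr// mulrC -ler_pdivrMr.
pose box : set (R * R) := `[e1, B]%classic `*` `[e2, B]%classic.
pose S : set (R * R) := [set z | box z /\ sumle w v z.1 z.2].
have cbox : compact box by apply: compact_setX; exact: segment_compact.
have hbox : closed box by apply: compact_closed => //; exact: norm_hausdorff.
have cS : compact S.
  apply: (subclosed_compact _ cbox); last by move=> z [].
  move=> z cz.
  have bz : box z.
    by apply: hbox; apply: (closure_subset _ cz) => y [].
  split => // n; rewrite leNgt; apply/negP => vz.
  have z10 : 0 < z.1.
    by case: bz => /=; rewrite in_itv/= => /andP[+ _] _; exact: lt_le_trans.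
  have z20 : 0 < z.2.
    by case: bz => /= _; rewrite in_itv/= => /andP[+ _]; exact: lt_le_trans.
  have L : series (acvterm w y.1 y.2) n @[y --> z] --> series (acvterm w z.1 z.2) n.
    by apply: cvg_sumr => i _; apply: cvg_acvterm => //; [exact: cvg_fst|exact: cvg_snd].
  have N : nbhs z [set y | v < series (acvterm w y.1 y.2) n].
    exact: (cvgr_gt _ L).
  have [y [[_ /(_ n)]]] := cz _ N.
  by rewrite /= leNgt => /negP.
have S0 : S !=set0.
  have [h1 h2] := low _ _ p0 q0 Hpq.
  exists (p, q); split => //; split => /=; rewrite in_itv/=; apply/andP; split=> //; rewrite /B; lra.
have ctot : {within S, continuous (fun z : R * R => z.1 + z.2)}.
  by apply: continuous_subspaceT => z; apply: cvgD; [exact: cvg_fst|exact: cvg_snd].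
have [[x y]] := compact_EVT_min S0 cS ctot.
rewrite inE => -[[/= bx by_] Hxy] min.
rewrite !in_itv/= in bx by_.
have /andP[e1x xB] := bx; have /andP[e2y yB] := by_.
have x0 : 0 < x by lra. have y0 : 0 < y by lra.
exists x, y; split => // x' y' x'0 y'0 H'.
have [h1 h2] := low _ _ x'0 y'0 H'.
have [hB|hB] := leP (x' + y') B.
  have := min (x', y'); rewrite inE; apply; split => //.
  by split => /=; rewrite in_itv/=; apply/andP; split => //; lra.
have := min (p, q); rewrite inE /= => hpq; apply: le_trans (ltW hB); apply: hpq.
have [h3 h4] := low _ _ p0 q0 Hpq.
split => //; split => /=; rewrite in_itv/=; apply/andP; split=> //; rewrite /B; lra.
Qed.

(** Such a pair would be another minimiser of the total, but with slack, against
    [total_min_sharp]. *)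
Lemma total_min_optimal v a b a' b' c : total_min v a b -> 0 < a' -> 0 < b' ->
  a' + b' = a + b -> 0 < c -> ~ sumle w (v - c) a' b'.
Proof.
move=> [a0 b0 H min] a'0 b'0 tot c0 H'.
case: (@total_min_sharp v a' b' c _ c0 H'); split => //.
  by apply: sumleW H'; lra.
by move=> *; rewrite tot; exact: min.
Qed.

End Minimiser.

(** * The domain of finiteness of ACV^2 *)

Section Domain.
Context {R : realType}.
Implicit Types (a b c s M nu x : R).

Lemma series_convol (p q : R^nat) n :
  \sum_(0 <= k < n.+1) \sum_(l < k.+1) p l * q (k - l)%N =
  \sum_(l < n.+1) p l * series q (n.+1 - l)%N.
Proof.
elim: n => [|n IH].
  rewrite big_nat1 !big_ord1 /=. rewrite subnn subn0; by rewrite /series /= big_nat1.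
rewrite big_nat_recr//= IH [RHS]big_ord_recr [X in _ + X]big_ord_recr /= !subnn.
rewrite addrA -big_split /= subSnn; congr (_ + _); last by rewrite /series /= big_nat1.
by apply: eq_bigr => i _; rewrite -mulrDr (subSn (ltnW (ltn_ord i))) seriesSr.
Qed.

Lemma series_convol_le (p q : R^nat) n : (forall i, 0 <= p i) -> (forall i, 0 <= q i) ->
  series (fun j => \sum_(l < j.+2) p l * q (j.+1 - l)%N) n <= series p n.+1 * series q n.+1.
Proof.
move=> p0 q0.
apply: (@le_trans _ _ (\sum_(0 <= k < n.+1) \sum_(l < k.+1) p l * q (k - l)%N)).
  rewrite big_nat_recl//= lerDr; apply: sumr_ge0 => i _; exact: mulr_ge0.
rewrite series_convol /series /= [in leRHS]big_mkord mulr_suml.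
apply: ler_sum => i _; rewrite ler_wpM2l//.
by apply: (@nondecreasing_series _ q xpredT 0); [move=> ? _ _; exact: q0|exact: leq_subr].
Qed.

Lemma cubic_ge0 (eta B C D v : R) : 0 < eta -> 1 <= v -> `|B| + `|C| + `|D| <= eta * v ->
  0 <= eta * v ^+ 3 + B * v ^+ 2 + C * v + D.
Proof.
move=> e0 v1 H.
have nb (y : R) : - `|y| <= y by rewrite lerNl -normrN ler_norm.
have v2 : v <= v ^+ 2 by rewrite expr2 ler_peMl//; lra.
have v21 : 1 <= v ^+ 2 by lra.
have hB : - `|B| * v ^+ 2 <= B * v ^+ 2 by rewrite ler_wpM2r//; lra.
have hC : - `|C| * v ^+ 2 <= C * v.
  have : - `|C| * v <= C * v by rewrite ler_wpM2r//; lra.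
  have : `|C| * v <= `|C| * v ^+ 2 by rewrite ler_wpM2l.
  lra.
have hD : - `|D| * v ^+ 2 <= D.
  have : `|D| <= `|D| * v ^+ 2 by rewrite ler_peMr.
  have := nb D.
  lra.
have : (`|B| + `|C| + `|D|) * v ^+ 2 <= eta * v * v ^+ 2 by rewrite ler_wpM2r//; lra.
rewrite -mulrA -exprS; lra.
Qed.

Lemma powR_succ_ratio s (n : nat) : 0 <= s ->
  n.+1%:R `^ s * (n%:R + 2 + s) <= n.+2%:R `^ s * (n%:R + 2).
Proof.
move=> s0.
have h1 : 0 < n.+1%:R :> R by rewrite ltr0n.
have h2 : 0 < n.+2%:R :> R by rewrite ltr0n.
have e2 : n.+2%:R = n%:R + 2 :> R by rewrite -addn2 natrD.
have -> : n.+1%:R = n.+2%:R * (n.+1%:R / n.+2%:R) :> R by rewrite mulrCA divff ?mulr1// gt_eqF.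
rewrite powRM ?divr_ge0// -mulrA ler_wpM2l ?powR_ge0//.
have r0 : 0 < n.+1%:R / n.+2%:R :> R by rewrite divr_gt0.
rewrite /powR gt_eqF//.
have hl : ln (n.+1%:R / n.+2%:R) <= - (n%:R + 2)^-1 :> R.
  have -> : n.+1%:R / n.+2%:R = 1 + (- (n%:R + 2)^-1) :> R.
    rewrite -e2 -(natr1 n.+1); field.
    by rewrite gt_eqF//; have := ler0n R n; lra.
  apply: le_ln1Dx; rewrite ltrN2 invf_lt1 -?e2// ltr1n//.
have n0 : 0 < n%:R + 2 :> R by rewrite -e2.
have hs : expR (s * ln (n.+1%:R / n.+2%:R)) <= expR (- (s / (n%:R + 2))).
  by rewrite ler_expR -mulrN ler_wpM2l.
have hs2 : expR (- (s / (n%:R + 2))) * (n%:R + 2 + s) <= n%:R + 2.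
  rewrite expRN mulrC ler_pdivrMr ?expR_gt0//.
  have -> : n%:R + 2 + s = (n%:R + 2) * (1 + s / (n%:R + 2)) by field; rewrite gt_eqF.
  by rewrite ler_pM2l// expR_ge1Dx.
apply: le_trans hs2; rewrite ler_wpM2r//; lra.
Qed.

(** The terms are of order l^(2c - a - 1 - s). Raabe's test is applied with half of the excess
    [a + s - 2 * c]. *)
Lemma poch_sq_summable c a s : 0 < a -> 0 <= s -> 2 * c < a + s ->
  cvgn (series (fun l => pochhammer c l ^+ 2 / (pochhammer a l * l`!%:R * l.+1%:R `^ s))).
Proof.
move=> a0 s0 H.
pose eta := (a + s - 2 * c) / 2.
have eta0 : 0 < eta by rewrite /eta; lra.
(* [eta], [B], [C], [D] are the coefficients of [v (v + 1) (a + v) (v + 2 + s) - (v + 1 + eta) (c +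
   v)^2 (v + 2)], whose quartic terms cancel. *)
pose B := (a * (2 + s) + a + 2 + s) - (c ^+ 2 + 2 * c * (3 + eta) + 2 * (1 + eta)).
pose C := a * (2 + s) - (c ^+ 2 * (3 + eta) + 4 * c * (1 + eta)).
pose D := - (2 * (1 + eta) * c ^+ 2).
pose N := (Num.truncn ((`|B| + `|C| + `|D|) / eta)).+1.
have f0 l : 0 < l`!%:R :> R by rewrite ltr0n fact_gt0.
have pw0 l : 0 < l.+1%:R `^ s :> R by rewrite powR_gt0// ltr0n.
apply: (@raabe _ _ eta N) => //.
  by move=> l; rewrite divr_ge0 ?sqr_ge0// !mulr_ge0 ?powR_ge0 ?poch_ge0// ltW.
move=> l Nl.
have l1 : 1 <= l%:R :> R by rewrite ler1n (leq_trans _ Nl).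
have hl : `|B| + `|C| + `|D| <= eta * l%:R.
  rewrite mulrC -ler_pdivrMr//; apply: (le_trans (ltW (truncnS_gt _))).
  by rewrite ler_nat.
have K := cubic_ge0 eta0 l1 hl.
rewrite !pochS factS natrM.
have P := powR_succ_ratio l s0.
have pa := poch_gt0 l a0.
move: (pochhammer c l) (pochhammer a l) (_`!%:R) (f0 l) pa => pc pa f {}f0 pa0.
move: (l.+1%:R `^ s) (l.+2%:R `^ s) (pw0 l) (pw0 l.+1) P => y z y0 z0 P.
rewrite -(natr1 l).
move: (l%:R) l1 K P {hl} => v v1 K P.
have poly : (v + 1 + eta) * (c + v) ^+ 2 * (v + 2) <= v * (v + 1) * (a + v) * (v + 2 + s).
  rewrite -subr_ge0; apply: le_trans K _.
  by rewrite le_eqVlt; apply/orP; left; apply/eqP; rewrite /B /C /D /eta; field.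
have av : 0 < a + v by lra.
have -> : (v + 1 + eta) * ((pc * (c + v)) ^+ 2 / (pa * (a + v) * ((v + 1) * f) * z)) =
  (pc ^+ 2 / (pa * f)) * ((v + 1 + eta) * (c + v) ^+ 2 / ((a + v) * (v + 1) * z)).
  by field; rewrite !gt_eqF//; lra.
have -> : v * (pc ^+ 2 / (pa * f * y)) = (pc ^+ 2 / (pa * f)) * (v / y).
  by field; rewrite !gt_eqF.
have c0 : 0 <= pc ^+ 2 / (pa * f) by rewrite divr_ge0 ?sqr_ge0// ltW// mulr_gt0.
rewrite ler_wpM2l//.
rewrite ler_pdivrMr ?mulr_gt0//; last lra.
rewrite mulrAC ler_pdivlMr//.
have v2 : 0 < v + 2 by lra.
rewrite -(ler_pM2r v2).
have h1 := ler_wpM2l (ltW y0) poly.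
have h2 : 0 <= v * (v + 1) * (a + v) by rewrite !mulr_ge0//; lra.
have h3 := ler_wpM2l h2 P.
lra.
Qed.

(* The coefficients of ACV^2 up to bounded factors, see weight_bweight. *)
Definition bweight nu l m : R :=
  pochhammer (nu + 1) l ^+ 2 * pochhammer (1 - nu) m ^+ 2 /
  ((l + m).+1%:R ^+ 2 * l`!%:R * m`!%:R).

(* (l + m + 1)^2 >= (l + 1)^(2 - th) (m + 1)^th decouples the double series. *)
Lemma bweight_finite nu a b : 0 < nu -> 0 < a -> 0 < b -> 2 * nu < a -> 2 < a + b ->
  exists M, sumle (bweight nu) M a b.
Proof.
move=> nu0 a0 b0 h1 h2.
(* The last two conditions are summability in [l] and in [m]. The interval for [th] is nonempty
   because [2 * nu < a] and [2 < a + b]; its midpoint is taken. *)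
have [th [t0 t2 ta tb]] : exists th : R, [/\ 0 <= th, th <= 2, th < a - 2 * nu & 2 - 2 * nu - b < th].
  exists ((Num.max 0 (2 - 2 * nu - b) + Num.min 2 (a - 2 * nu)) / 2).
  by rewrite /Num.max /Num.min; case: ifP => ?; case: ifP => ?; split; lra.
pose p l := pochhammer (nu + 1) l ^+ 2 / (pochhammer a l * l`!%:R * l.+1%:R `^ (2 - th)) : R.
pose q m := pochhammer (1 - nu) m ^+ 2 / (pochhammer b m * m`!%:R * m.+1%:R `^ th) : R.
have f0 l : 0 < l`!%:R :> R by rewrite ltr0n fact_gt0.
have p0 l : 0 <= p l by rewrite divr_ge0 ?sqr_ge0// !mulr_ge0 ?powR_ge0 ?poch_ge0// ltW.
have q0 l : 0 <= q l by rewrite divr_ge0 ?sqr_ge0// !mulr_ge0 ?powR_ge0 ?poch_ge0// ltW.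
have cp : cvgn (series p) by apply: poch_sq_summable => //; lra.
have cq : cvgn (series q) by apply: poch_sq_summable => //; lra.
exists (limn (series p) * limn (series q)) => n.
apply: (@le_trans _ _ (series p n.+1 * series q n.+1)); last first.
  by rewrite ler_pM ?series_partial_le// /series /= sumr_ge0.
apply: le_trans (series_convol_le n p0 q0).
apply: ler_sum => j _; apply: ler_sum => l _.
rewrite /bweight /kern /p /q; move: (j.+1 - l)%N => m; move: (nat_of_ord l) => {}l.
have pa := poch_gt0 l a0; have pb := poch_gt0 m b0.
have y0 : 0 < l.+1%:R `^ (2 - th) :> R by rewrite powR_gt0// ltr0n.
have z0 : 0 < m.+1%:R `^ th :> R by rewrite powR_gt0// ltr0n.
have k0 : 0 < (l + m).+1%:R :> R by rewrite ltr0n.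
have yz : l.+1%:R `^ (2 - th) * m.+1%:R `^ th <= (l + m).+1%:R ^+ 2 :> R.
  have -> : (l + m).+1%:R ^+ 2 = (l + m).+1%:R `^ (2 - th) * (l + m).+1%:R `^ th :> R.
    by rewrite -powRD ?(gt_eqF k0) ?implybT// subrK powR_mulrn.
  have h3 : 0 <= 2 - th by lra.
  apply: ler_pM; rewrite ?powR_ge0//.
    by apply: ge0_ler_powR; rewrite ?nnegrE ?ler_nat ?ltnS ?leq_addr.
  by apply: ge0_ler_powR; rewrite ?nnegrE ?ler_nat ?ltnS ?leq_addl.
move: (pochhammer (nu + 1) l) (pochhammer (1 - nu) m) (pochhammer a l) (pochhammer b m) pa pb.
move=> P Q A B A0 B0.
move: (l`!%:R) (m`!%:R) (f0 l) (f0 m) (l.+1%:R `^ _) (m.+1%:R `^ _) ((l + m).+1%:R) k0 y0 z0 yz.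
move=> f g f00 g00 y z k k0 y0 z0 yz.
have -> : P ^+ 2 * Q ^+ 2 / (k ^+ 2 * f * g) / (A * B) =
  P ^+ 2 * Q ^+ 2 / (f * g * A * B) / (k ^+ 2) by field; rewrite !gt_eqF.
have -> : P ^+ 2 / (A * f * y) * (Q ^+ 2 / (B * g * z)) =
  P ^+ 2 * Q ^+ 2 / (f * g * A * B) / (y * z) by field; rewrite !gt_eqF.
have c0 : 0 <= P ^+ 2 * Q ^+ 2 / (f * g * A * B).
  apply: divr_ge0; first by rewrite mulr_ge0 ?sqr_ge0.
  by rewrite ltW// !mulr_gt0.
by rewrite ler_wpM2l// lef_pV2 ?posrE ?exprn_gt0 ?mulr_gt0.
Qed.

End Domain.

(** * Divergence on the boundary of the domain *)

Section OpenDomain.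
Context {R : realType}.
Implicit Types (a b c M nu x : R).

Lemma harmonic_minorant (u : R^nat) c M : 0 < c -> (forall j, c / j.+2%:R <= u j) ->
  ~ (forall n, series u n <= M).
Proof.
move=> c0 uc uM; apply: (@dvg_harmonic R).
apply: (@series_bounded_cvg _ _ (1 + M / c)) => [n|n]; first exact: harmonic_ge0.
apply: (@le_trans _ _ (series (@harmonic R) n.+1)).
  by rewrite seriesSr lerDl harmonic_ge0.
rewrite /series /= big_nat_recl//= /harmonic /= invr1 lerD2l ler_pdivlMr//.
apply: le_trans (uM n); rewrite /series /= mulr_suml.
by apply: ler_sum => i _; rewrite mulrC; exact: uc.
Qed.

Lemma bweight_ge0 nu l m : 0 <= bweight nu l m :> R.
Proof. by rewrite /bweight; nneg. Qed.

(** By monotonicity it is enough to diverge at [a = 2 * nu]. There the terms with [m = 0] alone are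
    at least [1 / j.+2], by an induction whose step comes down to [(nu - 1)^2 >= 0]. *)
Lemma sumle_bweight_left nu a b M : 0 < nu -> 0 < a -> 0 < b ->
  sumle (bweight nu) M a b -> 2 * nu < a.
Proof.
move=> nu0 a0 b0 H; rewrite ltNge; apply/negP => anu.
have nu20 : 0 < 2 * nu by lra.
have {H} : sumle (bweight nu) M (2 * nu) b.
  by apply: sumle_anti H => //; exact: bweight_ge0.
apply: (@harmonic_minorant _ 1) => // j.
rewrite /acvterm big_ord_recr /= subnn.
apply: ler_wpDl.
  by apply: sumr_ge0 => i _; rewrite mulr_ge0 ?bweight_ge0// ltW// kern_gt0.
rewrite /bweight /kern !poch0 addn0 expr1n !mulr1.
have key l : l.+1%:R * (pochhammer (2 * nu) l * l`!%:R) <= pochhammer (nu + 1) l ^+ 2.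
  elim: l => [|l IH]; first by rewrite !poch0 !mulr1 expr1n.
  rewrite !pochS factS natrM exprMn.
  have h1 : l.+2%:R * (2 * nu + l%:R) <= (nu + 1 + l%:R) ^+ 2.
    rewrite -(natr1 l.+1) -(natr1 l) -subr_ge0.
    have -> : (nu + 1 + l%:R) ^+ 2 - (l%:R + 1 + 1) * (2 * nu + l%:R) = (nu - 1) ^+ 2 by ring.
    exact: sqr_ge0.
  have -> : l.+2%:R * (pochhammer (2 * nu) l * (2 * nu + l%:R) * (l.+1%:R * l`!%:R)) =
    (l.+1%:R * (pochhammer (2 * nu) l * l`!%:R)) * (l.+2%:R * (2 * nu + l%:R)) by ring.
  by apply: ler_pM => //; nneg.
have := key j.+1; move: (pochhammer (nu + 1) _ ^+ 2) => P.
have := poch_gt0 j.+1 nu20; have : 0 < j.+1`!%:R :> R by rewrite ltr0n fact_gt0.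
move: (pochhammer _ _) (_`!%:R) (j.+2%:R : R) (ltr0Sn R j.+1) => A f k k0 f0 A0 H.
have -> : P / (k ^+ 2 * f) / A = P / (k * (A * f)) / k by field; rewrite !gt_eqF.
rewrite ler_pM2r ?invr_gt0// ler_pdivlMr ?mul1r//.
by rewrite !mulr_gt0.
Qed.

(** The right-hand side is l!^2 times the product of 1 - nu^2 / i^2 over 1 <= i <= l. Keep the
    factor at i = 1 and replace nu by 1 in the others: their product is then (l + 1) / (2 l), the
    sharper value carried by the induction. *)
Lemma poch_reflect_ge nu l : 0 < nu < 1 ->
  (1 - nu ^+ 2) / 2 * l`!%:R ^+ 2 <= pochhammer (nu + 1) l * pochhammer (1 - nu) l.
Proof.
move=> /andP[nu0 nu1].
have n2 : 0 < 1 - nu ^+ 2 by nra.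
case: l => [|l]; first by rewrite !poch0 expr1n; nra.
suff key : (1 - nu ^+ 2) * l.+2%:R * l.+1`!%:R ^+ 2 <=
    2 * l.+1%:R * (pochhammer (nu + 1) l.+1 * pochhammer (1 - nu) l.+1).
  have : (1 - nu ^+ 2) * l.+1%:R * l.+1`!%:R ^+ 2 <= (1 - nu ^+ 2) * l.+2%:R * l.+1`!%:R ^+ 2.
    by rewrite ler_wpM2r ?sqr_ge0// ler_wpM2l ?ler_nat// ltW.
  move=> /le_trans/(_ key).
  move: (l.+1`!%:R ^+ 2) (pochhammer _ _ * _) (l.+1%:R : R) (ltr0Sn R l) => F P k k0.
  have -> : (1 - nu ^+ 2) * k * F = k * ((1 - nu ^+ 2) * F) by ring.
  have -> : 2 * k * P = k * (2 * P) by ring.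
  by rewrite ler_pM2l//; lra.
elim: l => [|l IH].
  by rewrite !pochS !poch0 (_ : 1`!%N = 1%N)//; lra.
rewrite (pochS _ l.+1) (pochS (1 - nu) l.+1) (factS l.+1) natrM.
have F0 : 0 <= l.+1`!%:R ^+ 2 :> R by exact: sqr_ge0.
move: (pochhammer (nu + 1) _) (pochhammer (1 - nu) _) (_`!%:R) IH F0 => P Q f.
rewrite -(natr1 l.+2) -(natr1 l.+1) -(natr1 l).
move: (l%:R : R) (ler0n R l) => v v0 IH F0.
have h : (v + 2) ^+ 2 - 1 <= (v + 2) ^+ 2 - nu ^+ 2 by nra.
have h0 : 0 <= (v + 2) ^+ 2 - 1 by nra.
have h1 : 0 <= (1 - nu ^+ 2) * (v + 1 + 1) * f ^+ 2.
  by apply: mulr_ge0 => //; apply: mulr_ge0; lra.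
have PQ : 0 <= P * Q.
  have : 0 <= 2 * (v + 1) * (P * Q) by apply: le_trans IH.
  by rewrite pmulr_rge0//; lra.
have step : (v + 1) * ((1 - nu ^+ 2) * (v + 1 + 1 + 1) * ((v + 1 + 1) * f) ^+ 2) <=
   (v + 1) * (2 * (v + 1 + 1) * (P * (nu + 1 + (v + 1)) * (Q * (1 - nu + (v + 1))))).
  have -> : (v + 1) * ((1 - nu ^+ 2) * (v + 1 + 1 + 1) * ((v + 1 + 1) * f) ^+ 2) =
    ((1 - nu ^+ 2) * (v + 1 + 1) * f ^+ 2) * ((v + 2) * ((v + 2) ^+ 2 - 1)) by ring.
  have -> : (v + 1) * (2 * (v + 1 + 1) * (P * (nu + 1 + (v + 1)) * (Q * (1 - nu + (v + 1))))) =
    (2 * (v + 1) * (P * Q)) * ((v + 2) * ((v + 2) ^+ 2 - nu ^+ 2)) by ring.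
  apply: ler_pM => //; first by rewrite mulr_ge0//; lra.
  by rewrite ler_wpM2l//; lra.
by move: step; rewrite ler_pM2l//; lra.
Qed.

(* On the line a + b = 2, AM-GM applied to the terms (l, m) and (m, l) bounds the terms of
   total degree k below by a multiple of 1 / k. *)
Lemma sumle_bweight_total nu a b M : 0 < nu < 1 -> 0 < a -> 0 < b ->
  sumle (bweight nu) M a b -> 2 < a + b.
Proof.
move=> /andP[nu0 nu1] a0 b0 H; rewrite ltNge; apply/negP => ab.
have {H} : sumle (bweight nu) M (2 - b) b.
  by apply: sumle_anti H => //; [exact: bweight_ge0|lra].
have {ab} : 0 < 2 - b by lra.
have : 2 - b + b = 2 by lra.
move: (2 - b) => {a0}a {}ab a0.
have n2 : 0 < 1 - nu ^+ 2 by nra.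
pose kap := (1 - nu ^+ 2) / 2.
have kap0 : 0 < kap by rewrite /kap; lra.
apply: (@harmonic_minorant _ (kap ^+ 2)); first by rewrite exprn_gt0.
move=> j.
pose p l := pochhammer (nu + 1) l ^+ 2 / (pochhammer a l * l`!%:R) : R.
pose q m := pochhammer (1 - nu) m ^+ 2 / (pochhammer b m * m`!%:R) : R.
have f0 l : 0 < l`!%:R :> R by rewrite ltr0n fact_gt0.
have p0 l : 0 <= p l by rewrite divr_ge0 ?sqr_ge0// ltW// mulr_gt0 ?poch_gt0.
have q0 l : 0 <= q l by rewrite divr_ge0 ?sqr_ge0// ltW// mulr_gt0 ?poch_gt0.
have E : acvterm (bweight nu) a b j = (\sum_(l < j.+2) p l * q (j.+1 - l)%N) / j.+2%:R ^+ 2.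
  rewrite mulr_suml; apply: eq_bigr => l _; rewrite /bweight /kern /p /q.
  rewrite subnKC -1?ltnS//; move: (j.+1 - l)%N => m.
  have := poch_gt0 l a0; have := poch_gt0 m b0.
  move: (pochhammer a l) (pochhammer b m) (l`!%:R) (m`!%:R) (f0 l) (f0 m) (j.+2%:R : R) (ltr0Sn R j.+1).
  move=> A B f g f00 g00 k k0 B0 A0.
  by field; rewrite !gt_eqF.
(* On [a + b = 2] each [(a + i) (b + i)] is at most [(1 + i)^2]. These diagonal bounds suffice, as
   [(p l * q m) (p m * q l)] regroups into [(p l * q l) (p m * q m)]. *)
have pq l : kap ^+ 2 <= p l * q l.
  have := @poch_reflect_ge nu l; rewrite nu0 nu1 -/kap => /(_ isT) h.
  have pab : pochhammer a l * pochhammer b l <= l`!%:R ^+ 2.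
    elim: l {h} => [|l IH]; first by rewrite !poch0 mul1r expr1n.
    rewrite !pochS factS natrM mulrACA exprMn mulrC.
    apply: ler_pM => //; [nneg|nneg|].
    have -> : b = 2 - a by lra.
    by rewrite -natr1; have := sqr_ge0 (a - 1); lra.
  have k1 := poch_gt0 l a0; have k2 := poch_gt0 l b0; have k3 := f0 l.
  rewrite /p /q mulf_div -exprMn ler_pdivlMr ?mulr_gt0//.
  have -> : pochhammer a l * l`!%:R * (pochhammer b l * l`!%:R) =
    pochhammer a l * pochhammer b l * l`!%:R ^+ 2 by ring.
  apply: (@le_trans _ _ ((kap * l`!%:R ^+ 2) ^+ 2)); last first.
    rewrite ler_sqr ?nnegrE//; nneg.
  have -> : (kap * l`!%:R ^+ 2) ^+ 2 = kap ^+ 2 * (l`!%:R ^+ 2 * l`!%:R ^+ 2) by ring.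
  apply: ler_wpM2l; first exact: sqr_ge0.
  by apply: ler_wpM2r => //; exact: sqr_ge0.
have sym l m : 2 * kap ^+ 2 <= p l * q m + p m * q l.
  have h1 : kap ^+ 2 * kap ^+ 2 <= (p l * q l) * (p m * q m).
    by apply: ler_pM => //; nneg.
  have h2 : 0 <= p l * q m by rewrite mulr_ge0.
  have h3 : 0 <= p m * q l by rewrite mulr_ge0.
  rewrite -(@ler_pXn2r _ 2)//; [|by rewrite nnegrE; nneg|by rewrite nnegrE; nneg].
  have := sqr_ge0 (p l * q m - p m * q l).
  lra.
rewrite E ler_pdivlMr ?exprn_gt0//.
rewrite expr2 mulrA divfK// -(ler_pM2l (ltr0Sn R 1)).
have -> : 2 * (\sum_(l < j.+2) p l * q (j.+1 - l)%N) =
   \sum_(l < j.+2) (p l * q (j.+1 - l)%N + p (j.+1 - l)%N * q l).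
  rewrite big_split /= mulr_natl mulr2n; congr (_ + _).
  rewrite (reindex_inj rev_ord_inj) /=; apply: eq_bigr => i _.
  by rewrite subSS subKn// -ltnS.
rewrite mulrA -[j.+2 in leLHS]card_ord mulr_natr -sumr_const.
by apply: ler_sum => l _; exact: sym.
Qed.

End OpenDomain.

(** * Transfer from bweight to the exact coefficients *)

Section Weights.
Context {R : realType}.
Implicit Types (a b c M nu x : R).

(* The squared coefficients of the series of ACV^2, without the Pochhammer symbols
   of the shapes. *)
Definition weight nu x l m : R :=
  (falling (nu - 1) m * gcoef l m nu x) ^+ 2 / (l`!%:R * m`!%:R).

Lemma weight_ge0 nu x l m : 0 <= weight nu x l m.
Proof. by rewrite /weight; nneg. Qed.

Lemma gcoef_gt0 l m nu x : 0 < nu -> 0 < x < 1 -> 0 < gcoef l m nu x.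
Proof.
move=> nu0 /andP[x0 x1].
have h b c : 0 < b -> 0 < c -> 0 < hyp b c x.
  by move=> b0 c0; rewrite (lt_le_trans ltr01)// hyp_ge1//; [exact: ltW|rewrite ltW].
rewrite /gcoef !mulr_gt0 ?invr_gt0 ?poch_gt0 ?h ?ltr0n//; try lra.
by have := ler0n R l; lra.
Qed.

Lemma weight10 nu x : 0 < nu -> 0 < x < 1 -> 0 < weight nu x 1 0.
Proof.
move=> nu0 x01; rewrite /weight falling0 mul1r divr_gt0 ?exprn_gt0 ?gcoef_gt0//.
Qed.

Lemma weight01 nu x : 0 < nu -> nu != 1 -> 0 < x < 1 -> 0 < weight nu x 0 1.
Proof.
move=> nu0 nu1 x01; rewrite /weight fallingSl falling0 mulr1.
have g0 := gcoef_gt0 0 1 nu0 x01.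
apply: divr_gt0 => //.
rewrite lt_neqAle sqr_ge0 andbT eq_sym sqrf_eq0.
by apply: mulf_neq0; [rewrite subr_eq0|rewrite gt_eqF].
Qed.

(** Both hypergeometric values lie in [[1, D]], so their ratio lies in [[1 / D, D]]; the weights
    involve its square. *)
Lemma weight_bweight nu x : 0 < nu -> 0 < x < 1 -> exists2 C, 0 < C &
  forall l m, weight nu x l m <= C * bweight nu l m /\ bweight nu l m <= C * weight nu x l m.
Proof.
move=> nu0 /andP[x0 x1].
have xx : 0 <= x < 1 by rewrite ltW.
have nu0' := ltW nu0.
pose D := hyp (nu + 1) 1 x.
have D1 : 1 <= D by apply: hyp_ge1 => //; lra.
exists (D ^+ 2); first by rewrite exprn_gt0//; lra.
move=> l m.
have h1 : 1 <= hyp (l%:R + nu + 1) (l + m).+2%:R x.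
  by apply: hyp_ge1 => //; have := ler0n R l; lra.
have h2 : hyp (l%:R + nu + 1) (l + m).+2%:R x <= D by exact: hyp_le_uniform.
have h3 : 1 <= hyp (nu + 1) 2 x by apply: hyp_ge1 => //; lra.
have h4 : hyp (nu + 1) 2 x <= D.
  by have := @hyp_le_uniform _ nu x 0 0 nu0' xx; rewrite !add0r.
have E : weight nu x l m = bweight nu l m *
    (hyp (l%:R + nu + 1) (l + m).+2%:R x / hyp (nu + 1) 2 x) ^+ 2.
  rewrite /weight /bweight /gcoef -sqr_falling.
  have : 0 < l`!%:R :> R by rewrite ltr0n fact_gt0.
  have : 0 < m`!%:R :> R by rewrite ltr0n fact_gt0.
  move: (l`!%:R) (m`!%:R) (_.+1%:R : R) (ltr0Sn R (l + m)) => f g k k0 g0 f0.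
  by field; rewrite !gt_eqF//; lra.
rewrite E.
move: (bweight nu l m) (bweight_ge0 nu l m) (hyp _ _ _) h1 h2 (hyp _ _ _) h3 h4.
move=> B B0 h h1 h2 g g1 gD {E}.
have r1 : h / g <= D.
  rewrite ler_pdivrMr; last lra.
  by apply: (le_trans h2); rewrite ler_peMr//; lra.
have r2 : D^-1 <= h / g.
  rewrite ler_pdivlMr; last lra.
  apply: le_trans h1; rewrite mulrC ler_pdivrMr ?mul1r//; lra.
have r0 : 0 < D^-1 by rewrite invr_gt0; lra.
split.
  by rewrite mulrC ler_wpM2r// ler_sqr ?nnegrE//; lra.
rewrite mulrCA ler_peMr// -exprMn -(expr1n R 2) ler_sqr ?nnegrE//; last by rewrite mulr_ge0//; lra.
have : D * D^-1 = 1 by rewrite divff// gt_eqF//; lra.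
move=> <-; rewrite ler_wpM2l//; lra.
Qed.

Lemma sumle_weight (w w' : nat -> nat -> R) C M a b :
  (forall l m, w l m <= C * w' l m) -> 0 < C -> 0 < a -> 0 < b ->
  sumle w' M a b -> sumle w (C * M) a b.
Proof.
move=> ww C0 a0 b0 H n; apply: (@le_trans _ _ (C * series (acvterm w' a b) n)).
  rewrite /series /= mulr_sumr; apply: ler_sum => j _; rewrite mulr_sumr.
  by apply: ler_sum => l _; rewrite mulrA ler_wpM2r// ltW// kern_gt0.
by rewrite ler_pM2l.
Qed.

Lemma weight_domain nu x a b : 0 < nu -> nu != 1 -> 0 < x < 1 -> 0 < a -> 0 < b ->
  (exists M, sumle (weight nu x) M a b) <-> (2 * nu < a /\ 2 < a + b).
Proof.
move=> nu0 nu1 x01 a0 b0; have [C C0 HC] := weight_bweight nu0 x01.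
split=> [[M H]|[h1 h2]].
  have {}H : sumle (bweight nu) (C * M) a b.
    by apply: (sumle_weight _ C0 a0 b0 H) => l m; case: (HC l m).
  have a2 := sumle_bweight_left nu0 a0 b0 H.
  (* For [nu > 1], [2 * nu < a] already gives [2 < a + b]; the divergence on [a + b = 2] is called
     upon for [nu < 1]. *)
  split => //; have [nu1'|nu1'] := leP 1 nu.
    by rewrite le_eqVlt eq_sym (negbTE nu1) /= in nu1'; lra.
  by apply: (sumle_bweight_total _ a0 b0 H); rewrite nu0.
have [M H] := bweight_finite nu0 a0 b0 h1 h2.
by exists (C * M); apply: (sumle_weight _ C0 a0 b0 H) => l m; case: (HC l m).
Qed.

Lemma weight_open nu x M a b : 0 < nu -> nu != 1 -> 0 < x < 1 -> 0 < a -> 0 < b ->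
  sumle (weight nu x) M a b ->
  exists r M', [/\ 0 < r, r < a, r < b & sumle (weight nu x) M' (a - r) (b - r)].
Proof.
move=> nu0 nu1 x01 a0 b0 H.
have [h1 h2] : 2 * nu < a /\ 2 < a + b by apply/(weight_domain nu0 nu1 x01 a0 b0); exists M.
pose s := Num.min (a - 2 * nu) (Num.min b ((a + b - 2) / 2)).
have s0 : 0 < s by rewrite !lt_min; apply/and3P; split; lra.
have s1 : s <= a - 2 * nu by rewrite ge_min lexx.
have s2 : s <= b by rewrite !ge_min lexx orbT.
have s3 : s <= (a + b - 2) / 2 by rewrite !ge_min lexx !orbT.
pose r := s / 2.
have [r0 ra rb rab] : [/\ 0 < r, r < a - 2 * nu, r < b & r < (a + b - 2) / 2].
  by rewrite /r; split; lra.
have ra' : 0 < a - r by lra. have rb' : 0 < b - r by lra.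
have [M' H'] : exists M, sumle (weight nu x) M (a - r) (b - r).
  by apply/(weight_domain nu0 nu1 x01) => //; split; lra.
by exists r, M'; split => //; lra.
Qed.

Lemma weight_min_exists nu x v : 0 < nu -> nu != 1 -> 0 < x < 1 -> 0 < v ->
  exists a b, total_min (weight nu x) v a b.
Proof.
move=> nu0 nu1 x01 v0.
have a0 : 0 < 2 * nu + 2 by lra.
have [M H] : exists M, sumle (weight nu x) M (2 * nu + 2) 1.
  by apply/(weight_domain nu0 nu1 x01) => //; split; lra.
exact: (total_min_exists (weight_ge0 nu x) (weight10 nu0 x01) (weight01 nu0 nu1 x01)
  v0 a0 ltr01 H).
Qed.

End Weights.

(** * ACV^2 as an extended real number *)

Section ExtendedSum.
Context {R : realType}.
Implicit Types (a b c M v : R) (g : nat -> nat -> R).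

Definition eterm g a b k : \bar R := (\sum_(0 <= l < k.+1) (g k l ^+ 2)%:E /
  (pochhammer a l * pochhammer b (k - l) * l`!%:R * (k - l)`!%:R)%:E)%E.

Definition esumterm g a b : \bar R := (\sum_(1 <= k <oo) eterm g a b k)%E.

Definition norm_sq g l m : R := g (l + m)%N l ^+ 2 / (l`!%:R * m`!%:R).

Lemma norm_sq_ge0 g l m : 0 <= norm_sq g l m.
Proof. by rewrite /norm_sq; nneg. Qed.

Lemma eterm_ge0 g a b k : 0 <= a -> 0 <= b -> (0 <= eterm g a b k)%E.
Proof.
move=> a0 b0; apply: sume_ge0 => l _.
by rewrite mule_ge0 ?lee_fin ?inve_ge0 ?lee_fin//; nneg.
Qed.

Lemma esumterm_ge0 g a b : 0 <= a -> 0 <= b -> (0 <= esumterm g a b)%E.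
Proof. by move=> a0 b0; apply: nneseries_ge0 => k _ _; exact: eterm_ge0. Qed.

Lemma etermE g a b j : 0 < a -> 0 < b ->
  eterm g a b j.+1 = (acvterm (norm_sq g) a b j)%:E.
Proof.
move=> a0 b0; rewrite /eterm /acvterm -sumEFin big_mkord; apply: eq_bigr => l _.
rewrite /norm_sq /kern subnKC -1?ltnS//.
have pa := poch_gt0 l a0; have pb := poch_gt0 (j.+1 - l) b0.
have f0 i : 0 < i`!%:R :> R by rewrite ltr0n fact_gt0.
move: (f0 l) (f0 (j.+1 - l)%N); move: (l`!%:R : R) (_`!%:R : R) => f h {}f0 h0.
rewrite inver gt_eqF ?mulr_gt0// -EFinM; congr (_%:E).
by field; rewrite !gt_eqF.
Qed.

Lemma esumtermE g a b : 0 < a -> 0 < b ->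
  esumterm g a b = (\sum_(0 <= j <oo) (acvterm (norm_sq g) a b j)%:E)%E.
Proof.
move=> a0 b0; rewrite /esumterm -(@nneseries_addn _ _ 1); last first.
  by move=> k; apply: eterm_ge0; exact: ltW.
by apply: eq_eseriesr => j _; rewrite addn1 etermE.
Qed.

Lemma esumterm_le g a b v : 0 < a -> 0 < b ->
  (esumterm g a b <= v%:E)%E <-> sumle (norm_sq g) v a b.
Proof.
move=> a0 b0; rewrite esumtermE//.
have t0 j : (0 <= (acvterm (norm_sq g) a b j)%:E)%E.
  by rewrite lee_fin acvterm_ge0//; exact: norm_sq_ge0.
split=> [H n|H].
  rewrite -lee_fin /series /= -sumEFin.
  by apply: le_trans H; apply: nneseries_lim_ge.
apply: lime_le; first exact: is_cvg_nneseries.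
by apply: nearW => n; rewrite sumEFin lee_fin; exact: H.
Qed.

(** Being the least bound of the partial sums characterises the value, so later arguments can stay
    with [sumle]. *)
Lemma esumterm_eq g a b v : 0 < a -> 0 < b ->
  esumterm g a b = v%:E <->
  sumle (norm_sq g) v a b /\ (forall c, 0 < c -> ~ sumle (norm_sq g) (v - c) a b).
Proof.
move=> a0 b0; split=> [H|[H1 H2]].
  split; first by apply/(esumterm_le _ _ a0 b0); rewrite H.
  by move=> c c0 /(esumterm_le _ _ a0 b0); rewrite H lee_fin; lra.
move/(esumterm_le _ _ a0 b0) : (H1) => H.
have := esumterm_ge0 g (ltW a0) (ltW b0).
have : forall c, 0 < c -> ~ (esumterm g a b <= (v - c)%:E)%E.
  by move=> c c0 /(esumterm_le _ _ a0 b0); exact: H2.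
move: (esumterm g a b) H => [s| |]//; rewrite lee_fin => sv Hc _.
congr (_%:E); apply/eqP; rewrite eq_le sv/= leNgt; apply/negP => sv'.
by apply: (Hc (v - s)); rewrite ?lee_fin; lra.
Qed.

Lemma esumterm_fin g a b M : 0 < a -> 0 < b -> sumle (norm_sq g) M a b ->
  esumterm g a b = (limn (series (acvterm (norm_sq g) a b)))%:E.
Proof.
move=> a0 b0 H.
have t0 j : 0 <= acvterm (norm_sq g) a b j.
  by rewrite acvterm_ge0//; exact: norm_sq_ge0.
have cv : cvgn (series (acvterm (norm_sq g) a b)) by exact: (series_bounded_cvg t0 H).
apply/esumterm_eq => //; split=> [n|c c0 Hc]; first exact: series_partial_le.
by have := lim_series_bound cv Hc; lra.
Qed.

(** The terms of degree 1 are [g 1 0 ^+ 2 / b] and [g 1 1 ^+ 2 / a], so a zero shape costs an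
    infinite value. This keeps the optimum off the axes. *)
Lemma esumterm_pinfty g a b : 0 <= a -> 0 <= b -> g 1 0 != 0 -> g 1 1 != 0 ->
  a = 0 \/ b = 0 -> esumterm g a b = +oo%E.
Proof.
move=> a0 b0 g0 g1 ab.
have H : eterm g a b 1 = +oo%E.
  rewrite /eterm /index_iota /= !big_cons big_nil adde0 subn0 subnn.
  rewrite !pochS !poch0 !mul1r !mulr1 !addr0.
  have q0 (y : R) : y != 0 -> ((y ^+ 2)%:E * +oo)%E = +oo%E :> \bar R.
    by move=> y0; rewrite gt0_muley// lte_fin lt_neqAle sqr_ge0 andbT eq_sym sqrf_eq0.
  have q1 (y d : R) : 0 <= d -> (0 <= (y ^+ 2)%:E / d%:E)%E.
    by move=> d0; rewrite mule_ge0 ?lee_fin ?sqr_ge0// inve_ge0 lee_fin.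
  case: ab => ->; rewrite inve0 q0// ?addey ?addye//.
    by have := q1 (g 1 0) b b0; case: (_ / _)%E.
  by have := q1 (g 1 1) a a0; case: (_ / _)%E.
apply/eqP; rewrite eq_le leey /= /esumterm.
apply: (@le_trans _ _ (\sum_(1 <= k < 2) eterm g a b k)%E); first by rewrite big_nat1 H.
by apply: nneseries_lim_ge => k _ _; exact: eterm_ge0.
Qed.

End ExtendedSum.

(** * Equivalence of the two minimisation problems, and stationarity *)

Section Optimum.
Context {R : realType}.
Implicit Types (a b c M v h : R).

Lemma cvg_harm (T : Type) (F : set_system T) {FF : Filter F} (f : T -> R) (l : R) n :
  0 < l -> f t @[t --> F] --> l -> harm (f t) n @[t --> F] --> harm l n.
Proof.
move=> l0 fl; apply: cvg_sumr => i _; apply: cvgV; first by rewrite gt_eqF// ltr_pwDl.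
by apply: cvgD => //; exact: cvg_cst.
Qed.

Variable g : nat -> nat -> R.
Let w := norm_sq g.
Let w_ge0 : forall l m, 0 <= w l m. Proof. exact: norm_sq_ge0. Qed.
Hypothesis g10 : g 1 0 != 0.
Hypothesis g11 : g 1 1 != 0.
Hypothesis open_domain : forall M a b, 0 < a -> 0 < b -> sumle w M a b ->
  exists r M', [/\ 0 < r, r < a, r < b & sumle w M' (a - r) (b - r)].

Let w10 : 0 < w 1 0.
Proof.
rewrite /w /norm_sq addn0; apply: divr_gt0 => //.
by rewrite lt_neqAle sqr_ge0 andbT eq_sym sqrf_eq0.
Qed.

Let w01 : 0 < w 0 1.
Proof.
rewrite /w /norm_sq add0n; apply: divr_gt0 => //.
by rewrite lt_neqAle sqr_ge0 andbT eq_sym sqrf_eq0.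
Qed.

Definition minimises v a b := [/\ 0 <= a, 0 <= b, esumterm g a b = v%:E &
  forall a' b', 0 <= a' -> 0 <= b' -> a' + b' = a + b ->
    (esumterm g a b <= esumterm g a' b')%E].

Lemma esumterm_pos a b : 0 <= a -> 0 <= b -> esumterm g a b != +oo%E -> 0 < a /\ 0 < b.
Proof.
move=> a0 b0 H; split; rewrite lt_neqAle ?a0 ?b0 andbT eq_sym.
  by apply: contra_neq H => a00; rewrite esumterm_pinfty//; left.
by apply: contra_neq H => b00; rewrite esumterm_pinfty//; right.
Qed.

Lemma total_min_value v a b : total_min w v a b -> esumterm g a b = v%:E.
Proof.
move=> m; have [a0 b0 H _] := m; apply/esumterm_eq => //; split => // c c0.
exact: (total_min_sharp w_ge0 open_domain m).
Qed.

(** If a pair reached the level with a smaller total, adding the surplus to its first shape would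
    push the value strictly below [v] at the original total. The converse is [total_min_optimal]. *)
Lemma minimises_total_min v a b : minimises v a b <-> total_min w v a b.
Proof.
split=> [[a0 b0 Fv min]|m].
  have [{}a0 {}b0] : 0 < a /\ 0 < b by apply: esumterm_pos => //; rewrite Fv.
  have [Hv _] := (esumterm_eq g v a0 b0).1 Fv.
  split=> // a' b' a'0 b'0 H'; rewrite leNgt; apply/negP => tot.
  have h0 : 0 < a + b - (a' + b') by lra.
  have [c c0 Hc] := sumle_strict_anti w_ge0 w10 a'0 b'0 h0 H'.
  have a1 : 0 < a' + (a + b - (a' + b')) by lra.
  have := min _ _ (ltW a1) (ltW b'0).
  rewrite Fv (_ : a' + (a + b - (a' + b')) + b' = a + b); last by ring.
  move=> /(_ erefl)/le_trans/(_ ((esumterm_le g _ a1 b'0).2 Hc)).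
  by rewrite lee_fin; lra.
have [a0 b0 H _] := m; have Fv := total_min_value m.
split; rewrite ?ltW// => a' b' a'0 b'0 tot.
rewrite Fv leNgt; apply/negP => H'.
have [{}a'0 {}b'0] : 0 < a' /\ 0 < b'.
  by apply: esumterm_pos => //; apply: contraTneq H' => ->; rewrite -leNgt leey.
have := esumterm_ge0 g (ltW a'0) (ltW b'0).
case E : (esumterm g a' b') H' => [s| |]//; rewrite lte_fin => sv _.
have vs : 0 < v - s by lra.
apply: (total_min_optimal w_ge0 open_domain m a'0 b'0 tot vs).
by apply/esumterm_le => //; rewrite E lee_fin; lra.
Qed.

Section SecondDifference.
Variables (a b : R).

Let phi h j := acvterm w (a - h) (b + h) j.
Let slope h j := \sum_(l < j.+2) w l (j.+1 - l)%N * (kern l (j.+1 - l)%N (a - h) (b + h) *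
  (harm (a - h) l - harm (b + h) (j.+1 - l)%N)).

Lemma acvterm_tangent h j : 0 < a -> 0 < b -> h < a -> - h < b ->
  phi h j - phi 0 j <= h * slope h j.
Proof.
move=> a0 b0 ha hb; rewrite /phi /slope /acvterm mulr_sumr subr0 addr0 -sumrB.
apply: ler_sum => l _; rewrite -mulrBr mulrCA ler_wpM2l//.
have ha' : 0 < a - h by lra. have hb' : 0 < b + h by lra.
have := kern_tangent l (j.+1 - l) ha' hb' a0 b0.
move: (kern _ _ _ _) (kern _ _ _ _) (harm _ _) (harm _ _) => K K' s s'.
lra.
Qed.

Lemma cvg_slope j : 0 < a -> 0 < b ->
  slope h j @[h --> 0^'] --> slope 0 j /\ slope (- h) j @[h --> 0^'] --> slope 0 j.
Proof.
move=> a0 b0.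
have key (s : R -> R) : s h @[h --> 0^'] --> 0 -> slope (s h) j @[h --> 0^'] --> slope 0 j.
  move=> s0.
  have ca : a - s h @[h --> 0^'] --> a - 0 by apply: cvgB => //; exact: cvg_cst.
  have cb : b + s h @[h --> 0^'] --> b + 0 by apply: cvgD => //; exact: cvg_cst.
  have a00 : 0 < a - 0 by rewrite subr0.
  have b00 : 0 < b + 0 by rewrite addr0.
  apply: cvg_sumr => l _; apply: cvgM; first exact: cvg_cst.
  by apply: cvgM; [exact: cvg_kern|apply: cvgB; exact: cvg_harm].
have id0 : (h : R) @[h --> 0^'] --> (0 : R) by apply: cvg_within; exact: cvg_id.
split; first exact: (key id).
by apply: (key (fun h => - h)); rewrite -[X in _ --> X]oppr0; exact: cvgN.
Qed.

Let diff2 h j := (phi h j + phi (- h) j - 2 * phi 0 j) / `|h|.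

Lemma diff2_ge0 h j : h < a -> - h < a -> h < b -> - h < b -> 0 <= diff2 h j.
Proof.
move=> h1 h2 h3 h4; rewrite divr_ge0//.
have := @acvterm_convex _ w w_ge0 (a - h) (b + h) (a + h) (b - h) 2^-1 j.
rewrite (_ : (1 - 2^-1) * (a - h) + 2^-1 * (a + h) = a); last lra.
rewrite (_ : (1 - 2^-1) * (b + h) + 2^-1 * (b - h) = b); last lra.
move=> H; have {}H := H ltac:(lra) ltac:(lra) ltac:(lra) ltac:(lra) ltac:(lra).
by rewrite /phi opprK subr0 addr0; lra.
Qed.

(** For [h > 0], the points at distance [h] are combinations, with weight [h / r], of the centre and
    the points at distance [r]. The quotient is even in [h], which gives the other sign. *)
Lemma diff2_mono h r j : h != 0 -> `|h| <= r -> r < a -> r < b ->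
  diff2 h j <= diff2 r j.
Proof.
move=> h0 hr ra rb.
have n0 : 0 < `|h| by rewrite normr_gt0.
have r0 : 0 < r by exact: lt_le_trans hr.
rewrite /diff2 (gtr0_norm r0).
wlog hp : h h0 hr n0 / 0 < h.
  move=> W; have [hp|hn] := ltP 0 h; first exact: W.
  have nh0 : - h != 0 by rewrite oppr_eq0.
  have nhp : 0 < - h by rewrite oppr_gt0 lt_neqAle h0.
  have := W (- h) nh0; rewrite normrN opprK => /(_ hr n0 nhp).
  by rewrite (addrC (phi h j)).
rewrite (gtr0_norm hp) in hr n0 *.
have a0 : 0 < a by lra. have b0 : 0 < b by lra.
have t01 : 0 <= h / r <= 1.
  by apply/andP; split; [nneg|rewrite ler_pdivrMr// mul1r].
have hrr : h / r * r = h by rewrite divfK// gt_eqF.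
have H1 := @acvterm_convex _ w w_ge0 a b (a - r) (b + r) (h / r) j a0 b0
  ltac:(lra) ltac:(lra) t01.
have H2 := @acvterm_convex _ w w_ge0 a b (a + r) (b - r) (h / r) j a0 b0
  ltac:(lra) ltac:(lra) t01.
have e1 : (1 - h / r) * a + h / r * (a - r) = a - h by field; rewrite gt_eqF.
have e2 : (1 - h / r) * b + h / r * (b + r) = b + h by field; rewrite gt_eqF.
have e3 : (1 - h / r) * a + h / r * (a + r) = a + h by field; rewrite gt_eqF.
have e4 : (1 - h / r) * b + h / r * (b - r) = b - h by field; rewrite gt_eqF.
rewrite e1 e2 in H1; rewrite e3 e4 in H2.
rewrite /phi !opprK subr0 addr0 ler_pdivrMr// mulrAC -mulrA mulrC.
rewrite [leRHS](_ : _ = h / r * (acvterm w (a - r) (b + r) j + acvterm w (a + r) (b - r) j - 2 * acvterm w a b j)); last by ring.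
lra.
Qed.

(** Tangents at the displaced points, not at the centre, bound the second difference above by
    [h * (slope h - slope (- h))]; continuity of [slope] finishes. *)
Lemma cvg_diff2 j : 0 < a -> 0 < b -> diff2 h j @[h --> 0^'] --> 0.
Proof.
move=> a0 b0; have [s1 s2] := cvg_slope j a0 b0.
have s12 : `|slope h j - slope (- h) j| @[h --> 0^'] --> 0.
  have : `|slope h j - slope (- h) j| @[h --> 0^'] --> `|slope 0 j - slope 0 j|.
    by apply: cvg_norm; exact: cvgB.
  by rewrite subrr normr0.
have ab0 : 0 < Num.min a b by rewrite lt_min a0.
apply: (squeeze_cvgr _ (cvg_cst 0) s12).
near=> h.
have h0 : h != 0 by near: h; exact: nbhs_dnbhs_neq.
have : `|h| < Num.min a b by near: h; apply: dnbhs0_lt.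
rewrite lt_min !ltr_norml => /andP[/andP[h1 h2] /andP[h3 h4]].
rewrite diff2_ge0//=; [|lra|lra].
rewrite ler_pdivrMr ?normr_gt0// -normrM.
apply: le_trans (ler_norm _).
have t1 := acvterm_tangent j a0 b0 h2 ltac:(lra).
have t2 := @acvterm_tangent (- h) j a0 b0 ltac:(lra) ltac:(lra).
lra.
Unshelve. all: by end_near. Qed.

End SecondDifference.

(* By convexity the second difference quotients are monotone in |h|, so they tend to 0 by
   dominated convergence; at a minimum they dominate the first difference quotients. *)
Lemma total_min_stationary v a b : total_min w v a b ->
  (\forall x \near b, esumterm g (a + b - x) x \is a fin_num) /\
  is_derive b (1 : R) (fine \o (fun x => esumterm g (a + b - x) x)) (0 : R).
Proof.
move=> m; have [a0 b0 H _] := m.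
have [r [M [r0 ra rb HM]]] := open_domain a0 b0 H.
have ar : 0 < a - r by lra. have br : 0 < b - r by lra.
have fin h : `|h| <= r -> sumle w M (a - h) (b + h).
  by rewrite ler_norml => /andP[h1 h2]; apply: sumle_anti HM => //; lra.
have pos h : `|h| <= r -> 0 < a - h /\ 0 < b + h.
  by rewrite ler_norml => /andP[h1 h2]; split; lra.
split.
  have nb : \forall x \near b, `|b - x| <= r.
    have idb : (x : R) @[x --> b] --> b by exact: cvg_id.
    by move/cvgrPdist_le : idb => /(_ _ r0).
  near=> x; have hx : `|x - b| <= r by rewrite distrC; near: x.
  have := fin _ hx; have [p1 p2] := pos _ hx.
  rewrite (_ : a - (x - b) = a + b - x); last ring.
  rewrite (_ : b + (x - b) = x) in p2 *; last ring.
  rewrite (_ : a - (x - b) = a + b - x) in p1; last ring.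
  by move=> K; rewrite (esumterm_fin p1 p2 K).
pose G h := limn (series (acvterm w (a - h) (b + h))).
have GE h : `|h| <= r -> esumterm g (a - h) (b + h) = (G h)%:E.
  by move=> hr; have [p1 p2] := pos _ hr; rewrite (esumterm_fin p1 p2 (fin _ hr)).
have cG h : `|h| <= r -> cvgn (series (acvterm w (a - h) (b + h))).
  move=> hr; have [p1 p2] := pos _ hr.
  by apply: (series_bounded_cvg _ (fin _ hr)) => n; exact: acvterm_ge0.
have G0 : G 0 = v.
  have := GE 0; rewrite normr0 subr0 addr0 (total_min_value m) => /(_ (ltW r0)).
  by case.
have Gv h : `|h| <= r -> v <= G h.
  move=> hr; have [p1 p2] := pos _ hr; rewrite leNgt; apply/negP => vG.
  have vG' : 0 < v - G h by lra.
  apply: (total_min_optimal w_ge0 open_domain m p1 p2 _ vG'); first by ring.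
  rewrite (_ : v - (v - G h) = G h); last ring.
  by move=> n; apply: series_partial_le; [move=> k; exact: acvterm_ge0|exact: cG].
(* Written with [a - - h] and [a - 0] so as to be convertible to [diff2]. *)
pose d2 h j := (acvterm w (a - h) (b + h) j + acvterm w (a - - h) (b + - h) j -
  2 * acvterm w (a - 0) (b + 0) j) / `|h|.
have cd2 h : `|h| <= r -> series (d2 h) n @[n --> \oo] --> (G h + G (- h) - 2 * G 0) / `|h|.
  move=> hr; have -> : series (d2 h) = (fun n => (series (acvterm w (a - h) (b + h)) n +
     series (acvterm w (a - - h) (b + - h)) n - 2 * series (acvterm w (a - 0) (b + 0)) n) / `|h|).
    by apply/funext => n; rewrite /series /= /d2 -mulr_suml sumrB big_split /= mulr_sumr.
  apply: cvgM; last exact: cvg_cst.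
  apply: cvgB; first by apply: cvgD; apply: cG; rewrite ?normrN.
  by apply: cvgM; [exact: cvg_cst|apply: cG; rewrite normr0 ltW].
have cvr : cvgn (series (d2 r)) by apply/cvg_ex; eexists; apply: cd2; rewrite gtr0_norm.
have lim0 : limn (series (d2 h)) @[h --> 0^'] --> limn (series (fun=> 0 : R)).
  apply: (@cvg_series_dominated _ _ _ _ (fun j h => d2 h j) _ (d2 r)) => //.
    by move=> j; exact: cvg_diff2.
  near=> h => j.
  have h0 : h != 0 by near: h; exact: nbhs_dnbhs_neq.
  have hr : `|h| < r by near: h; exact: dnbhs0_lt.
  have := hr; rewrite ltr_norml => /andP[h1 h2].
  rewrite ger0_norm; last by apply: diff2_ge0; lra.
  by apply: diff2_mono => //; exact: ltW.
have lim00 : limn (series (fun=> 0 : R)) = 0.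
  by apply: cvg_lim => //; apply: cvg_near_cst; apply: nearW => n; rewrite /series /= big1.
rewrite lim00 in lim0.
have key : (fun h => h^-1 *: (((fine \o (fun x => esumterm g (a + b - x) x)) \o shift b) (h *: 1)
    - (fine \o (fun x => esumterm g (a + b - x) x)) b)) @ 0^' --> (0 : R).
  apply/cvgr0Pnorm_le => e e0; have /cvgr0Pnorm_le/(_ e e0) L := lim0.
  near=> h.
  have h0 : h != 0 by near: h; exact: nbhs_dnbhs_neq.
  have hr : `|h| <= r by apply: ltW; near: h; exact: dnbhs0_lt.
  have Lh : `|limn (series (d2 h))| <= e by near: h.
  apply: le_trans Lh.
  rewrite (cvg_lim _ (cd2 _ hr))//=.
  rewrite /= [h *: 1]mulr1 (_ : a + b - (h + b) = a - h); last ring.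
  rewrite [h + b]addrC GE// (_ : a + b - b = a); last ring.
  rewrite (total_min_value m) /= -G0 /GRing.scale /= normrM normfV mulrC.
  have h1 := Gv _ hr; have h2 : v <= G (- h) by apply: Gv; rewrite normrN.
  rewrite [leRHS]ger0_norm; last by rewrite G0 divr_ge0//; lra.
  rewrite ler_pM2r ?invr_gt0 ?normr_gt0// ger0_norm ?G0; lra.
by apply: DeriveDef; [exact: cvgP key|exact: cvg_lim key].
Unshelve. all: by end_near. Qed.

End Optimum.

(** * The case zeta = 0 or nu = 1 *)

Section DegenerateCase.
Context {R : realType}.
Implicit Types (a b c M v : R).

Definition dterm a : R^nat := fun j => j.+1`!%:R / pochhammer a j.+1.

Lemma series_dterm a n : 2 < a ->
  series (dterm a) n = (a - 2)^-1 - n.+1`!%:R / ((a - 2) * pochhammer a n).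
Proof.
move=> a2; elim: n => [|n IH].
  by rewrite /series /= big_nil poch0 mulr1 div1r subrr.
rewrite seriesSr IH /dterm pochS (factS n.+1) natrM -(natr1 n.+1) -(natr1 n).
have a0 : 0 < a by lra.
have := poch_gt0 n a0; move: (pochhammer a n) (_`!%:R) (n%:R : R) (ler0n R n) => P f v v0 P0.
by field; rewrite !gt_eqF//; lra.
Qed.

Lemma series_dterm_le a n : 2 < a -> series (dterm a) n <= (a - 2)^-1.
Proof.
move=> a2; rewrite series_dterm// lerBlDr lerDl.
have a0 : 0 < a by lra. have a20 : 0 <= a - 2 by lra.
by nneg.
Qed.

(** The limit of the remainder is not computed: a remainder of at least [c] would make the terms
    dominate a multiple of the harmonic series, against boundedness. *)
Lemma series_dterm_sharp a c : 2 < a -> 0 < c ->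
  ~ (forall n, series (dterm a) n <= (a - 2)^-1 - c).
Proof.
move=> a2 c0 H.
have c1 : 0 < c * (a - 2) / a by rewrite divr_gt0 ?mulr_gt0//; lra.
apply: (harmonic_minorant c1 _ H) => j.
have := H j; rewrite series_dterm// /dterm pochS.
have a0 : 0 < a by lra.
have := poch_gt0 j a0.
rewrite -(natr1 j.+1) -(natr1 j).
move: (pochhammer a j) (_`!%:R) (j%:R : R) (ler0n R j) => P f v v0 P0 h.
have a20 : 0 < a - 2 by lra.
have {}h : c <= f / ((a - 2) * P) by lra.
rewrite ler_pdivlMr ?mulr_gt0// in h.
have av : 0 < a + v by lra.
rewrite ler_pdivlMr ?mulr_gt0//; apply: le_trans h.
have -> : c * (a - 2) / a / (v + 1 + 1) * (P * (a + v)) =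
    c * ((a - 2) * P) * ((a + v) / (a * (v + 2))).
  by field; rewrite !gt_eqF//; lra.
rewrite ler_piMr//; first by nneg.
rewrite ler_pdivrMr ?mulr_gt0//; last lra.
by rewrite mul1r; nra.
Qed.

Variable g : nat -> nat -> R.
Hypothesis g_lt : forall k l, (l < k)%N -> g k l = 0.
Hypothesis g_diag : forall k, g k k = k`!%:R.

Lemma eterm_degenerate a b k :
  eterm g a b k = ((k`!%:R ^+ 2)%:E / (pochhammer a k * k`!%:R)%:E)%E.
Proof.
rewrite /eterm big_nat_recr//= g_diag subnn poch0 !mulr1.
rewrite big_nat big1 ?add0e// => l lk.
by rewrite g_lt// expr0n mul0e.
Qed.

Lemma esumterm_degenerate_gt2 a b : 2 < a -> 0 <= b ->
  esumterm g a b = ((a - 2)^-1)%:E.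
Proof.
move=> a2 b0; have a0 : 0 < a by lra.
have f0 k : 0 < k`!%:R :> R by rewrite ltr0n fact_gt0.
have d0 j : 0 <= dterm a j by rewrite /dterm; nneg.
have E : esumterm g a b = (\sum_(0 <= j <oo) (dterm a j)%:E)%E.
  rewrite /esumterm -(@nneseries_addn _ _ 1); last first.
    by move=> k; apply: eterm_ge0 => //; exact: ltW.
  apply: eq_eseriesr => j _; rewrite addn1 eterm_degenerate inver.
  have := poch_gt0 j.+1 a0 => pa; rewrite gt_eqF ?mulr_gt0// -EFinM; congr (_%:E).
  by rewrite /dterm; have := f0 j.+1 => f00; field; rewrite !gt_eqF.
have cv : cvgn (series (dterm a)).
  by apply: (@series_bounded_cvg _ _ ((a - 2)^-1)) => // n; exact: series_dterm_le.
have -> : esumterm g a b = (limn (series (dterm a)))%:E.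
  rewrite E -EFin_lim//; congr (limn _); apply/funext => n.
  by rewrite sumEFin.
congr (_%:E); apply/eqP; rewrite eq_le lim_series_bound//=; last first.
  by move=> n; exact: series_dterm_le.
rewrite leNgt; apply/negP => H.
have c0 : 0 < (a - 2)^-1 - limn (series (dterm a)) by lra.
apply: (series_dterm_sharp a2 c0) => n.
by rewrite opprB addrC subrK; exact: series_partial_le.
Qed.

Lemma esumterm_degenerate_le2 a b : 0 <= a <= 2 -> 0 <= b -> esumterm g a b = +oo%E.
Proof.
move=> /andP[a0 a2] b0.
have t0 k : (0 <= eterm g a b k)%E by exact: eterm_ge0.
have := esumterm_ge0 g a0 b0; case E : (esumterm g a b) => [s| |]// _.
exfalso; apply: (@harmonic_minorant R (fun j => 1 / j.+2%:R) 1 s) => // n.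
rewrite -lee_fin -E /series /= -sumEFin.
apply: (@le_trans _ _ (\sum_(1 <= k < n.+1) eterm g a b k)%E); last first.
  by apply: nneseries_lim_ge.
rewrite big_add1 /=; apply: lee_sum => j _; rewrite eterm_degenerate inver.
have f0 : 0 < j.+1`!%:R :> R by rewrite ltr0n fact_gt0.
(* This occurs at [a = 0]: the coefficient is nonzero, so the term is infinite. *)
have [p0|p0] := eqVneq (pochhammer a j.+1) 0.
  by rewrite p0 mul0r eqxx gt0_muley ?leey// lte_fin exprn_gt0.
have pp : 0 < pochhammer a j.+1 by rewrite lt_neqAle eq_sym p0 poch_ge0.
rewrite gt_eqF ?mulr_gt0// -EFinM lee_fin.
have : pochhammer a j.+1 <= j.+2`!%:R.
  apply: (le_trans (ler_poch _ a0 a2)).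
  by have := pochSl (1 : R) j.+1; rewrite poch_one mul1r -[1 + 1]/(2%:R : R) => <-.
rewrite factS natrM => h.
have -> : j.+1`!%:R ^+ 2 / (pochhammer a j.+1 * j.+1`!%:R) = j.+1`!%:R / pochhammer a j.+1.
  by field; rewrite !gt_eqF.
by rewrite ler_pdivrMr// mulrAC ler_pdivlMr// mul1r mulrC.
Qed.

(** The value [(a - 2)^-1] ignores [b] and decreases in [a], so comparison with [(a + b, 0)] forces
    [b = 0]. *)
Lemma minimises_degenerate v a b : 0 < v ->
  minimises g v a b <-> (a, b) = (v^-1 + 2, 0).
Proof.
move=> v0; split=> [[a0 b0 Fv min]|[-> ->]].
  have [a2|a2] := leP a 2.
    by move: Fv; rewrite esumterm_degenerate_le2// a0.
  move: (Fv); rewrite esumterm_degenerate_gt2// => -[av].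
  have := min (a + b) 0 (addr_ge0 a0 b0) (lexx 0); rewrite addr0 => /(_ erefl).
  rewrite !esumterm_degenerate_gt2//; last lra.
  rewrite lee_fin lef_pV2 ?posrE; [|lra|lra] => h.
  by congr (_, _); rewrite -?av ?invrK; lra.
have v1 : 0 < v^-1 by rewrite invr_gt0.
have F : esumterm g (v^-1 + 2) 0 = v%:E.
  by rewrite esumterm_degenerate_gt2 ?addrK ?invrK//; lra.
split=> //; first lra.
move=> a' b' a'0 b'0; rewrite addr0 F => tot.
have [a2|a2] := leP a' 2; first by rewrite esumterm_degenerate_le2 ?leey// a'0.
rewrite esumterm_degenerate_gt2// lee_fin -[leLHS]invrK lef_pV2 ?posrE; lra.
Qed.

End DegenerateCase.

(** * The parameter nu_dagger, its limits, and the bias condition *)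

Section Dagger.
Context {R : realType}.
Variables (acv0 arb0 b : R).
Hypotheses (acv0_gt0 : 0 < acv0) (arb0_gt0 : 0 < arb0) (arb0_lt1 : arb0 < 1) (b_ge0 : 0 <= b).
Implicit Types (z : R).

Lemma ln_arb0 : ln arb0 < 0.
Proof. by apply: ln_lt0; rewrite arb0_gt0. Qed.

Lemma nu_dagger_in z : 0 < z -> nu_dagger arb0 b z = ln arb0 / ln z + b.
Proof. by move=> z0; rewrite /nu_dagger gt_eqF. Qed.

Lemma nu_dagger_gt z : 0 < z < 1 -> b < nu_dagger arb0 b z.
Proof.
move=> /andP[z0 z1]; rewrite nu_dagger_in// ltrDr.
have lz : ln z < 0 by apply: ln_lt0; rewrite z0.
by rewrite ltr_ndivlMr// mul0r ln_arb0.
Qed.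

(** For [b < 1], solve [ln arb0 / ln z = 1 - b]. For [b >= 1] both sides fail, since [nu_dagger]
    exceeds [b] and [zeta1] is 0. *)
Lemma nu_dagger_eq1 z : 0 < z < 1 -> nu_dagger arb0 b z = 1 <-> z = zeta1 arb0 b.
Proof.
move=> zz; have /andP[z0 z1] := zz; rewrite /zeta1.
have lz : ln z < 0 by apply: ln_lt0; rewrite z0.
have lz0 : ln z != 0 by rewrite lt_eqF.
have := nu_dagger_gt zz; rewrite nu_dagger_in// => bn.
case: ifPn => [b1|]; last first.
  by rewrite -leNgt => b1; split=> h; lra.
have b10 : 1 - b != 0 by rewrite gt_eqF//; lra.
split=> [h|->].
  have : ln z = ln (arb0 `^ (1 / (1 - b))).
    rewrite ln_powR; apply: (mulIf b10); rewrite mul1r mulrAC mulVf// mul1r.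
    have {}h : ln arb0 / ln z = 1 - b by lra.
    by rewrite -h mulrCA divff// mulr1.
  by move/ln_inj; apply; rewrite posrE// powR_gt0.
have la : ln arb0 != 0 by rewrite lt_eqF// ln_arb0.
rewrite ln_powR mul1r invfM invrK mulrCA divff// mulr1; lra.
Qed.

Lemma zeta1_in : b < 1 -> 0 < zeta1 arb0 b < 1.
Proof.
move=> b1; rewrite /zeta1 b1 powR_gt0//=.
have b10 : 0 < (1 - b)^-1 by rewrite invr_gt0; lra.
by rewrite /powR gt_eqF// expR_lt1 div1r pmulr_rlt0// ln_arb0.
Qed.

Lemma gtilde_dagger_in z l m : 0 < z < 1 ->
  gtilde_dagger arb0 b z (l + m) l =
  falling (nu_dagger arb0 b z - 1) m * gcoef l m (nu_dagger arb0 b z) (1 - z).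
Proof.
move=> zz; have /andP[z0 z1] := zz; rewrite /gtilde_dagger gt_eqF//.
by apply: gtilde_gcoef; exact: le_lt_trans (nu_dagger_gt zz).
Qed.

Lemma nu_dagger_cvg0 : nu_dagger arb0 b z @[z --> 0^'+] --> b.
Proof.
have H : (ln arb0 * (ln z)^-1 + b) @[z --> 0^'+] --> ln arb0 * 0 + b.
  apply: cvgD; last exact: cvg_cst.
  apply: cvgM; first exact: cvg_cst.
  have h : (- ln z)^-1 @[z --> (0 : R)^'+] --> (0 : R).
    apply/gtr0_cvgV0; last first.
      apply/cvgryPge => A; have /cvgrNyPle/(_ (- A)) := @lnNy R.
      by apply: filterS => z; lra.
    near=> z; rewrite oppr_gt0; apply: ln_lt0; apply/andP; split.
      by near: z; exact: nbhs_right_gt.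
    by near: z; exact: nbhs_right_lt.
  rewrite -[X in _ --> X]oppr0.
  have h2 : - (- ln z)^-1 @[z --> (0 : R)^'+] --> (- 0 : R) by exact: cvgN h.
  by under eq_cvg do rewrite -[(ln _)^-1]opprK -invrN; exact: h2.
rewrite mulr0 add0r in H; apply: cvg_trans H; apply: near_eq_cvg.
near=> z; rewrite nu_dagger_in//; near: z; exact: nbhs_right_gt.
Unshelve. all: by end_near. Qed.

Lemma gtilde_dagger_zero l m :
  gtilde_dagger arb0 b 0 (l + m) l = (m == 0%N)%:R * l`!%:R.
Proof.
rewrite /gtilde_dagger eqxx.
have n01 : \forall z \near 0^'+, 0 < z < (1 : R).
  near=> z; apply/andP; split; near: z; [exact: nbhs_right_gt|exact: nbhs_right_lt].
have nc := nu_dagger_cvg0.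
have H : (falling (nu_dagger arb0 b z - 1) m * gcoef l m (nu_dagger arb0 b z) (1 - z))
    @[z --> 0^'+] --> falling (b - 1) m * ((m == 0%N)%:R * l`!%:R).
  apply: cvgM.
    by apply: cvg_prodr => i _; do 2 (apply: cvgB; last exact: cvg_cst).
  apply: (@gcoef_cvg0 _ _ _ _ _ (fun z => 1 - z) (b + 1)).
  - have : \forall z \near 0^'+, nu_dagger arb0 b z < b + 1.
      by apply: (cvgr_lt _ nc); lra.
    apply: filterS2 n01 => z zz h.
    by rewrite (le_lt_trans b_ge0 (nu_dagger_gt zz)) ltW.
  - by apply: filterS n01 => z; lra.
  - rewrite -[X in _ --> X]subr0; apply: cvgB; first exact: cvg_cst.
    by apply: cvg_within; exact: cvg_id.
have -> : (m == 0%N)%:R * l`!%:R = falling (b - 1) m * ((m == 0%N)%:R * l`!%:R) :> R.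
  by case: m {H} => [|m]; rewrite ?falling0 ?mul1r// !mul0r mulr0.
apply: cvg_lim => //; apply: cvg_trans H; apply: near_eq_cvg.
apply: filterS n01 => z zz; rewrite -gtilde_gcoef//.
exact: le_lt_trans (nu_dagger_gt zz).
Unshelve. all: by end_near. Qed.

Lemma ARB_in z : 0 < z < 1 -> ARB z (nu_dagger arb0 b z) = arb0 * z `^ b.
Proof.
move=> /andP[z0 z1]; have lz : ln z < 0 by apply: ln_lt0; rewrite z0.
rewrite /ARB nu_dagger_in// powRD; last by rewrite (gt_eqF z0) implybT.
congr (_ * _); rewrite /powR gt_eqF// divfK ?lt_eqF// lnK// posrE.
Qed.

Lemma ARB_daggerE z : 0 <= z < 1 -> ARB_dagger arb0 b z = arb0 * z `^ b.
Proof.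
move=> /andP[z0 z1]; rewrite /ARB_dagger; case: ifPn => [/eqP ->|z00]; last first.
  by apply: ARB_in; rewrite z1 lt_neqAle eq_sym z00 z0.
have n01 : \forall z \near 0^'+, 0 < z < (1 : R).
  near=> x; apply/andP; split; near: x; [exact: nbhs_right_gt|exact: nbhs_right_lt].
have H : arb0 * x `^ b @[x --> 0^'+] --> arb0 * 0 `^ b.
  apply: cvgM; first exact: cvg_cst.
  (* The power at 0 jumps from 1 at exponent 0 to 0 at positive exponents, and the limit follows
     it. *)
  have [b0|b0] := eqVneq b 0.
    by rewrite b0 powRr0; under eq_cvg do rewrite powRr0; exact: cvg_cst.
  rewrite powR0//; apply: powR_cvg0; rewrite lt_neqAle eq_sym b0//.
apply: cvg_lim => //; apply: cvg_trans H; apply: near_eq_cvg.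
by apply: filterS n01 => x xx; rewrite ARB_in.
Unshelve. all: by end_near. Qed.

Lemma ACV2_daggerE z a1 a2 : ACV2_dagger arb0 b z a1 a2 = esumterm (gtilde_dagger arb0 b z) a1 a2.
Proof. by []. Qed.

Lemma optimal_minimises z n1 n2 : 0 <= z < 1 ->
  optimal_sample_sizes z acv0 arb0 b n1 n2 <->
  minimises (gtilde_dagger arb0 b z) (acv0 ^+ 2) (Defs.shape n1) (Defs.shape n2).
Proof.
move=> zz; have shape_ge0 n : (0 <= Defs.shape n) = (1 <= n).
  by rewrite /Defs.shape pmulr_lge0 ?invr_gt0// subr_ge0.
have size_shape n : Defs.shape (2 * n + 1) = n by rewrite /Defs.shape addrK mulrC mulKf.
split=> [[[h1 h2] min Fv _]|[h1 h2 Fv min]].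
  have a1 : 0 <= Defs.shape n1 by rewrite shape_ge0.
  have a2 : 0 <= Defs.shape n2 by rewrite shape_ge0.
  split=> //.
    rewrite -(sqr_sqrte (esumterm_ge0 (gtilde_dagger arb0 b z) a1 a2)).
    by move: Fv; rewrite /ACV_dagger ACV2_daggerE => ->.
  move=> a' b' a'0 b'0 tot.
  have := min (2 * a' + 1) (2 * b' + 1).
  rewrite /ACV_dagger !ACV2_daggerE !size_shape lee_sqrt; last exact: esumterm_ge0.
  by apply; [lra|lra|move: tot; rewrite /Defs.shape; lra].
rewrite !shape_ge0 in h1 h2.
split=> //; last exact: ARB_daggerE.
  move=> m1 m2 m11 m21 tot; rewrite /ACV_dagger !ACV2_daggerE lee_sqrt.
    by apply: min; rewrite ?shape_ge0// /Defs.shape; lra.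
  by apply: esumterm_ge0; rewrite shape_ge0.
by rewrite /ACV_dagger ACV2_daggerE Fv /= sqrtr_sqr gtr0_norm.
Qed.

End Dagger.

(** * The limit zeta -> 1 *)

Section NearOne.
Context {R : realType}.
Implicit Types (a b c v s : R).

Variable L : R.
Hypothesis L_gt0 : 0 < L.

(** The confluent value 1F1(1; k + 2; L), limit of 2F1(1, l + nu + 1; k + 2; x) as x tends to 0 and
    x nu to L. *)
Definition hyplim k : R := limn (series (fun n => L ^+ n / pochhammer k.+2%:R n)).

(** The limit of [x^(l + m)] times the coefficient of index [(l, m)]. It depends only on
    [k = l + m], whence a power series in a single variable. *)
Definition gcoeflim k : R := L ^+ k / k.+1%:R * (hyplim k / hyplim 0).

(** Majorises [hcoef] near the limit: with [x <= 1 / 2] and [x (nu + l + 1) <= L + 1], the ratio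
    [x (l + nu + 1 + i) / (c + i)] is at most [1 / 2 + (L + 1) / (i + 1)] for [c >= 1]. *)
Definition hmaj : R^nat := fun n => \prod_(i < n) (2^-1 + (L + 1) / i.+1%:R).

Lemma hmaj_ge0 n : 0 <= hmaj n.
Proof. by have L0 := L_gt0; apply: prodr_ge0 => i _; nneg. Qed.

Lemma hmaj_cvg : cvgn (series hmaj).
Proof.
have L0 := L_gt0; apply: (@raabe _ _ 1 (Num.truncn (2 + 4 * (L + 1))).+1) => //; first exact: hmaj_ge0.
move=> n Nn.
have hn : 2 + 4 * (L + 1) <= n%:R.
  apply: (le_trans (ltW (truncnS_gt _))); by rewrite ler_nat.
rewrite {1}/hmaj big_ord_recr /= -/(hmaj n) mulrCA mulrC ler_wpM2r ?hmaj_ge0// -natr1.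
move: (n%:R) hn => u hn.
have u1 : 0 < u + 1 by lra.
have -> : (u + 1 + 1) * (2^-1 + (L + 1) / (u + 1)) = (u + 2) / 2 + (L + 1) + (L + 1) / (u + 1).
  by field; rewrite gt_eqF.
have : (L + 1) / (u + 1) <= L + 1 by rewrite ler_pdivrMr// ler_peMr//; lra.
lra.
Qed.

Lemma hyplim_coef_cvg k : cvgn (series (fun n => L ^+ n / pochhammer k.+2%:R n)).
Proof.
have L0 := L_gt0; apply: series_le_cvg hmaj_cvg.
- by move=> n; nneg.
- exact: hmaj_ge0.
move=> n; rewrite /pochhammer -[n in L ^+ n]card_ord -prodr_const -prodf_div.
apply: ler_prod => i _; apply/andP; split; first by nneg.
apply: (@le_trans _ _ ((L + 1) / i.+1%:R)); last by rewrite lerDr.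
apply: ler_pM; [exact: ltW|by nneg|lra|].
have p1 : 0 < k.+2%:R + i%:R :> R by rewrite ltr_pwDl.
rewrite lef_pV2 ?posrE//.
by rewrite -natrD ler_nat addSn ltnS -[leqLHS]add0n leq_add.
Qed.

Lemma hyplim_ge1 k : 1 <= hyplim k.
Proof.
have L0 := L_gt0; have h := @series_partial_le _ _ 1 _ (@hyplim_coef_cvg k).
rewrite [series _ 1](_ : _ = 1) in h.
  by apply: h => n; nneg.
by rewrite /series /= big_nat1 expr0 poch0 divr1.
Qed.

Lemma gcoeflim_gt0 k : 0 < gcoeflim k.
Proof.
have L0 := L_gt0; have h1 := hyplim_ge1 k; have h0 := hyplim_ge1 0.
by rewrite /gcoeflim mulr_gt0// divr_gt0 ?exprn_gt0//; lra.
Qed.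

Context {T : Type} {F : set_system T} {FF : ProperFilter F}.
Variables (nu x : T -> R).
Hypothesis x01 : \forall t \near F, 0 < x t < 1.
Hypothesis x0 : x t @[t --> F] --> (0 : R).
Hypothesis nu_gt0 : \forall t \near F, 0 < nu t.
Hypothesis xnu : x t * nu t @[t --> F] --> L.

Lemma cvg_xnuD c : x t * (nu t + c) @[t --> F] --> L.
Proof.
have : x t * nu t + x t * c @[t --> F] --> L + 0 * c.
  by apply: cvgD => //; apply: cvgM => //; exact: cvg_cst.
by rewrite mul0r addr0; under eq_cvg do rewrite -mulrDr.
Qed.

Lemma cvg_poch_nu l : x t ^+ l * pochhammer (nu t + 1) l @[t --> F] --> L ^+ l.
Proof.
rewrite -[l in _ --> L ^+ l]card_ord -prodr_const.
under eq_cvg => t do rewrite -[l in x t ^+ l]card_ord -prodr_const -big_split /=.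
apply: cvg_prodr => i _; under eq_cvg do rewrite -addrA.
exact: cvg_xnuD.
Qed.

Lemma cvg_falling_nu m : x t ^+ m * falling (nu t - 1) m @[t --> F] --> L ^+ m.
Proof.
rewrite -[m in _ --> L ^+ m]card_ord -prodr_const.
under eq_cvg => t do rewrite -[m in x t ^+ m]card_ord -prodr_const -big_split /=.
apply: cvg_prodr => i _; under eq_cvg do rewrite -addrA.
exact: cvg_xnuD.
Qed.

Lemma near_xnu l : \forall t \near F, [/\ 0 < x t, x t <= 2^-1, 0 < nu t &
  x t * nu t + x t * l%:R <= L + 1].
Proof.
have h1 : \forall t \near F, x t < 2^-1 by apply: (cvgr_lt _ x0); lra.
have h2 : \forall t \near F, x t * (nu t + l%:R) < L + 1.
  by apply: (cvgr_lt _ (cvg_xnuD _)); lra.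
near=> t.
have /andP[? ?] : 0 < x t < 1 by near: t.
split=> //; [by apply: ltW; near: t|by near: t|].
by rewrite -mulrDr; apply: ltW; near: t.
Unshelve. all: by end_near. Qed.

Lemma near_hcoef_hmaj l c : 1 <= c ->
  \forall t \near F, forall n, `|hcoef (l%:R + nu t + 1) c (x t) n| <= hmaj n.
Proof.
have L0 := L_gt0; move=> c1; apply: filterS (near_xnu l.+1) => t [xt xt2 nt h] n.
have l0 := ler0n R l.
have c0 : 0 <= c by lra.
rewrite ger0_norm; last by apply: hcoef_ge0 => //; [lra|exact: ltW].
rewrite /hcoef -prodf_div -[n in x t ^+ n]card_ord -prodr_const -big_split /=.
apply: ler_prod => i _; have i0 := ler0n R i.
have i1 : 0 < i%:R + 1 :> R by lra.
apply/andP; split; first by nneg.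
rewrite -(natr1 l) in h; rewrite -(natr1 i).
have ci : 0 < c + i%:R by lra.
rewrite mulrAC ler_pdivrMr//.
apply: (@le_trans _ _ ((2^-1 + (L + 1) / (i%:R + 1)) * (i%:R + 1))).
  have -> : (2^-1 + (L + 1) / (i%:R + 1)) * (i%:R + 1) = (i%:R + 1) / 2 + (L + 1).
    by field; rewrite gt_eqF.
  have : x t * i%:R <= 2^-1 * i%:R by rewrite ler_wpM2r.
  rewrite mulrDr in h; lra.
by rewrite ler_wpM2l//; [nneg|lra].
Qed.

Lemma cvg_hcoef_nu l k n : hcoef (l%:R + nu t + 1) k.+2%:R (x t) n @[t --> F] -->
  L ^+ n / pochhammer k.+2%:R n.
Proof.
have -> : (fun t => hcoef (l%:R + nu t + 1) k.+2%:R (x t) n) =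
    (fun t => \prod_(i < n) (x t * (nu t + (l%:R + 1 + i%:R)) / (k.+2%:R + i%:R))).
  apply/funext => t; rewrite /hcoef -prodf_div -[n in x t ^+ n]card_ord -prodr_const.
  by rewrite -big_split /=; apply: eq_bigr => i _; ring.
rewrite /pochhammer -[n in L ^+ n]card_ord -prodr_const -prodf_div.
by apply: cvg_prodr => i _; apply: cvgM; [exact: cvg_xnuD|exact: cvg_cst].
Qed.

Lemma cvg_hyp_nu l k : hyp (l%:R + nu t + 1) k.+2%:R (x t) @[t --> F] --> hyplim k.
Proof.
apply: (@cvg_series_dominated _ _ _ _
  (fun n t => hcoef (l%:R + nu t + 1) k.+2%:R (x t) n) _ hmaj); last exact: hmaj_cvg.
- by move=> n; exact: cvg_hcoef_nu.
- by apply: near_hcoef_hmaj; rewrite ler1n.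
Qed.

Lemma cvg_weight l m : x t ^+ (l + m) ^+ 2 * weight (nu t) (x t) l m @[t --> F] -->
  gcoeflim (l + m) ^+ 2 / (l`!%:R * m`!%:R).
Proof.
have hl := @cvg_hyp_nu l (l + m)%N.
have h0 : hyp (nu t + 1) 2 (x t) @[t --> F] --> hyplim 0.
  by have := @cvg_hyp_nu 0 0; under eq_cvg do rewrite add0r.
have hl0 : hyplim 0 != 0 by rewrite gt_eqF// (lt_le_trans _ (hyplim_ge1 0)).
have -> : (fun t => x t ^+ (l + m) ^+ 2 * weight (nu t) (x t) l m) = (fun t =>
  ((x t ^+ l * pochhammer (nu t + 1) l) * (x t ^+ m * falling (nu t - 1) m) / (l + m).+1%:R *
   (hyp (l%:R + nu t + 1) (l + m).+2%:R (x t) / hyp (nu t + 1) 2 (x t))) ^+ 2 /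
  (l`!%:R * m`!%:R)).
  apply/funext => t; rewrite /weight /gcoef mulrA; congr (_ / _).
  by rewrite -exprMn exprD; congr (_ ^+ 2); ring.
have -> : gcoeflim (l + m) = L ^+ l * L ^+ m / (l + m).+1%:R * (hyplim (l + m) / hyplim 0).
  by rewrite /gcoeflim exprD.
apply: cvgM; last exact: cvg_cst.
apply: cvgXr; apply: cvgM.
  apply: cvgM; last exact: cvg_cst.
  by apply: cvgM; [exact: cvg_poch_nu|exact: cvg_falling_nu].
by apply: cvgM => //; exact: cvgV.
Qed.

Lemma cvg_kern_scaled a b l m : 0 < a -> 0 < b ->
  kern l m (a / x t ^+ 2) (b / x t ^+ 2) / x t ^+ (l + m) ^+ 2 @[t --> F] -->
  (a ^+ l * b ^+ m)^-1.
Proof.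
move=> a0 b0.
have key c n : x t ^+ n ^+ 2 * pochhammer (c / x t ^+ 2) n @[t --> F] --> c ^+ n.
  have : \prod_(i < n) (c + x t ^+ 2 * i%:R) @[t --> F] --> \prod_(i < n) (c + 0 ^+ 2 * i%:R).
    apply: cvg_prodr => i _; apply: cvgD; first exact: cvg_cst.
    by apply: cvgM; [exact: cvgXr|exact: cvg_cst].
  under [X in _ --> X]eq_bigr do rewrite expr0n mul0r addr0.
  rewrite prodr_const card_ord.
  apply: cvg_trans; apply: near_eq_cvg; apply: filterS x01 => t /andP[xt _].
  rewrite exprAC -[n in X in X * _]card_ord -prodr_const -big_split /=.
  by apply: eq_bigr => i _; field; rewrite gt_eqF.
have -> : (fun t => kern l m (a / x t ^+ 2) (b / x t ^+ 2) / x t ^+ (l + m) ^+ 2) =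
  (fun t => ((x t ^+ l ^+ 2 * pochhammer (a / x t ^+ 2) l) *
     (x t ^+ m ^+ 2 * pochhammer (b / x t ^+ 2) m))^-1).
  by apply/funext => t; rewrite /kern -invfM exprD exprMn; congr (_^-1); ring.
apply: cvgV; first by rewrite mulf_neq0// gt_eqF// exprn_gt0.
by apply: cvgM; exact: key.
Qed.

(* Coefficients of the limiting series, which is a power series in 1/a + 1/b. *)
Definition limcoef j : R := gcoeflim j.+1 ^+ 2 / j.+1`!%:R.

Definition limterm s : R^nat := fun j => limcoef j * s ^+ j.+1.

Lemma limcoef_gt0 j : 0 < limcoef j.
Proof. by rewrite /limcoef divr_gt0 ?exprn_gt0 ?gcoeflim_gt0// ltr0n fact_gt0. Qed.

Lemma limterm_binomial a b j : 0 < a -> 0 < b ->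
  limterm (a^-1 + b^-1) j = \sum_(l < j.+2)
    gcoeflim j.+1 ^+ 2 / (l`!%:R * (j.+1 - l)`!%:R) * (a ^+ l * b ^+ (j.+1 - l))^-1.
Proof.
move=> a0 b0; rewrite /limterm /limcoef addrC exprDn mulr_sumr; apply: eq_bigr => l _.
have lj : (l <= j.+1)%N by rewrite -ltnS.
rewrite -(bin_fact lj) !natrM -mulr_natr !exprVn.
have f0 i : i`!%:R != 0 :> R by rewrite pnatr_eq0 -lt0n fact_gt0.
have b1 : 'C(j.+1, l)%:R != 0 :> R by rewrite pnatr_eq0 -lt0n bin_gt0.
by field; rewrite b1 !f0 !expf_neq0 ?gt_eqF.
Qed.

Lemma cvg_acvterm_scaled a b j : 0 < a -> 0 < b ->
  acvterm (weight (nu t) (x t)) (a / x t ^+ 2) (b / x t ^+ 2) j @[t --> F] -->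
  limterm (a^-1 + b^-1) j.
Proof.
move=> a0 b0; rewrite limterm_binomial//; apply: cvg_sumr => l _.
have lj : (l <= j.+1)%N by rewrite -ltnS.
have := @cvg_weight l (j.+1 - l)%N; have := @cvg_kern_scaled a b l (j.+1 - l)%N a0 b0.
rewrite subnKC// => h1 h2.
apply: cvg_trans (cvgM h2 h1); apply: near_eq_cvg; apply: filterS x01 => t /andP[xt _].
have p0 : x t ^+ j.+1 ^+ 2 != 0 by rewrite !expf_neq0 ?gt_eqF.
rewrite /=; move: (weight _ _ _ _) (kern _ _ _ _) (x t ^+ j.+1 ^+ 2) p0 => W K p p0.
by field.
Qed.

End NearOne.

(** * Domination and limit of the rescaled series *)

Section ScaledLimit.
Context {R : realType}.
Implicit Types (a b c v s A B : R).
Variable L : R.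
Hypothesis L_gt0 : 0 < L.

(* Majorant, uniform in x and nu with x nu <= L + 1, of the ratios of the sequence
   (nu + 1)_l ^ 2 / (l! (A / x ^ 2)_l).  Beyond the threshold it is the ratio i / (i + 2) of
   a summable sequence. *)
Definition ratio_maj A (i : nat) : R :=
  if (i < (Num.truncn (6 * (L + 2) ^+ 2 / A)).+1)%N then (L + 2 + i%:R) ^+ 2 / A
  else i%:R / (i%:R + 2).

Definition poch_maj A (l : nat) : R := \prod_(i < l) ratio_maj A i.

Lemma poch_maj_ge0 A l : 0 < A -> 0 <= poch_maj A l.
Proof.
move=> A0; apply: prodr_ge0 => i _; rewrite /ratio_maj; have i0 := ler0n R i.
by case: ifP => _; nneg.
Qed.

Lemma poch_maj_cvg A : 0 < A -> cvgn (series (poch_maj A)).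
Proof.
move=> A0; apply: (@raabe _ _ 1 (Num.truncn (6 * (L + 2) ^+ 2 / A)).+1) => //.
  by move=> n; exact: poch_maj_ge0.
move=> n Nn; rewrite {1}/poch_maj big_ord_recr /= -/(poch_maj A n) /ratio_maj ltnNge Nn /=.
rewrite -(natr1 n); have n0 := ler0n R n; have P0 := poch_maj_ge0 n A0.
move: (n%:R : R) n0 => u u0; rewrite le_eqVlt; apply/orP; left; apply/eqP.
by field; rewrite gt_eqF//; lra.
Qed.

Lemma ratio_maj_ge A (nu x : R) (i : nat) : 0 < A -> 0 < x -> x <= 1 -> 0 < nu ->
  x * nu <= L + 1 -> x * (6 * (L + 2) + 1) <= A / 2 ->
  (nu + 1 + i%:R) ^+ 2 <= ratio_maj A i * ((1 + i%:R) * (A / x ^+ 2 + i%:R)).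
Proof.
move=> A0 x0 x1 nu0 h1 h2; have L0 := L_gt0; have i0 := ler0n R i.
have x20 : 0 < x ^+ 2 by rewrite exprn_gt0.
rewrite -(ler_pM2l x20).
have -> : x ^+ 2 * (nu + 1 + i%:R) ^+ 2 = (x * nu + x + x * i%:R) ^+ 2 by ring.
have -> : x ^+ 2 * (ratio_maj A i * ((1 + i%:R) * (A / x ^+ 2 + i%:R))) =
  ratio_maj A i * ((1 + i%:R) * (A + x ^+ 2 * i%:R)) by field; rewrite gt_eqF.
have xi0 : 0 <= x * i%:R by nneg.
have xnu0 : 0 < x * nu by rewrite mulr_gt0.
rewrite /ratio_maj; case: ifPn => [_|].
  apply: (@le_trans _ _ ((L + 2 + i%:R) ^+ 2)).
    rewrite ler_sqr ?nnegrE; [|lra|lra].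
    have : x * i%:R <= i%:R by rewrite ler_piMl.
    lra.
  rewrite [leRHS](_ : _ = (L + 2 + i%:R) ^+ 2 * ((1 + i%:R) * (A + x ^+ 2 * i%:R) / A)).
    rewrite ler_peMr ?sqr_ge0// ler_pdivlMr// mul1r.
    have x2i : 0 <= x ^+ 2 * i%:R by nneg.
    have : A <= A + x ^+ 2 * i%:R by lra.
    by move=> /le_trans; apply; rewrite ler_peMl//; lra.
  by ring.
rewrite -leqNgt => Ni.
have hi : 6 * (L + 2) ^+ 2 <= A * i%:R.
  rewrite (mulrC A) -ler_pdivrMr//; apply: (le_trans (ltW (truncnS_gt _))).
  by rewrite ler_nat.
have i1 : 1 <= i%:R :> R by rewrite ler1n (leq_trans _ Ni).
move: (i%:R : R) i0 i1 hi xi0 {Ni} => u u0 u1 hu xu0.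
rewrite mulrAC ler_pdivlMr; last lra.
apply: (@le_trans _ _ ((L + 2 + x * u) ^+ 2 * (u + 2))).
  rewrite ler_wpM2r//; first lra.
  by rewrite ler_sqr ?nnegrE; lra.
(* With the ratio [u / (u + 2)] the terms [x^2 u^3] cancel. As [u + 2 <= 3 u], half of [A u^2] pays
   for the constant part through [6 (L + 2)^2 <= A u], the other half for the terms in [x]. *)
rewrite -subr_ge0.
have -> : u * ((1 + u) * (A + x ^+ 2 * u)) - (L + 2 + x * u) ^+ 2 * (u + 2) =
  A * u * (u + 1) - (L + 2) ^+ 2 * (u + 2) - 2 * (L + 2) * x * u * (u + 2) - x ^+ 2 * u ^+ 2.
  by ring.
have e1 : (L + 2) ^+ 2 * (u + 2) <= (L + 2) ^+ 2 * (3 * u).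
  by rewrite ler_wpM2l ?sqr_ge0//; lra.
have xpos : 0 <= 2 * (L + 2) * x * u by nneg.
have e2 : 2 * (L + 2) * x * u * (u + 2) <= 2 * (L + 2) * x * u * (3 * u).
  by rewrite ler_wpM2l//; lra.
have e3 : x ^+ 2 * u ^+ 2 <= x * u ^+ 2.
  by rewrite ler_wpM2r ?sqr_ge0// expr2 ler_piMr// ltW.
have e4 : x * (6 * (L + 2) + 1) * u ^+ 2 <= A / 2 * u ^+ 2 by rewrite ler_wpM2r ?sqr_ge0.
have e5 : 6 * (L + 2) ^+ 2 * u <= A * u * u by rewrite ler_wpM2r.
have e6 : 0 <= A * u by nneg.
lra.
Qed.

Lemma poch_ratio_maj A (nu x : R) l : 0 < A -> 0 < x -> x <= 1 -> 0 < nu ->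
  x * nu <= L + 1 -> x * (6 * (L + 2) + 1) <= A / 2 ->
  pochhammer (nu + 1) l ^+ 2 <= poch_maj A l * (l`!%:R * pochhammer (A / x ^+ 2) l).
Proof.
move=> A0 x0 x1 nu0 h1 h2.
rewrite -poch_one /poch_maj /pochhammer -prodrXl -!big_split /=.
apply: ler_prod => i _; rewrite sqr_ge0 /=; exact: ratio_maj_ge.
Qed.

Context {T : Type} {F : set_system T} {FF : ProperFilter F}.
Variables (nu x : T -> R).
Hypothesis x01 : \forall t \near F, 0 < x t < 1.
Hypothesis x0 : x t @[t --> F] --> (0 : R).
Hypothesis nu_gt0 : \forall t \near F, 0 < nu t.
Hypothesis xnu : x t * nu t @[t --> F] --> L.

Let D := limn (series (hmaj L)).

Definition acv_maj A B : R^nat := fun j =>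
  D ^+ 2 * \sum_(l < j.+2) poch_maj A l * poch_maj B (j.+1 - l)%N.

Lemma acv_maj_cvg A B : 0 < A -> 0 < B -> cvgn (series (acv_maj A B)).
Proof.
move=> A0 B0.
have pA n := poch_maj_ge0 n A0; have pB n := poch_maj_ge0 n B0.
have cA := @poch_maj_cvg A A0; have cB := @poch_maj_cvg B B0.
apply: (@series_bounded_cvg _ _ (D ^+ 2 * (limn (series (poch_maj A)) * limn (series (poch_maj B))))).
  move=> n; rewrite /acv_maj mulr_ge0 ?sqr_ge0//; apply: sumr_ge0 => l _.
  by rewrite mulr_ge0.
move=> n; rewrite /series /= -mulr_sumr ler_wpM2l ?sqr_ge0//.
apply: le_trans (series_convol_le n pA pB) _.
by rewrite ler_pM ?series_partial_le// /series /= sumr_ge0.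
Qed.

(** The squared falling factorial is at most [pochhammer (nu + 1) m ^+ 2], and [gcoef] at most [D]
    times [pochhammer (nu + 1) l]. Each index is then dominated separately by [poch_ratio_maj]. *)
Lemma near_acvterm_maj A B : 0 < A -> 0 < B -> \forall t \near F, forall j,
  `|acvterm (weight (nu t) (x t)) (A / x t ^+ 2) (B / x t ^+ 2) j| <= acv_maj A B j.
Proof.
move=> A0 B0; have L0 := L_gt0.
have c1 : \forall t \near F, [/\ 0 < x t, x t <= 2^-1, 0 < nu t &
    x t * nu t + x t * 0%:R <= L + 1] by apply: near_xnu.
have c2 : \forall t \near F, forall n, `|hcoef (0%:R + nu t + 1) 1 (x t) n| <= hmaj L n.
  by apply: near_hcoef_hmaj.
pose e C := C / 2 / (6 * (L + 2) + 1).
have k0 : 0 < 6 * (L + 2) + 1 by lra.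
have e0 C : 0 < C -> 0 < e C by move=> C0; rewrite /e !divr_gt0.
have c3 : \forall t \near F, x t < e A by apply: (cvgr_lt _ x0); exact: e0.
have c4 : \forall t \near F, x t < e B by apply: (cvgr_lt _ x0); exact: e0.
near=> t => j.
have [xt xt2 nt xn] : [/\ 0 < x t, x t <= 2^-1, 0 < nu t & x t * nu t + x t * 0%:R <= L + 1].
  by near: t.
rewrite mulr0 addr0 in xn.
have hm : forall n, `|hcoef (0%:R + nu t + 1) 1 (x t) n| <= hmaj L n by near: t.
have hA : x t * (6 * (L + 2) + 1) <= A / 2.
  by rewrite -ler_pdivlMr//; apply: ltW; near: t.
have hB : x t * (6 * (L + 2) + 1) <= B / 2.
  by rewrite -ler_pdivlMr//; apply: ltW; near: t.
have x20 : 0 < x t ^+ 2 by rewrite exprn_gt0.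
have Ax : 0 < A / x t ^+ 2 by rewrite divr_gt0.
have Bx : 0 < B / x t ^+ 2 by rewrite divr_gt0.
have x1 : x t <= 1 by lra.
have xx : 0 <= x t < 1 by apply/andP; split; lra.
have nu0 := ltW nt.
have hD : hyp (nu t + 1) 1 (x t) <= D.
  rewrite add0r in hm.
  apply: lim_series_le; [by apply: hcoef_cvg => //; lra|exact: hmaj_cvg|].
  by move=> n; apply: le_trans (hm n); exact: ler_norm.
rewrite ger0_norm; last by apply: acvterm_ge0 => //; exact: weight_ge0.
rewrite /acvterm /acv_maj mulr_sumr; apply: ler_sum => l _.
move: (j.+1 - l)%N => m; move: (nat_of_ord l) => {}l.
have PA := poch_ratio_maj l A0 xt x1 nt xn hA.
have PB := poch_ratio_maj m B0 xt x1 nt xn hB.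
have fm : falling (nu t - 1) m ^+ 2 <= pochhammer (nu t + 1) m ^+ 2.
  rewrite sqr_falling /pochhammer -!prodrXl; apply: ler_prod => i _.
  have i0 := ler0n R i; rewrite sqr_ge0 /=.
  by rewrite -subr_ge0 (_ : _ - _ = 4 * nu t * (1 + i%:R)); [nneg|ring].
have gc : gcoef l m (nu t) (x t) ^+ 2 <= D ^+ 2 * pochhammer (nu t + 1) l ^+ 2.
  have g0 : 0 <= gcoef l m (nu t) (x t) by apply: ltW; apply: gcoef_gt0; rewrite // xt; lra.
  have P0 : 0 <= pochhammer (nu t + 1) l by apply: poch_ge0; lra.
  have h1 := @hyp_le_uniform _ (nu t) (x t) l m nu0 xx.
  have h2 : 1 <= hyp (nu t + 1) 2 (x t) by apply: hyp_ge1 => //; lra.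
  have h3 : 1 <= hyp (l%:R + nu t + 1) (l + m).+2%:R (x t).
    by apply: hyp_ge1 => //; have := ler0n R l; lra.
  rewrite -exprMn ler_sqr ?nnegrE//; last by rewrite mulr_ge0//; lra.
  rewrite /gcoef [leRHS]mulrC; apply: ler_pM => //; [by nneg|by rewrite divr_ge0//; lra| |].
    by rewrite ler_pdivrMr// ler_peMr// ler1n.
  rewrite ler_pdivrMr; last lra.
  by apply: (@le_trans _ _ D); [lra|rewrite ler_peMr//; lra].
have pa := poch_gt0 l Ax; have pb := poch_gt0 m Bx.
have fl : 0 < l`!%:R :> R by rewrite ltr0n fact_gt0.
have fmm : 0 < m`!%:R :> R by rewrite ltr0n fact_gt0.
rewrite /weight /kern exprMn -mulrA -invfM.
rewrite ler_pdivrMr ?mulr_gt0//.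
apply: (@le_trans _ _ (pochhammer (nu t + 1) m ^+ 2 * (D ^+ 2 * pochhammer (nu t + 1) l ^+ 2))).
  by apply: ler_pM; rewrite ?sqr_ge0.
apply: (@le_trans _ _ ((poch_maj B m * (m`!%:R * pochhammer (B / x t ^+ 2) m)) *
   (D ^+ 2 * (poch_maj A l * (l`!%:R * pochhammer (A / x t ^+ 2) l))))).
  apply: ler_pM => //; [exact: sqr_ge0|by rewrite mulr_ge0 ?sqr_ge0|].
  by rewrite ler_wpM2l ?sqr_ge0.
by rewrite le_eqVlt; apply/orP; left; apply/eqP; ring.
Unshelve. all: by end_near. Qed.

(** The majorant passes to the termwise limit, so no estimate of [gcoeflim] is needed. *)
Lemma limterm_cvg A B : 0 < A -> 0 < B -> cvgn (series (limterm L (A^-1 + B^-1))).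
Proof.
move=> A0 B0; apply: (dominated_series_cvg _ (@acv_maj_cvg A B A0 B0)).
apply: (@dominated_lim_le _ _ F _ (fun j t =>
  acvterm (weight (nu t) (x t)) (A / x t ^+ 2) (B / x t ^+ 2) j)).
  by move=> j; exact: cvg_acvterm_scaled.
exact: near_acvterm_maj.
Qed.

Lemma cvg_acv_scaled A B : 0 < A -> 0 < B ->
  limn (series (acvterm (weight (nu t) (x t)) (A / x t ^+ 2) (B / x t ^+ 2))) @[t --> F] -->
  limn (series (limterm L (A^-1 + B^-1))).
Proof.
move=> A0 B0.
apply: (@cvg_series_dominated _ _ F _ (fun j t =>
  acvterm (weight (nu t) (x t)) (A / x t ^+ 2) (B / x t ^+ 2) j) _ (acv_maj A B)).
- by move=> j; exact: cvg_acvterm_scaled.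
- exact: near_acvterm_maj.
- exact: acv_maj_cvg.
Qed.

Lemma near_sumle_scaled A B v : 0 < A -> 0 < B ->
  limn (series (limterm L (A^-1 + B^-1))) < v ->
  \forall t \near F, sumle (weight (nu t) (x t)) v (A / x t ^+ 2) (B / x t ^+ 2).
Proof.
move=> A0 B0 lv; have c1 := near_acvterm_maj A0 B0.
have c2 : \forall t \near F,
    limn (series (acvterm (weight (nu t) (x t)) (A / x t ^+ 2) (B / x t ^+ 2))) < v.
  by apply: (cvgr_lt _ (@cvg_acv_scaled A B A0 B0)).
near=> t => n.
have /andP[xt _] : 0 < x t < 1 by near: t.
have x20 : 0 < x t ^+ 2 by rewrite exprn_gt0.
apply: (@le_trans _ _ (limn (series (acvterm (weight (nu t) (x t)) (A / x t ^+ 2) (B / x t ^+ 2))))).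
  apply: series_partial_le.
    by move=> j; apply: acvterm_ge0; rewrite ?divr_gt0//; exact: weight_ge0.
  apply: (dominated_series_cvg _ (@acv_maj_cvg A B A0 B0)); by near: t.
by apply: ltW; near: t.
Unshelve. all: by end_near. Qed.

End ScaledLimit.

(** * Asymptotics of the optimal shapes *)

Section ScaledOptimum.
Context {R : realType}.
Implicit Types (v s A B e : R).
Variable L : R.
Hypothesis L_gt0 : 0 < L.
Context {T : Type} {F : set_system T} {FF : ProperFilter F}.
Variables (nu x : T -> R).
Hypothesis x01 : \forall t \near F, 0 < x t < 1.
Hypothesis x0 : x t @[t --> F] --> (0 : R).
Hypothesis nu_gt0 : \forall t \near F, 0 < nu t.
Hypothesis xnu : x t * nu t @[t --> F] --> L.

Lemma limterm_ge0 s j : 0 <= s -> 0 <= limterm L s j.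
Proof. by move=> s0; rewrite mulr_ge0 ?exprn_ge0// ltW// limcoef_gt0. Qed.

Lemma limterm_mono s s' j : 0 <= s -> s <= s' -> limterm L s j <= limterm L s' j.
Proof.
move=> s0 ss; rewrite /limterm ler_wpM2l//; first by rewrite ltW// limcoef_gt0.
by rewrite lerXn2r ?nnegrE//; lra.
Qed.

Lemma limterm_scale s s' j : 0 <= s -> s <= s' -> 0 < s' ->
  limterm L s j <= s / s' * limterm L s' j.
Proof.
move=> s0 ss s'0; rewrite /limterm mulrCA ler_wpM2l//; first by rewrite ltW// limcoef_gt0.
rewrite exprS [s' ^+ _]exprS mulrA divfK ?gt_eqF// ler_wpM2l//.
by rewrite lerXn2r ?nnegrE//; lra.
Qed.

Lemma limterm_cvg_pos s : 0 < s -> cvgn (series (limterm L s)).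
Proof.
move=> s0; have A0 : 0 < 2 / s by rewrite divr_gt0.
have : cvgn (series (limterm L ((2 / s)^-1 + (2 / s)^-1))).
  exact: (limterm_cvg L_gt0 x01 x0 nu_gt0 xnu A0 A0).
by rewrite (_ : (2 / s)^-1 + (2 / s)^-1 = s)//; field; rewrite gt_eqF.
Qed.

(** Take the supremum of the admissible [s]. Continuity in [s] is avoided: below it [limterm_scale]
    gives a strict gain, and above it some partial sum exceeds [v]. *)
Lemma critical_exists v : 0 < v -> exists s, [/\ 0 < s,
  forall s', 0 < s' -> s' < s -> limn (series (limterm L s')) < v &
  forall s', s < s' -> exists N, v < series (limterm L s') N].
Proof.
move=> v0.
pose E : set R := [set s | 0 <= s /\ forall n, series (limterm L s) n <= v].
have c0 := limcoef_gt0 L_gt0 0.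
have ubE : has_ubound E.
  exists (v / limcoef L 0) => s [s0 /(_ 1%N)].
  by rewrite /series /= big_nat1 /limterm expr1 ler_pdivlMr// mulrC.
pose K := limn (series (limterm L 1)).
have c1 := limterm_cvg_pos ltr01.
have K0 : 0 < K.
  apply: (@lt_le_trans _ _ (series (limterm L 1) 1)).
    by rewrite /series /= big_nat1 /limterm expr1 mulr1.
  by apply: series_partial_le => // n; exact: limterm_ge0.
pose s1 := Num.min 1 (v / K).
have s10 : 0 < s1 by rewrite lt_min ltr01 divr_gt0.
have s11 : s1 <= 1 by rewrite ge_min lexx.
have s1K : s1 * K <= v.
  by rewrite -ler_pdivlMr// ge_min lexx orbT.
have Es1 : E s1.
  split=> [|n]; first exact: ltW.
  apply: le_trans s1K; apply: (@le_trans _ _ (s1 * series (limterm L 1) n)).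
    rewrite /series /= mulr_sumr; apply: ler_sum => j _.
    by have := @limterm_scale s1 1 j (ltW s10) s11 ltr01; rewrite divr1.
  by rewrite ler_pM2l//; apply: series_partial_le => // j; exact: limterm_ge0.
have E0 : E !=set0 by exists s1.
have hs : has_sup E by split.
have s1sup : s1 <= sup E by apply: ub_le_sup.
exists (sup E); split; first exact: lt_le_trans s1sup.
- move=> s' s'0 /(sup_gt E0)[s2 [s20 Hs2] s's2].
  have s2p : 0 < s2 by lra.
  have ss1 : s' / s2 < 1 by rewrite ltr_pdivrMr// mul1r.
  apply: (@le_lt_trans _ _ (s' / s2 * v)); last by rewrite gtr_pMl.
  apply: lim_series_bound; first exact: limterm_cvg_pos.
  move=> n; apply: (@le_trans _ _ (s' / s2 * series (limterm L s2) n)).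
    rewrite /series /= mulr_sumr; apply: ler_sum => j _.
    by apply: limterm_scale => //; exact: ltW.
  by rewrite ler_wpM2l// divr_ge0// ltW.
- move=> s' ss'.
  have s'0 : 0 <= s' by lra.
  apply: contrapT => H; have : E s'.
    by split=> // n; rewrite leNgt; apply/negP => Hn; apply: H; exists n.
  by move=> /(ub_le_sup ubE); lra.
Qed.

Variables (v : R) (a b : T -> R).
Hypothesis v_gt0 : 0 < v.
Hypothesis opt : \forall t \near F, total_min (weight (nu t) (x t)) v (a t) (b t).

(** The test point [A = B = 2 / s * (1 + e)] has reciprocal sum [s / (1 + e) < s], so it is
    eventually feasible; the optimal total is no larger. *)
Lemma near_scaled_upper s e : 0 < s -> 0 < e ->
  (forall s', 0 < s' -> s' < s -> limn (series (limterm L s')) < v) ->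
  \forall t \near F, x t ^+ 2 * a t + x t ^+ 2 * b t <= 4 / s * (1 + e).
Proof.
move=> s0 e0 H; pose A := 2 / s * (1 + e).
have A0 : 0 < A by rewrite /A mulr_gt0 ?divr_gt0//; lra.
have AE : A^-1 + A^-1 = s / (1 + e) by rewrite /A; field; rewrite !gt_eqF//; lra.
have lv : limn (series (limterm L (A^-1 + A^-1))) < v.
  rewrite AE; apply: H; first by rewrite divr_gt0//; lra.
  rewrite ltr_pdivrMr; last lra.
  by rewrite ltr_pMr//; lra.
have c : \forall t \near F, sumle (weight (nu t) (x t)) v (A / x t ^+ 2) (A / x t ^+ 2).
  exact: (near_sumle_scaled L_gt0 x01 x0 nu_gt0 xnu A0 A0 lv).
near=> t.
have /andP[xt _] : 0 < x t < 1 by near: t.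
have x20 : 0 < x t ^+ 2 by rewrite exprn_gt0.
have ct : sumle (weight (nu t) (x t)) v (A / x t ^+ 2) (A / x t ^+ 2) by near: t.
have [a0 b0 _ min] : total_min (weight (nu t) (x t)) v (a t) (b t) by near: t.
have Ax : 0 < A / x t ^+ 2 by rewrite divr_gt0.
have := min _ _ Ax Ax ct; rewrite -(ler_pM2l x20) mulrDr.
by move=> /le_trans; apply; rewrite /A le_eqVlt; apply/orP; left; apply/eqP; field; rewrite !gt_eqF.
Unshelve. all: by end_near. Qed.

(** A partial sum [Q > v] of the limit series at [s + e] involves finitely many weights, eventually
    above [th] times their limits with [th * Q > v]. Adding [e] to the rescaled shapes absorbs the
    shifts [x^2 i] in the Pochhammer factors. *)
Lemma near_scaled_lower s e : 0 < s -> 0 < e ->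
  (forall s', s < s' -> exists N, v < series (limterm L s') N) ->
  \forall t \near F,
    (x t ^+ 2 * a t + e)^-1 + (x t ^+ 2 * b t + e)^-1 <= s + e.
Proof.
move=> s0 e0 H; have [N HN] : exists N, v < series (limterm L (s + e)) N by apply: H; lra.
set Q := series _ _ in HN.
have v0 := v_gt0.
have Q0 : 0 < Q by lra.
pose th := (1 + v / Q) / 2.
have vQ : v / Q < 1 by rewrite ltr_pdivrMr// mul1r.
have vQ0 : 0 < v / Q by rewrite divr_gt0.
have th0 : 0 < th by rewrite /th; lra.
have thv : v < th * Q.
  have : v / Q * Q = v by rewrite divfK// gt_eqF.
  by rewrite /th; lra.
pose lim l m : R := gcoeflim L (l + m) ^+ 2 / (l`!%:R * m`!%:R).
have lim0 l m : 0 < lim l m.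
  by rewrite divr_gt0 ?exprn_gt0 ?gcoeflim_gt0// mulr_gt0// ltr0n fact_gt0.
have c1 : \forall t \near F, forall lm : 'I_N.+1 * 'I_N.+1,
    th * lim lm.1 lm.2 < x t ^+ (lm.1 + lm.2) ^+ 2 * weight (nu t) (x t) lm.1 lm.2.
  apply: filter_forall => -[l m] /=.
  have W : x t ^+ (l + m) ^+ 2 * weight (nu t) (x t) l m @[t --> F] --> lim l m.
    by apply: cvg_weight.
  apply: (cvgr_gt _ W).
  by rewrite gtr_pMl//; rewrite /th; lra.
have c2 : \forall t \near F, x t < e / N.+1%:R by apply: (cvgr_lt _ x0); rewrite divr_gt0.
near=> t.
have /andP[xt xt1] : 0 < x t < 1 by near: t.
have x20 : 0 < x t ^+ 2 by rewrite exprn_gt0.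
have Nx (i : nat) : (i <= N)%N -> x t ^+ 2 * i%:R <= e.
  move=> iN; have : x t < e / N.+1%:R by near: t.
  rewrite ltr_pdivlMr// => h.
  apply: le_trans (ltW h); rewrite expr2 -mulrA ler_pM2l//.
  apply: (@le_trans _ _ (1 * i%:R)); first by rewrite ler_wpM2r// ltW.
  by rewrite mul1r ler_nat ltnW.
have [a0 b0 Hv _] : total_min (weight (nu t) (x t)) v (a t) (b t) by near: t.
have c1t : forall lm : 'I_N.+1 * 'I_N.+1,
    th * lim lm.1 lm.2 < x t ^+ (lm.1 + lm.2) ^+ 2 * weight (nu t) (x t) lm.1 lm.2.
  by near: t.
set A := x t ^+ 2 * a t + e; set B := x t ^+ 2 * b t + e.
have A0 : 0 < A by rewrite /A addr_gt0// mulr_gt0.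
have B0 : 0 < B by rewrite /B addr_gt0// mulr_gt0.
rewrite leNgt; apply/negP => sAB.
have pk c n : 0 < c -> (n <= N)%N -> x t ^+ n ^+ 2 * pochhammer c n <= (x t ^+ 2 * c + e) ^+ n.
  move=> cpos nN.
  rewrite exprAC -[n in X in X * _]card_ord -prodr_const -[n in leRHS]card_ord -prodr_const.
  rewrite -big_split /=; apply: ler_prod => i _.
  rewrite mulrDr lerD2l Nx ?andbT; first by nneg.
  by rewrite (leq_trans (ltnW (ltn_ord i))).
have key j : (j < N)%N -> th * limterm L (A^-1 + B^-1) j <= acvterm (weight (nu t) (x t)) (a t) (b t) j.
  move=> jN; rewrite limterm_binomial// mulr_sumr; apply: ler_sum => l _.
  have lj : (l <= j.+1)%N by rewrite -ltnS.
  have lN : (l < N.+1)%N by rewrite ltnS (leq_trans lj).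
  have mN : (j.+1 - l < N.+1)%N by rewrite ltnS (leq_trans (leq_subr _ _)).
  have := c1t (Ordinal lN, Ordinal mN); rewrite /= /lim subnKC// => h.
  have pl := pk _ l a0 lN; have pm := pk _ (j.+1 - l)%N b0 mN.
  rewrite mulrA.
  apply: (@le_trans _ _ (x t ^+ j.+1 ^+ 2 * weight (nu t) (x t) l (j.+1 - l) *
      (A ^+ l * B ^+ (j.+1 - l))^-1)).
    by rewrite ler_wpM2r ?invr_ge0 ?mulr_ge0 ?exprn_ge0//; exact: ltW.
  rewrite mulrAC mulrC ler_wpM2l ?weight_ge0//.
  have xj : x t ^+ j.+1 = x t ^+ l * x t ^+ (j.+1 - l) by rewrite -exprD subnKC.
  rewrite ler_pdivrMr ?mulr_gt0 ?exprn_gt0// mulrC /kern ler_pdivlMr ?mulr_gt0 ?poch_gt0//.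
  rewrite xj exprMn mulrACA; apply: ler_pM => //.
    by rewrite mulr_ge0 ?exprn_ge0 ?poch_ge0// ltW.
  by rewrite mulr_ge0 ?exprn_ge0 ?poch_ge0// ltW.
have : th * Q <= v.
  apply: le_trans (Hv N); rewrite /Q /series /= mulr_sumr ler_sum_nat// => j /andP[_ jN].
  apply: le_trans (key _ jN); rewrite ler_pM2l//.
  by apply: limterm_mono; [nneg|exact: ltW sAB].
lra.
Unshelve. all: by end_near. Qed.

(* Quantifies that p + q is minimal under 1/p + 1/q <= s at p = q = 2 / s:
   (p - q)^2 = (p + q)^2 - 4 p q with p q >= (p + q) / s. *)
Lemma near_optimum_close s e : 0 < s -> 0 < e -> e <= 1 ->
  let K := 4 / s ^+ 2 + 4 / s + 2 in let T1 := 8 / s + 2 in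
  forall p q : R, 0 < p -> 0 < q -> p + q <= 4 / s * (1 + e) ->
  (p + e)^-1 + (q + e)^-1 <= s + e ->
  (p - q) ^+ 2 <= T1 * (K * e) /\ `|p + q - 4 / s| <= K * e + 2 * e.
Proof.
move=> s0 e0 e1 K T1 p q p0 q0 up low.
have pe : 0 < p + e by lra. have qe : 0 < q + e by lra.
have se : 0 < s + e by lra.
set w := p + q + 2 * e.
have w0 : 0 < w by rewrite /w; lra.
have h1 : w <= (s + e) * ((p + e) * (q + e)).
  have -> : w = ((p + e)^-1 + (q + e)^-1) * ((p + e) * (q + e)).
    by rewrite /w; field; rewrite !gt_eqF.
  by rewrite ler_pM2r// mulr_gt0.
have h2 : 4 / (s + e) <= w.
  rewrite ler_pdivrMr//.
  have : 4 * ((p + e) * (q + e)) <= w ^+ 2.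
    by rewrite /w; have := sqr_ge0 (p - q); nra.
  have : 4 * w <= 4 * ((s + e) * ((p + e) * (q + e))) by lra.
  move=> h3 h4.
  have h5 : (s + e) * (4 * ((p + e) * (q + e))) <= (s + e) * w ^+ 2 by rewrite ler_pM2l.
  rewrite -(ler_pM2r w0); lra.
have is0 : 0 < s^-1 by rewrite invr_gt0.
have h6 : 4 / s - 4 / s ^+ 2 * e <= 4 / (s + e).
  rewrite ler_pdivlMr// -subr_ge0.
  have -> : 4 - (4 / s - 4 / s ^+ 2 * e) * (s + e) = 4 * e ^+ 2 / s ^+ 2.
    by field; rewrite gt_eqF.
  by nneg.
have k2 : 0 <= 4 / s ^+ 2 * e by nneg.
have k1 : 0 <= 4 / s * e by nneg.
have wT : w <= T1.
  have : 4 / s * e <= 4 / s by rewrite ler_piMr//; nneg.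
  by rewrite /w /T1; lra.
(* The summands of [K] come from replacing [4 / s] by [4 / (s + e)], from the factor [1 + e] in the
   upper bound, and from the [2 * e] in [w]. *)
have wK : w - 4 / (s + e) <= K * e by rewrite /w /K; lra.
split.
  have -> : (p - q) ^+ 2 = w ^+ 2 - 4 * ((p + e) * (q + e)) by rewrite /w; ring.
  have h7 : w / (s + e) <= (p + e) * (q + e) by rewrite ler_pdivrMr// mulrC.
  apply: (@le_trans _ _ (w * (w - 4 / (s + e)))); first by lra.
  by apply: ler_pM => //; lra.
rewrite ler_norml; apply/andP; split; rewrite /K; move: h2 up; rewrite /w; lra.
Qed.

End ScaledOptimum.

Section OptimumLimit.
Context {R : realType}.
Variable L : R.
Hypothesis L_gt0 : 0 < L.
Context {T : Type} {F : set_system T} {FF : ProperFilter F}.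
Variables (nu x : T -> R).
Hypothesis x01 : \forall t \near F, 0 < x t < 1.
Hypothesis x0 : x t @[t --> F] --> (0 : R).
Hypothesis nu_gt0 : \forall t \near F, 0 < nu t.
Hypothesis xnu : x t * nu t @[t --> F] --> L.
Variables (v : R) (a b : T -> R).
Hypothesis v_gt0 : 0 < v.
Hypothesis opt : \forall t \near F, total_min (weight (nu t) (x t)) v (a t) (b t).

Lemma cvg_scaled_optimum : exists c : R, [/\ 0 < c,
  x t ^+ 2 * a t @[t --> F] --> c & x t ^+ 2 * b t @[t --> F] --> c].
Proof.
have [s [s0 Hu Hl]] : exists s, [/\ 0 < s,
    forall s', 0 < s' -> s' < s -> limn (series (limterm L s')) < v &
    forall s', s < s' -> exists N, v < series (limterm L s') N].
  exact: (critical_exists L_gt0 x01 x0 nu_gt0 xnu v_gt0).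
pose K := 4 / s ^+ 2 + 4 / s + 2; pose T1 := 8 / s + 2.
have K0 : 0 < K by rewrite /K ltr_wpDl//; nneg.
have T0 : 0 < T1 by rewrite /T1 ltr_wpDl//; nneg.
have key (eps : R) : 0 < eps -> \forall t \near F,
    `|2 / s - x t ^+ 2 * a t| <= eps /\ `|2 / s - x t ^+ 2 * b t| <= eps.
  move=> eps0.
  (* The bounds on [e] turn the two estimates of [near_optimum_close] into [|p - q| <= eps] and
     [|p + q - 4 / s| <= eps]. *)
  pose e := Num.min 1 (Num.min (eps / (K + 2)) (eps ^+ 2 / (T1 * K))).
  have K2 : 0 < K + 2 by lra.
  have TK : 0 < T1 * K by rewrite mulr_gt0.
  have e0 : 0 < e by rewrite !lt_min ltr01 !divr_gt0// exprn_gt0.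
  have e1 : e <= 1 by rewrite ge_min lexx.
  have e2 : e * (K + 2) <= eps by rewrite -ler_pdivlMr// !ge_min lexx orbT.
  have e3 : e * (T1 * K) <= eps ^+ 2 by rewrite -ler_pdivlMr// !ge_min lexx !orbT.
  have cu : \forall t \near F, x t ^+ 2 * a t + x t ^+ 2 * b t <= 4 / s * (1 + e).
    exact: (near_scaled_upper L_gt0 x01 x0 nu_gt0 xnu opt s0 e0 Hu).
  have cl : \forall t \near F,
      (x t ^+ 2 * a t + e)^-1 + (x t ^+ 2 * b t + e)^-1 <= s + e.
    exact: (near_scaled_lower L_gt0 x01 x0 nu_gt0 xnu v_gt0 opt s0 e0 Hl).
  near=> t.
  have /andP[xt _] : 0 < x t < 1 by near: t.
  have x20 : 0 < x t ^+ 2 by rewrite exprn_gt0.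
  have [a0 b0 _ _] : total_min (weight (nu t) (x t)) v (a t) (b t) by near: t.
  have p0 : 0 < x t ^+ 2 * a t by rewrite mulr_gt0.
  have q0 : 0 < x t ^+ 2 * b t by rewrite mulr_gt0.
  have ut : x t ^+ 2 * a t + x t ^+ 2 * b t <= 4 / s * (1 + e) by near: t.
  have lt : (x t ^+ 2 * a t + e)^-1 + (x t ^+ 2 * b t + e)^-1 <= s + e by near: t.
  have [] := near_optimum_close s0 e0 e1 p0 q0 ut lt; rewrite -/K -/T1.
  move: (x t ^+ 2 * a t) (x t ^+ 2 * b t) => p q h1 h2.
  have h3 : `|p - q| <= eps.
    rewrite -(ger0_norm (ltW eps0)) -ler_sqr ?nnegrE// -!normrX.
    rewrite !ger0_norm ?sqr_ge0//; lra.
  have h4 : `|p + q - 4 / s| <= eps by lra.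
  move: h3 h4; rewrite !ler_norml => /andP[h31 h32] /andP[h41 h42].
  by split; apply/andP; split; lra.
exists (2 / s); split; first by rewrite divr_gt0.
  by apply/cvgrPdist_le => eps /key; apply: filterS => t [].
by apply/cvgrPdist_le => eps /key; apply: filterS => t [].
Unshelve. all: by end_near. Qed.

End OptimumLimit.

(** * The cases of the theorem and the endpoint zeta = 1 *)

Section MainLemmas.
Context {R : realType}.

Lemma cvgy_of_scaled (T : Type) (F : set_system T) {FF : Filter F} (y f : T -> R) (c : R) :
  0 < c -> (\forall t \near F, 0 < y t) -> y t @[t --> F] --> (0 : R) ->
  y t * f t @[t --> F] --> c -> f t @[t --> F] --> +oo.
Proof.
move=> c0 ypos y0 yf; apply/cvgryPge => A.
have A1 : 0 < `|A| + 1 by rewrite ltr_pwDr.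
have near1 : \forall t \near F, c / 2 < y t * f t by apply: (cvgr_gt _ yf); lra.
have near2 : \forall t \near F, y t < c / 2 / (`|A| + 1).
  by apply: (cvgr_lt _ y0); rewrite !divr_gt0.
near=> t.
have yt : 0 < y t by near: t.
have h1 : c / 2 < y t * f t by near: t.
have h2 : y t < c / 2 / (`|A| + 1) by near: t.
rewrite leNgt; apply/negP => fA.
rewrite ltr_pdivlMr// in h2.
have h3 : y t * f t < y t * A by rewrite ltr_pM2l.
have h4 : y t * A <= y t * (`|A| + 1).
  by rewrite ler_pM2l//; have := ler_norm A; lra.
lra.
Unshelve. all: by end_near. Qed.

Variables (acv0 arb0 b : R).
Hypotheses (acv0_gt0 : 0 < acv0) (arb0_gt0 : 0 < arb0) (arb0_lt1 : arb0 < 1) (b_ge0 : 0 <= b).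

Lemma shape_eq (n a : R) : Defs.shape n = a <-> n = 2 * a + 1.
Proof. by rewrite /Defs.shape; split=> [<-|->]; field. Qed.

Lemma shape_pair (n1 n2 a1 a2 : R) :
  (Defs.shape n1, Defs.shape n2) = (a1, a2) <-> (n1, n2) = (2 * a1 + 1, 2 * a2 + 1).
Proof.
split=> [[/shape_eq -> /shape_eq ->]//|[/shape_eq -> /shape_eq ->]//].
Qed.

Lemma optimal_degenerate z (n1 n2 : R) : z = 0 \/ z = zeta1 arb0 b ->
  optimal_sample_sizes z acv0 arb0 b n1 n2 <-> (n1, n2) = (2 * acv0 ^- 2 + 5, 1).
Proof.
move=> zz.
have z01 : 0 <= z < 1.
  case: zz => ->; first by rewrite lexx ltr01.
  have [b1|b1] := ltP b 1.
    by have /andP[/ltW -> ->] := zeta1_in arb0_gt0 arb0_lt1 b1.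
  by rewrite /zeta1 ltNge b1 lexx ltr01.
have G l m : gtilde_dagger arb0 b z (l + m) l = (m == 0%N)%:R * l`!%:R.
  have [->|z0] := eqVneq z 0; first exact: gtilde_dagger_zero.
  have z01' : 0 < z < 1 by rewrite lt_neqAle eq_sym z0.
  have nu1 : nu_dagger arb0 b z = 1.
    apply/(nu_dagger_eq1 b arb0_gt0 arb0_lt1 z01').
    by case: zz => // zz; rewrite zz eqxx in z0.
  rewrite gtilde_dagger_in// nu1; case: m => [|m].
    rewrite falling0 gcoef_nu1//; lra.
  by rewrite fallingSl subrr !mul0r.
have glt k l : (l < k)%N -> gtilde_dagger arb0 b z k l = 0.
  by move=> lk; rewrite -(subnKC (ltnW lk)) G subn_eq0 leqNgt lk mul0r.
have gdiag k : gtilde_dagger arb0 b z k k = k`!%:R.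
  by have := G k 0%N; rewrite addn0 eqxx mul1r.
have v0 : 0 < acv0 ^+ 2 by rewrite exprn_gt0.
rewrite optimal_minimises// minimises_degenerate// shape_pair.
have -> : 2 * ((acv0 ^+ 2)^-1 + 2) + 1 = 2 * acv0 ^- 2 + 5 :> R by ring.
by rewrite mulr0 add0r.
Qed.

Lemma nu_dagger_gt0 z : 0 < z < 1 -> 0 < nu_dagger arb0 b z.
Proof. by move=> zz; apply: le_lt_trans b_ge0 _; exact: nu_dagger_gt. Qed.

Lemma norm_sq_dagger z : 0 < z < 1 ->
  norm_sq (gtilde_dagger arb0 b z) = weight (nu_dagger arb0 b z) (1 - z).
Proof.
move=> zz; apply/funext => l; apply/funext => m.
by rewrite /norm_sq gtilde_dagger_in.
Qed.

Section Generic.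
Variable z : R.
Hypotheses (z01 : 0 < z < 1) (zz : z <> zeta1 arb0 b).

Let nu1 : nu_dagger arb0 b z != 1.
Proof. by apply/eqP => /(nu_dagger_eq1 b arb0_gt0 arb0_lt1 z01). Qed.

Let x01 : 0 < 1 - z < 1. Proof. by have := z01; lra. Qed.

Let g10 : gtilde_dagger arb0 b z 1 0 != 0.
Proof.
rewrite (@gtilde_dagger_in _ _ _ arb0_gt0 arb0_lt1 b_ge0 z 0 1 z01).
rewrite fallingSl falling0 mulr1 mulf_neq0 ?subr_eq0//.
by rewrite gt_eqF// gcoef_gt0// nu_dagger_gt0.
Qed.

Let g11 : gtilde_dagger arb0 b z 1 1 != 0.
Proof.
rewrite (@gtilde_dagger_in _ _ _ arb0_gt0 arb0_lt1 b_ge0 z 1 0 z01).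
by rewrite falling0 mul1r gt_eqF// gcoef_gt0// nu_dagger_gt0.
Qed.

Let dom M a c : 0 < a -> 0 < c -> sumle (norm_sq (gtilde_dagger arb0 b z)) M a c ->
  exists r M', [/\ 0 < r, r < a, r < c &
    sumle (norm_sq (gtilde_dagger arb0 b z)) M' (a - r) (c - r)].
Proof.
by rewrite norm_sq_dagger// => a0 c0; apply: weight_open => //; exact: nu_dagger_gt0.
Qed.

Lemma optimal_total_min n1 n2 : optimal_sample_sizes z acv0 arb0 b n1 n2 <->
  total_min (weight (nu_dagger arb0 b z) (1 - z)) (acv0 ^+ 2) (Defs.shape n1) (Defs.shape n2).
Proof.
have zz' : 0 <= z < 1 by have := z01; lra.
by rewrite optimal_minimises// (minimises_total_min g10 g11 dom) norm_sq_dagger.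
Qed.

Lemma optimal_generic : exists a1 a2, [/\
  forall n1 n2, optimal_sample_sizes z acv0 arb0 b n1 n2 <->
    (n1, n2) = (2 * a1 + 1, 2 * a2 + 1),
  stationary_at_fixed_total arb0 b z a1 a2 &
  (ACV2_dagger arb0 b z a1 a2 - (acv0 ^+ 2)%:E = 0)%E].
Proof.
have v0 : 0 < acv0 ^+ 2 by rewrite exprn_gt0.
have [a1 [a2 m]] := weight_min_exists (nu_dagger_gt0 z01) nu1 x01 v0.
exists a1, a2.
have m' : total_min (norm_sq (gtilde_dagger arb0 b z)) (acv0 ^+ 2) a1 a2.
  by rewrite norm_sq_dagger.
split.
- move=> n1 n2; rewrite optimal_total_min -shape_pair; split=> [m2|[-> ->]//].
  apply: total_min_uniq m2 m.
  + exact: weight_ge0.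
  + by apply: weight10 => //; exact: nu_dagger_gt0.
  + by move=> M a c a0 c0; apply: weight_open => //; exact: nu_dagger_gt0.
- exact: (total_min_stationary dom m').
- by rewrite ACV2_daggerE (total_min_value dom m') subee.
Qed.

End Generic.

Lemma id_cvg_left (c : R) : z @[z --> c^'-] --> c.
Proof.
by apply: cvg_at_left_filter; exact: cvg_id.
Qed.

Lemma one_minus_cvg : 1 - z @[z --> (1 : R)^'-] --> (0 : R).
Proof.
rewrite -(subrr (1 : R)); apply: cvgB; first exact: cvg_cst.
exact: id_cvg_left.
Qed.

Lemma near_left_one : \forall z \near (1 : R)^'-, 0 < z < 1.
Proof.
near=> z; apply/andP; split; near: z; first exact: nbhs_left_gt.
exact: nbhs_left_lt.
Unshelve. all: by end_near. Qed.

Lemma one_minus_nu_dagger_cvg :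
  (1 - z) * nu_dagger arb0 b z @[z --> (1 : R)^'-] --> - ln arb0.
Proof.
(* Squeezed between [z] and 1 by [1 - z <= - ln z <= z^-1 - 1]. *)
have r1 : (1 - z) / - ln z @[z --> (1 : R)^'-] --> (1 : R).
  apply: (@squeeze_cvgr _ _ _ _ (fun z : R => z) (fun=> 1)).
  - apply: filterS near_left_one => z /andP[z0 z1].
    have lz : 0 < - ln z by rewrite oppr_gt0; apply: ln_lt0; rewrite z0.
    have h1 : ln z <= z - 1.
      have := @le_ln1Dx R (z - 1); rewrite (_ : 1 + (z - 1) = z); last by ring.
      by apply; lra.
    have h2 : - ln z <= z^-1 - 1.
      have zV : 0 < z^-1 by rewrite invr_gt0.
      rewrite -lnV ?posrE//; have := @le_ln1Dx R (z^-1 - 1).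
      by rewrite (_ : 1 + (z^-1 - 1) = z^-1); [apply; lra|ring].
    rewrite ler_pdivlMr// ler_pdivrMr// mul1r; apply/andP; split; last lra.
    have := ler_wpM2l (ltW z0) h2; rewrite mulrBr mulfV ?gt_eqF// mulr1; lra.
  - exact: id_cvg_left.
  - exact: cvg_cst.
have H : - ln arb0 * ((1 - z) / - ln z) + (1 - z) * b @[z --> (1 : R)^'-] -->
    - ln arb0 * 1 + 0 * b.
  apply: cvgD; first by apply: cvgM => //; exact: cvg_cst.
  by apply: cvgM; [exact: one_minus_cvg|exact: cvg_cst].
rewrite mulr1 mul0r addr0 in H; apply: cvg_trans H; apply: near_eq_cvg.
apply: filterS near_left_one => z /andP[z0 z1].
have lz : ln z < 0 by apply: ln_lt0; rewrite z0.
by rewrite nu_dagger_in//; field; rewrite lt_eqF.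
Qed.

End MainLemmas.

Unset Implicit Arguments.

Theorem theorem18 (R : realType) (acv0 arb0 b : R)
  (acv0_gt0 : 0 < acv0) (arb0_gt0 : 0 < arb0) (arb0_lt1 : arb0 < 1)
  (b_ge0 : 0 <= b) :
  exists n1opt n2opt : R -> R,
    [/\ (* well-definedness of the optimal sample sizes as functions of zeta *)
        forall zeta : R, 0 <= zeta < 1 -> forall n1 n2 : R,
          optimal_sample_sizes zeta acv0 arb0 b n1 n2 <->
          (n1, n2) = (n1opt zeta, n2opt zeta),
        forall zeta : R, zeta = 0 \/ zeta = zeta1 arb0 b ->
          (n1opt zeta, n2opt zeta) = (2 * acv0 ^- 2 + 5, 1),
        forall zeta : R, 0 <= zeta < 1 -> zeta <> 0 -> zeta <> zeta1 arb0 b ->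
          exists a1opt a2opt : R,
            [/\ (n1opt zeta, n2opt zeta) = (2 * a1opt + 1, 2 * a2opt + 1),
                stationary_at_fixed_total arb0 b zeta a1opt a2opt
              & (ACV2_dagger arb0 b zeta a1opt a2opt - (acv0 ^+ 2)%:E = 0)%E]
      & (* the endpoint zeta = 1, read in the limit *)
        [/\ nu_dagger arb0 b zeta @[zeta --> 1^'-] --> +oo,
            n1opt zeta @[zeta --> 1^'-] --> +oo,
            n2opt zeta @[zeta --> 1^'-] --> +oo
          & exists c1 c2 : R, [/\ 0 < c1, 0 < c2,
              (1 - zeta) ^+ 2 * n1opt zeta @[zeta --> 1^'-] --> c1
            & (1 - zeta) ^+ 2 * n2opt zeta @[zeta --> 1^'-] --> c2]]].
Proof.
have pos (z : R) : 0 <= z < 1 -> z <> 0 -> 0 < z < 1.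
  by move=> /andP[z0 ->] zn0; rewrite lt_neqAle z0 eq_sym andbT; apply/andP; split => //; exact/eqP.
(* The interval condition sits under the existential so that [choice] gives total functions; outside
   [[0, 1)] the default is [(0, 0)]. *)
have ex (z : R) : exists p : R * R, 0 <= z < 1 -> forall n1 n2,
    optimal_sample_sizes z acv0 arb0 b n1 n2 <-> (n1, n2) = p.
  have [zz|/not_orP[z0 z1]] := pselect (z = 0 \/ z = zeta1 arb0 b).
    by exists (2 * acv0 ^- 2 + 5, 1) => _ n1 n2; exact: optimal_degenerate.
  have [z01|z01] := pselect (0 <= z < 1); last by exists (0, 0).
  have [a1 [a2 [H _ _]]] := optimal_generic acv0_gt0 arb0_gt0 arb0_lt1 b_ge0 (pos _ z01 z0) z1.
  by exists (2 * a1 + 1, 2 * a2 + 1).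
have [f Hf] := choice ex.
pose n1 z := (f z).1; pose n2 z := (f z).2.
have fE z : f z = (n1 z, n2 z) by rewrite /n1 /n2; case: (f z).
have Hn z : 0 <= z < 1 -> optimal_sample_sizes z acv0 arb0 b (n1 z) (n2 z).
  by move=> zz; apply/Hf; rewrite ?fE.
have L0 : 0 < - ln arb0 by rewrite oppr_gt0 ln_arb0.
have x01 : \forall z \near (1 : R)^'-, 0 < 1 - z < 1.
  by apply: filterS (@near_left_one R) => z /andP[z0 z1]; apply/andP; split; lra.
have x0 := @one_minus_cvg R.
have nu0 : \forall z \near (1 : R)^'-, 0 < nu_dagger arb0 b z.
  by apply: filterS (@near_left_one R) => z zz; exact: nu_dagger_gt0.
have xnu : (1 - z) * nu_dagger arb0 b z @[z --> (1 : R)^'-] --> - ln arb0.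
  exact: one_minus_nu_dagger_cvg.
have xpos : \forall z \near (1 : R)^'-, 0 < 1 - z by apply: filterS x01 => z /andP[].
have nuy : nu_dagger arb0 b z @[z --> 1^'-] --> +oo.
  exact: (cvgy_of_scaled L0 xpos x0 xnu).
have v0 : 0 < acv0 ^+ 2 by rewrite exprn_gt0.
have opt : \forall z \near (1 : R)^'-, total_min (weight (nu_dagger arb0 b z) (1 - z))
    (acv0 ^+ 2) (Defs.shape (n1 z)) (Defs.shape (n2 z)).
  (* Eventually [nu_dagger > 1], which excludes [zeta1] near 1, so the generic case applies. *)
  have /cvgryPgt/(_ 1) nu1 := nuy.
  apply: filterS2 (@near_left_one R) nu1 => z zz nu1.
  apply/(optimal_total_min acv0_gt0 arb0_gt0 arb0_lt1 b_ge0 zz).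
    move=> /(nu_dagger_eq1 b arb0_gt0 arb0_lt1 zz) e; by rewrite e ltxx in nu1.
  by apply: Hn; case/andP: zz => /ltW -> ->.
have [c [c0 ca cb]] : exists c : R, [/\ 0 < c,
    (1 - z) ^+ 2 * Defs.shape (n1 z) @[z --> 1^'-] --> c &
    (1 - z) ^+ 2 * Defs.shape (n2 z) @[z --> 1^'-] --> c].
  exact: (cvg_scaled_optimum L0 x01 x0 nu0 xnu v0 opt).
have scale (n : R -> R) : (1 - z) ^+ 2 * Defs.shape (n z) @[z --> (1 : R)^'-] --> c ->
    (1 - z) ^+ 2 * n z @[z --> (1 : R)^'-] --> 2 * c.
  move=> h; have : 2 * ((1 - z) ^+ 2 * Defs.shape (n z)) + (1 - z) ^+ 2
      @[z --> (1 : R)^'-] --> 2 * c + 0 ^+ 2.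
    apply: cvgD; last exact: cvgXr.
    by apply: cvgM => //; exact: cvg_cst.
  rewrite expr0n addr0; apply: cvg_trans; apply: near_eq_cvg; apply: nearW => z.
  by rewrite /Defs.shape; field.
have x20 : (1 - z) ^+ 2 @[z --> (1 : R)^'-] --> (0 : R).
  have : (1 - z) ^+ 2 @[z --> (1 : R)^'-] --> (0 : R) ^+ 2 by exact: cvgXr.
  by rewrite expr0n.
have x2pos : \forall z \near (1 : R)^'-, 0 < (1 - z) ^+ 2.
  by apply: filterS xpos => z h; rewrite exprn_gt0.
have c2 : 0 < 2 * c by rewrite mulr_gt0.
exists n1, n2; split.
- by move=> z zz m1 m2; rewrite (Hf _ zz) fE.
- move=> z zz; apply/(optimal_degenerate acv0_gt0 arb0_gt0 arb0_lt1 b_ge0 _ _ zz).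
  apply: Hn; case: zz => ->; first by rewrite lexx ltr01.
  have [b1|b1] := ltP b 1.
    by have /andP[/ltW -> ->] := zeta1_in arb0_gt0 arb0_lt1 b1.
  by rewrite /zeta1 ltNge b1 lexx ltr01.
- move=> z zz z0 z1.
  have [a1 [a2 [H st val]]] := optimal_generic acv0_gt0 arb0_gt0 arb0_lt1 b_ge0 (pos _ zz z0) z1.
  by exists a1, a2; split=> //; apply/H; exact: Hn.
- split=> //.
  + exact: (cvgy_of_scaled c2 x2pos x20 (scale _ ca)).
  + exact: (cvgy_of_scaled c2 x2pos x20 (scale _ cb)).
  + by exists (2 * c), (2 * c); split => //; exact: scale.
Qed.
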